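(* Let $(Y_i)_{i\in\mathbb Z}$ be a strictly stationary sequence of real-valued random variables with marginal density $f$ with respect to Lebesgue measure $\lambda$ on $\mathbb R$. Let $r\ge0$ be an integer, $(m_n)_{n\ge1}$ a sequence of positive integers, and let $f_n$ be the piecewise polynomial estimator of order $r$ on the regular partition of $]0,1]$ into $m_n$ intervals, built from functions $R_1,\dots,R_{r+1}$ (see context). Let $p>2$ and assume that $f\mathbf 1_{[0,1]}\in\mathbb L^p([0,1],\lambda)$. Let $$C_{1,p}=\sum_{i=1}^{r+1}\|R_i\|_\infty^{\frac{3p}2}\|dR_i\|^{\frac p2},\qquad C_{2,p}=\sum_{i=1}^{r+1}\|R_i\|_\infty^{p+1}\|dR_i\|^{p-1},$$ $$V_{1,p,Y}(n)=\sum_{k=0}^n(k+1)^{p-2}\beta_{1,Y}(k),\qquad V_{2,p,Y}(n)=\sum_{k=0}^n(k+1)^{p-2}\beta_{2,Y}(k).$$ Then there is a constant $C>0$ not depending on $n$ such that for all positive integers $n$, $$\mathbb E\Big(\int_0^1|f_n(x)-\mathbb E(f_n(x))|^p\,dx\Big)\le C\Big(\frac{m_n}n\Big)^{\frac p2}C_{1,p}\Big(\|f\mathbf 1_{[0,1]}\|_{p,\lambda}^{\frac{p-2}{p-1}}(V_{1,p,Y}(n))^{\frac1{p-1}}\Big)^{\frac p2}+C\Big(\frac{m_n}n\Big)^{p-1}C_{2,p}V_{2,p,Y}(n).$$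
   Context: Estimator: let $(Q_i)_{1\le i\le r+1}$ be an orthonormal basis (in $\mathbb L^2([0,1],\lambda)$) of the space of polynomials of order $r$ (degree at most $r$) on $[0,1]$; set $R_i(x)=Q_i(x)$ if $x\in]0,1]$ and $R_i(x)=0$ otherwise. For $1\le i\le r+1$, $1\le j\le m_n$, let $\varphi_{i,j}(x)=\sqrt{m_n}\,R_i(m_nx-(j-1))$, and $$X_{i,j,n}=\frac1n\sum_{k=1}^n\varphi_{i,j}(Y_k),\qquad f_n=\sum_{i=1}^{r+1}\sum_{j=1}^{m_n}X_{i,j,n}\varphi_{i,j}.$$ $\|dR_i\|$ is the total variation norm of the measure $dR_i$ on $\mathbb R$; $\|\cdot\|_{p,\lambda}$ is the $\mathbb L^p(\lambda)$-norm. Dependence coefficients: let $P$ be the law of $Y_0$, $P_{(Y_i,Y_j)}$ the law of $(Y_i,Y_j)$, $\mathcal F_\ell=\sigma(Y_i, i\le \ell)$, and let $P_{Y_k|\mathcal F_\ell}$ and $P_{(Y_i,Y_j)|\mathcal F_\ell}$ be the conditional distributions of $Y_k$ and of $(Y_i,Y_j)$ given $\mathcal F_\ell$. For a measure $Q$ and a function $g$, $Q(g)=\int g\,dQ$. Put $f_t=\mathbf 1_{]-\infty,t]}$ (for $t\in\mathbb R$) and $f_t^{(0)}=f_t-P(f_t)$, and define $$b_\ell(k)=\sup_{t\in\mathbb R}|P_{Y_k|\mathcal F_\ell}(f_t)-P(f_t)|,\qquad b_\ell(i,j)=\sup_{(s,t)\in\mathbb R^2}\big|P_{(Y_i,Y_j)|\mathcal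 F_\ell}(f_t^{(0)}\otimes f_s^{(0)})-P_{(Y_i,Y_j)}(f_t^{(0)}\otimes f_s^{(0)})\big|.$$ Then $\beta_{1,Y}(k)=\mathbb E(b_0(k))$ and $\beta_{2,Y}(k)=\max\{\beta_{1,Y}(k),\ \sup_{i>j\ge k}\mathbb E(b_0(i,j))\}$. *)

(* Defs.v *)
From HB Require Import structures.
From mathcomp Require Import all_boot all_order all_algebra.
From mathcomp Require Import all_classical all_reals all_analysis.

Set Implicit Arguments.
Unset Strict Implicit.
Unset Printing Implicit Defensive.

Import Order.TTheory GRing.Theory Num.Theory.
Import numFieldNormedType.Exports.

Local Open Scope classical_set_scope.
Local Open Scope ring_scope.
Local Open Scope ereal_scope.

Section Polynomials.
Variable R : realType.

(* For r + 1 elements the spanning clause follows from the two others; it is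
   kept so that the definition reads as "orthonormal basis". *)
Definition orthonormal_poly_basis (r : nat) (Q : 'I_r.+1 -> {poly R}) : Prop :=
  [/\ forall i, (size (Q i) <= r.+1)%N,
      forall i j, \int[@lebesgue_measure R]_(x in `[0%R, 1%R])
        ((Q i).[x] * (Q j).[x])%:E = ((i == j)%:R : R)%:E
    & forall q : {poly R}, (size q <= r.+1)%N ->
        exists a : 'I_r.+1 -> R, q = (\sum_i a i *: Q i)%R].

Definition Rfun (q : {poly R}) (x : R) : R :=
  if x \in `]0%R, 1%R] then q.[x] else 0%R.

Definition supnorm (g : R -> R) : \bar R :=
  ereal_sup (range (fun x => `|g x|%:E)).

(* The signed measure dg of a left-continuous function g: this normalization,
   rather than ]a, b], is the right one since the Rfun q are left-continuous.
   The values on the intervals [a, b[ determine nu. *)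
Definition is_stieltjes_charge (g : R -> R) (nu : {charge set R -> \bar R}) :=
  forall a b : R, (a < b)%R -> nu `[a, b[%classic = (g b - g a)%:E.

(* Total variation norm |nu|(R). Any Hahn decomposition gives the same value,
   so the choice made here is immaterial. *)
Definition tvnorm (nu : {charge set R -> \bar R}) : \bar R :=
  charge_variation (projT2 (cid (projT2 (cid (Hahn_decomposition nu))))) setT.

End Polynomials.

Section Process.
Variables (d : measure_display) (Omega : measurableType d) (R : realType).
Variables (P : probability Omega R) (Y : int -> {RV P >-> R}).

(* Equality of the laws of (Y_{t_1}, ..., Y_{t_n}) and
   (Y_{t_1 + h}, ..., Y_{t_n + h}) for the product sigma-algebra. *)
Definition strictly_stationary : Prop :=
  forall (n : nat) (t : 'I_n -> int) (h : int) (A : set (n.-tuple R)),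
    measurable A ->
    P [set w | A [tuple Y (t i + h)%R w | i < n]] =
    P [set w | A [tuple Y (t i) w | i < n]].

Definition marginal_density (f : R -> R) : Prop :=
  [/\ measurable_fun setT f, forall x, (0 <= f x)%R
    & forall (i : int) (A : set R), measurable A ->
        distribution P (Y i) A = \int[@lebesgue_measure R]_(x in A) (f x)%:E].

(* [past l] generates F_l = sigma(Y_i, i <= l); a kernel with source
   [Fsigma l] is by construction F_l-measurable. *)
Definition past (l : int) : set (set Omega) :=
  \bigcup_(i in [set i : int | (i <= l)%R])
    preimage_set_system setT (Y i) measurable.

Definition Fsigma (l : int) := g_sigma_algebraType (past l).

(* kappa is a version of the (regular) conditional distribution of Z
   given F_l. *)
Definition is_cond_dist (l : int) (d' : measure_display) (U : measurableType d')
    (Z : Omega -> U) (kappa : R.-pker (Fsigma l) ~> U) : Prop :=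
  forall (A : set Omega) (B : set U), <<s past l >> A -> measurable B ->
    \int[P]_(w in A) kappa w B = P (A `&` Z @^-1` B).

Definition f_ (t : R) (x : R) : \bar R := (\1_(`]-oo, t]%classic) x : R)%:E.

Definition f0_ (t : R) (x : R) : \bar R :=
  f_ t x - \int[distribution P (Y 0%R)]_y f_ t y.

Definition tens (g h : R -> \bar R) (z : R * R) : \bar R := g z.1 * h z.2.

Definition b1 (l : int) (kappa : R.-pker (Fsigma l) ~> R) (w : Omega) :
    \bar R :=
  ereal_sup (range (fun t : R =>
    `| \int[kappa w]_x f_ t x - \int[distribution P (Y 0%R)]_x f_ t x |)).

Definition b2 (l i j : int) (kappa : R.-pker (Fsigma l) ~> (R * R)%type)
    (w : Omega) : \bar R :=
  ereal_sup (range (fun st : R * R =>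
    `| \int[kappa w]_z tens (f0_ st.2) (f0_ st.1) z
       - \int[pushforward P (fun v => (Y i v, Y j v))]_z
           tens (f0_ st.2) (f0_ st.1) z |)).

Section Beta.
Variables (kappa1 : int -> R.-pker (Fsigma 0) ~> R)
  (kappa2 : int -> int -> R.-pker (Fsigma 0) ~> (R * R)%type).

Definition beta1 (k : int) : \bar R := \int[P]_w b1 (kappa1 k) w.

Definition beta2 (k : int) : \bar R :=
  Order.max (beta1 k)
    (ereal_sup [set x | exists i j : int,
       [/\ (j < i)%R, (k <= j)%R & x = \int[P]_w b2 i j (kappa2 i j) w]]).

Definition V1 (p : R) (n : nat) : \bar R :=
  \sum_(0 <= k < n.+1) (k.+1%:R `^ (p - 2)%R)%:E * beta1 k%:Z.

Definition V2 (p : R) (n : nat) : \bar R :=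
  \sum_(0 <= k < n.+1) (k.+1%:R `^ (p - 2)%R)%:E * beta2 k%:Z.

End Beta.

Section Estimator.
Variables (r : nat) (Q : 'I_r.+1 -> {poly R}).

(* The index j ranges over 0, ..., m - 1, and so stands for j - 1. *)
Definition phi (m : nat) (i : 'I_r.+1) (j : 'I_m) (x : R) : R :=
  (Num.sqrt m%:R * Rfun (Q i) (m%:R * x - j%:R))%R.

Definition coefX (m n : nat) (i : 'I_r.+1) (j : 'I_m) (w : Omega) : R :=
  (n%:R^-1 * \sum_(1 <= k < n.+1) phi i j (Y k%:Z w))%R.

Definition estimator (m n : nat) (w : Omega) (x : R) : R :=
  (\sum_(i < r.+1) \sum_(j < m) coefX n i j w * phi i j x)%R.

End Estimator.

End Process.

Section Constants.
Variables (R : realType) (r : nat) (Q : 'I_r.+1 -> {poly R}).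
Variable dR : 'I_r.+1 -> {charge set R -> \bar R}.

Definition C1 (p : R) : \bar R :=
  \sum_(i < r.+1)
    supnorm (Rfun (Q i)) `^ (3 * p / 2)%R * tvnorm (dR i) `^ (p / 2)%R.

Definition C2 (p : R) : \bar R :=
  \sum_(i < r.+1)
    supnorm (Rfun (Q i)) `^ (p + 1)%R * tvnorm (dR i) `^ (p - 1)%R.

End Constants.

(* Main.v *)
Require Import Defs.
From HB Require Import structures.
From mathcomp Require Import all_boot all_order all_algebra.
From mathcomp Require Import all_classical all_reals all_analysis.
From mathcomp Require Import measurable_realfun.
From mathcomp Require Import zify ring lra.

(** For each [i], the functions [phi Q i j] live on disjoint cells of length
    [m^-1].  Hence the deviation of the estimator at [x] involves the single cell
    that contains [x], and the expected loss is, up to a constant,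
    [(m / n) ^ p * m^-1] times the sum over [i] and [j] of the moments of order
    [p] of the partial sums of [g (Y k) - E g (Y k)], with [g = local_poly Q i j]
    ([estimator_loss_le]).  As the constant may depend on the polynomials, and
    [C1] and [C2] are bounded below by a positive number ([constants_gt0]), it
    remains to bound this sum of moments for the family of the cells
    ([family_moment]).

    The moments come from an inequality of Rosenthal's type
    ([moment_inequality]).  The tail of a partial sum [S n] is examined at the
    scales [x], [4 * x], [16 * x] and so on, a Lipschitz function [ramp x] playing
    the role of the indicator of [`|S n| >= x].  To pass from one scale to the
    next, the sum is cut into blocks of length proportional to [x], and a smooth
    function of the sum is expanded to the second order along each block, its
    coefficients being read off one block earlier ([ramp_step]).  What appears
    are covariances between a Lipschitz function of the stopped sum and the
    variables of the block, or their products.  The Lipschitz function is a sum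
    of its increments, each dominated by one variable [`|X l|]; so a covariance
    at distance [v] is paid with the weight [`|X l|].  This localisation is
    essential: the weights of the different cells add up to a bounded function,
    so that the sum over the [m] cells costs a constant and not a factor [m].

    Stationarity moves such an increment to time 0, where it depends on the past
    only; conditioning then replaces the later variables by integrals against
    [kappa1] or [kappa2] ([increment_cond]).  A function of bounded variation is
    a uniform limit of combinations of indicators of half-lines with a bounded
    sum of coefficients, whence the deviations of these integrals are at most
    constant multiples of [b1] and [b2] ([dev1_le], [dev2_0_le], [dev2_le]).
    Summed over the scales, all these errors give [n * V2].

    The variance term is of another nature.  For the cell [j] it is bounded by
    the integral of [B] over the event that [Y 0] is in the cell, where [B] is a
    sum of conditional deviations.  Hölder's inequality, in each cell and then
    over the cells, separates the integral of [B ^ (p - 1)], which is at most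
    [(p - 1) * V1], from the sum of the [p]-th powers of the probabilities of the
    cells, which is at most [m ^ (1 - p)] times the [p]-th power of the norm of
    the density on [0, 1] ([sum_cell_prob_le]).  This is the first term of the
    bound. *)

Set Implicit Arguments.
Unset Strict Implicit.
Unset Printing Implicit Defensive.

Import Order.TTheory GRing.Theory Num.Theory.
Import numFieldNormedType.Exports.

Local Open Scope classical_set_scope.
Local Open Scope ring_scope.

(** * Bounded measurable functions and their integrals *)

Section BoundedMeasurable.
Context d (T : measurableType d) (R : realType).
Implicit Types f g : T -> R.

Definition bounded_measurable f :=
  measurable_fun setT f /\ exists M : R, forall x, `|f x| <= M.

Lemma bmf_cst (c : R) : bounded_measurable (fun=> c).
Proof. by split; [exact: measurable_cst | exists `|c|]. Qed.

Lemma bmfD f g : bounded_measurable f -> bounded_measurable g ->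
  bounded_measurable (fun x => f x + g x).
Proof.
move=> [mf [M fM]] [mg [N gN]]; split; first exact: measurable_funD.
by exists (M + N) => x; rewrite (le_trans (ler_normD _ _))// lerD.
Qed.

Lemma bmfM f g : bounded_measurable f -> bounded_measurable g ->
  bounded_measurable (fun x => f x * g x).
Proof.
move=> [mf [M fM]] [mg [N gN]]; split; first exact: measurable_funM.
by exists (M * N) => x; rewrite normrM ler_pM.
Qed.

Lemma bmfN f : bounded_measurable f -> bounded_measurable (fun x => - f x).
Proof.
move=> [mf [M fM]]; split; first exact: measurableT_comp.
by exists M => x; rewrite normrN.
Qed.

Lemma bmfB f g : bounded_measurable f -> bounded_measurable g ->
  bounded_measurable (fun x => f x - g x).
Proof. by move=> bf bg; apply: bmfD => //; exact: bmfN. Qed.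

Lemma bmf_norm f : bounded_measurable f -> bounded_measurable (fun x => `|f x|).
Proof.
move=> [mf [M fM]]; split; first exact: measurableT_comp.
by exists M => x; rewrite normr_id.
Qed.

Lemma bmf_sum (I : Type) (s : seq I) (P : pred I) (F : I -> T -> R) :
  (forall i, P i -> bounded_measurable (F i)) ->
  bounded_measurable (fun x => \sum_(i <- s | P i) F i x).
Proof.
move=> bF; elim: s => [|i s IHs].
  under eq_fun do rewrite big_nil; exact: bmf_cst.
under eq_fun do rewrite big_cons.
by case Pi: (P i) => //; exact: bmfD (bF i Pi) IHs.
Qed.

Lemma bmf_indic (A : set T) : measurable A -> bounded_measurable (\1_A : T -> R).
Proof.
move=> mA; split; first exact: measurable_indic.
by exists 1 => x; rewrite indicE; case: (_ \in _); rewrite ?normr1 ?normr0.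
Qed.

Lemma bmf_lipschitz (phi : R -> R) (K : R) f :
  (forall a b, `|phi a - phi b| <= K * `|a - b|) ->
  bounded_measurable f -> bounded_measurable (phi \o f).
Proof.
move=> phiK [mf [M fM]].
have K0 : 0 <= K.
  by have := phiK 1 0; rewrite subr0 normr1 mulr1; apply: le_trans.
split; last first.
  exists (K * M + `|phi 0|) => x /=.
  rewrite -[phi (f x)](subrK (phi 0)) (le_trans (ler_normD _ _))// lerD2r.
  by rewrite (le_trans (phiK _ _))// subr0 ler_wpM2l.
apply: measurableT_comp => //; apply: continuous_measurable_fun => a.
apply/cvgrPdist_le => e e0; near=> b.
rewrite (le_trans (phiK _ _))// (@le_trans _ _ ((K + 1) * `|a - b|))//.
  by rewrite ler_wpM2r// lerDl.
rewrite mulrC -ler_pdivlMr; last by rewrite ltr_wpDl.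
near: b; apply: cvgr_dist_le; first exact: cvg_id.
by rewrite divr_gt0// ltr_wpDl.
Unshelve. all: by end_near. Qed.

Context (mu : {measure set T -> \bar R}).
Hypothesis mu1 : mu setT = 1%E.

Lemma bmf_integrable f : bounded_measurable f ->
  mu.-integrable setT (EFin \o f).
Proof.
move=> [mf [M fM]]; apply: measurable_bounded_integrable => //.
  by rewrite mu1 ltry.
exists M; split; first exact: num_real.
by move=> N MN x _; apply: (le_trans (fM x)); exact: ltW.
Qed.

Lemma bmf_RintegralE f : bounded_measurable f ->
  (\int[mu]_x (f x)%:E)%E = (\int[mu]_x f x)%:E.
Proof. by move=> /bmf_integrable bf; rewrite fineK// integrable_fin_num. Qed.

Lemma bmf_RintegralD f g : bounded_measurable f -> bounded_measurable g ->
  \int[mu]_x (f x + g x) = \int[mu]_x f x + \int[mu]_x g x.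
Proof. by move=> bf bg; rewrite RintegralD//; exact: bmf_integrable. Qed.

Lemma bmf_RintegralB f g : bounded_measurable f -> bounded_measurable g ->
  \int[mu]_x (f x - g x) = \int[mu]_x f x - \int[mu]_x g x.
Proof. by move=> bf bg; rewrite RintegralB//; exact: bmf_integrable. Qed.

Lemma bmf_RintegralZ f c : bounded_measurable f ->
  \int[mu]_x (c * f x) = c * \int[mu]_x f x.
Proof. by move=> bf; rewrite RintegralZl//; exact: bmf_integrable. Qed.

Lemma bmf_Rintegral_cst c : \int[mu]_x c = c.
Proof. by rewrite Rintegral_cst// mu1 mulr1. Qed.

Lemma bmf_Rintegral_sum (I : Type) (s : seq I) (P : pred I) (F : I -> T -> R) :
  (forall i, P i -> bounded_measurable (F i)) ->
  \int[mu]_x (\sum_(i <- s | P i) F i x) =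
  \sum_(i <- s | P i) \int[mu]_x F i x.
Proof.
move=> bF; elim: s => [|i s IHs].
  under eq_Rintegral do rewrite big_nil.
  by rewrite big_nil bmf_Rintegral_cst.
under eq_Rintegral do rewrite big_cons.
rewrite big_cons; case Pi: (P i) => //.
by rewrite bmf_RintegralD ?IHs//; [exact: bF | exact: bmf_sum].
Qed.

Lemma bmf_le_Rintegral f g : bounded_measurable f -> bounded_measurable g ->
  (forall x, f x <= g x) -> \int[mu]_x f x <= \int[mu]_x g x.
Proof.
by move=> bf bg fg; apply: le_Rintegral => //; exact: bmf_integrable.
Qed.

Lemma bmf_normr_Rintegral f : bounded_measurable f ->
  `|\int[mu]_x f x| <= \int[mu]_x `|f x|.
Proof. by move=> bf; apply: le_normr_Rintegral => //; exact: bmf_integrable. Qed.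

Lemma bmf_normr_Rintegral_le f g : bounded_measurable f ->
  bounded_measurable g -> (forall x, `|f x| <= g x) ->
  `|\int[mu]_x f x| <= \int[mu]_x g x.
Proof.
move=> bf bg fg; apply: le_trans (bmf_normr_Rintegral bf) _.
by apply: bmf_le_Rintegral => //; exact: bmf_norm.
Qed.

Lemma bmf_normr_Rintegral_cst f c : bounded_measurable f ->
  (forall x, `|f x| <= c) -> `|\int[mu]_x f x| <= c.
Proof.
move=> bf fc; rewrite -(bmf_Rintegral_cst c).
by apply: bmf_normr_Rintegral_le => //; exact: bmf_cst.
Qed.

End BoundedMeasurable.

(** * A moment inequality for weakly dependent sums *)

Section Truncations.
Variable R : realType.
Implicit Types x s t u : R.

(** [excess x s] is the signed distance from [s] to the interval [-x, x]; its
    square is a smooth substitute for the indicator of [x <= `|s|]. *)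
Definition excess x s := s - Num.max (- x) (Num.min s x).

(** A Lipschitz version of the indicator of [x <= `|s|]. *)
Definition ramp x s := Num.min 1 (Num.max 0 (4 / x * (`|s| - x / 2))).

Lemma excess_cases x s : 0 < x ->
  [\/ s <= - x /\ excess x s = s + x,
      (- x <= s /\ s <= x) /\ excess x s = 0 |
      x <= s /\ excess x s = s - x].
Proof.
rewrite /excess => x0; have [sx|xs] := leP s x; last first.
  by apply: Or33; rewrite max_r; [split; lra | lra].
have [sx'|xs'] := leP (- x) s; last by apply: Or31; split; lra.
by apply: Or32; split; [split|]; lra.
Qed.

Lemma excess_lipschitz x s t : 0 < x -> `|excess x s - excess x t| <= 1 * `|s - t|.
Proof.
move=> x0; rewrite mul1r; wlog st : s t / s <= t.
  move=> H; case: (leP s t) => [|/ltW] /H //.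
  by rewrite [`|s - t|]distrC [X in X <= _]distrC.
have -> : `|s - t| = t - s by rewrite distrC ger0_norm// subr_ge0.
rewrite ler_norml.
by case: (excess_cases s x0) => -[? ->]; case: (excess_cases t x0) => -[? ->];
  apply/andP; split; lra.
Qed.

Lemma excess_eq0 x s : 0 < x -> `|s| <= x -> excess x s = 0.
Proof.
by move=> x0; rewrite ler_norml => /andP[? ?]; case: (excess_cases s x0) => -[? ->]; lra.
Qed.

(** [excess x s ^+ 2] is the least value of [(s - c) ^+ 2] over [`|c| <= x]; the
    point [c] that is optimal for [s] is a competitor for [s + u]. *)
Lemma excess_sqrD x s u : 0 < x ->
  excess x (s + u) ^+ 2 <= excess x s ^+ 2 + 2 * excess x s * u + u ^+ 2.
Proof.
move=> x0; suff : excess x (s + u) ^+ 2 <= (u + excess x s) ^+ 2 by nra.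
by case: (excess_cases s x0) => -[? ->];
  case: (excess_cases (s + u) x0) => -[? ->]; nra.
Qed.

Lemma ramp_ge0 x s : 0 <= ramp x s.
Proof. by rewrite /ramp le_min ler01 le_max lexx. Qed.

Lemma ramp_le1 x s : ramp x s <= 1.
Proof. by rewrite /ramp ge_min lexx. Qed.

Lemma ramp_lipschitz x s t : 0 < x -> `|ramp x s - ramp x t| <= 4 / x * `|s - t|.
Proof.
move=> x0; have k0 : 0 < 4 / x by rewrite divr_gt0.
suff : `|ramp x s - ramp x t| <= 4 / x * `| `|s| - `|t| |.
  move=> /le_trans; apply; rewrite ler_pM2l//; exact: ler_dist_dist.
rewrite /ramp; move: (4 / x) k0 => k k0; move: (`|s|) (`|t|) => {}s {}t.
wlog st : s t / s <= t.
  move=> H; case: (leP s t) => [|/ltW] /H //.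
  by rewrite [`|s - t|]distrC [X in X <= _]distrC.
have -> : `|s - t| = t - s by rewrite distrC ger0_norm// subr_ge0.
have ks : k * s <= k * t by rewrite ler_pM2l.
rewrite ler_norml !mulrBr.
case: (leP 0 (k * s - _)) => ?; case: (leP 0 (k * t - _)) => ?.
all: case: (leP 1 _) => ?; try case: (leP 1 _) => ?; apply/andP; split; lra.
Qed.

Lemma ramp_eq0 x s : 0 < x -> `|s| <= x / 2 -> ramp x s = 0.
Proof.
move=> x0 sx; rewrite /ramp max_l; last first.
  by rewrite pmulr_rle0 ?divr_gt0// subr_le0.
by rewrite min_r.
Qed.

Lemma ramp_eq1 x s : 0 < x -> 3 / 4 * x <= `|s| -> ramp x s = 1.
Proof.
move=> x0 sx; rewrite /ramp min_l// le_max; apply/orP; right.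
rewrite mulrAC ler_pdivlMr//; lra.
Qed.

Lemma ramp_le_sqr x s : 0 < x -> ramp x s <= 4 / x ^+ 2 * s ^+ 2.
Proof.
move=> x0; have [sx|sx] := leP `|s| (x / 2).
  by rewrite ramp_eq0// mulr_ge0 ?divr_ge0 ?sqr_ge0.
rewrite (le_trans (ramp_le1 _ _))// mulrAC ler_pdivlMr ?exprn_gt0//.
by rewrite mul1r -[s ^+ 2]real_normK ?num_real//; nra.
Qed.

Lemma ramp_le_excess x s : 0 < x -> x ^+ 2 * ramp (4 * x) s <= excess x s ^+ 2.
Proof.
move=> x0; have [sx|sx] := leP `|s| (2 * x).
  by rewrite ramp_eq0 ?mulr0 ?sqr_ge0//; lra.
apply: (@le_trans _ _ (x ^+ 2)).
  by rewrite ler_piMr ?sqr_ge0 ?ramp_le1.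
by move: sx; case: ger0P => ? ?; case: (excess_cases s x0) => -[? ->]; nra.
Qed.

(** The second order expansion of [excess x ^+ 2] along one block, with both
    coefficients read off at least one block earlier.  Blocks are short against
    [x], so that either [ramp x s = 1] and the expansion is the ordinary one, or
    the sum never leaves [-x, x] and the left hand side vanishes. *)
Lemma excess_block x s v0 v1 v2 : 0 < x ->
  `|v0| <= x / 16 -> `|v1| <= x / 16 -> `|v2| <= x / 16 ->
  excess x (s + v0 + v1 + v2) ^+ 2 - excess x (s + v0 + v1) ^+ 2 <=
  2 * (excess x (s + v0) * v2) + 2 * (ramp x s * (v1 ^+ 2 + v2 ^+ 2)).
Proof.
move=> x0 v0x v1x v2x; have [sx|sx] := leP (3 / 4 * x) `|s|.
  rewrite ramp_eq1//.
  have := excess_sqrD (s + v0 + v1) v2 x0.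
  have := excess_lipschitz (s + v0 + v1) (s + v0) x0.
  rewrite (_ : s + v0 + v1 - (s + v0) = v1); last ring.
  move: (excess x (s + v0 + v1)) (excess x (s + v0)) => a b.
  rewrite mul1r => ab.
  have : (a - b) * v2 <= `|v1| * `|v2|.
    by rewrite (le_trans (ler_norm _))// normrM ler_wpM2r.
  have := real_normK (num_real v1); have := real_normK (num_real v2).
  by move: (`|v1|) (`|v2|) => y z; nra.
have e0 : excess x (s + v0) = 0.
  by rewrite excess_eq0// (le_trans (ler_normD _ _))//; lra.
have e1 : excess x (s + v0 + v1) = 0.
  rewrite excess_eq0// (le_trans (ler_normD _ _))//.
  by have := ler_normD s v0; lra.
have e2 : excess x (s + v0 + v1 + v2) = 0.
  rewrite excess_eq0// (le_trans (ler_normD _ _))//.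
  by have := ler_normD s v0; have := ler_normD (s + v0) v1; lra.
rewrite e0 e1 e2 expr0n subrr mul0r mulr0 add0r.
by rewrite !mulr_ge0 ?ramp_ge0// addr_ge0 ?sqr_ge0.
Qed.

End Truncations.

Section NatSums.
Variable R : realDomainType.
Implicit Types F y : nat -> R.

(** Grouping by lag: the bound on the covariances depends on the lag only. *)
Lemma sqr_sum_lag y N :
  (\sum_(0 <= i < N) y i) ^+ 2 =
  \sum_(0 <= i < N) \sum_(0 <= u < i.+1) (u != 0).+1%:R * (y (i - u)%N * y i).
Proof.
elim: N => [|N IHN]; first by rewrite !big_geq// expr0n.
rewrite [in LHS]big_nat_recr// [in RHS]big_nat_recr//= -IHN.
have -> : \sum_(0 <= u < N.+1) (u != 0).+1%:R * (y (N - u)%N * y N) =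
    y N ^+ 2 + 2 * (\sum_(0 <= i < N) y i) * y N.
  rewrite big_nat_recl//= subn0 mul1r -expr2; congr (_ + _).
  rewrite [in RHS]big_nat_rev mulr_sumr mulr_suml /=.
  by apply: eq_bigr => i _; rewrite add0n mulrA.
rewrite sqrrD -mulr_natl; ring.
Qed.

Lemma sum_lag_le F (t q k n : nat) : (forall v, 0 <= F v) ->
  (t + q <= k)%N -> (k <= n)%N ->
  \sum_(1 <= l < t.+1) F (k - l)%N <= \sum_(q <= v < n.+1) F v.
Proof.
move=> F0 tqk kn.
have -> : \sum_(1 <= l < t.+1) F (k - l)%N = \sum_(k - t <= v < k) F v.
  elim: t tqk => [|t IHt] tqk; first by rewrite subn0 !big_geq.
  rewrite big_nat_recr//= IHt; last by lia.
  rewrite [RHS]big_ltn; last by lia.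
  by rewrite addrC (_ : (k - t.+1).+1 = (k - t)%N)//; lia.
rewrite (@big_cat_nat _ _ _ (k - t) q n.+1)//=; [|lia|lia].
rewrite (@big_cat_nat _ _ _ k (k - t) n.+1)//=; [|lia|lia].
by rewrite addrCA lerDl addr_ge0// sumr_ge0.
Qed.

Lemma telescope_sum F n : \sum_(0 <= i < n) (F i.+1 - F i) = F n - F 0%N.
Proof. by rewrite telescope_sumr. Qed.

End NatSums.

Section WeaklyDependent.
Context d (T : measurableType d) (R : realType).
Context (mu : {measure set T -> \bar R}).
Hypothesis mu1 : mu setT = 1%E.

Definition partial_sum (X : nat -> T -> R) k w := \sum_(1 <= l < k.+1) X l w.

(** What the moment inequality uses of a sequence [X 1], ..., [X n]: the
    covariance at lag [u] is at most [c u], while [e1 v], resp. [e2 v u],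
    bounds the covariance of an increment [phi (S_l) - phi (S_(l-1))] with the
    variable at distance [v], resp. with the product of the variables at
    distances [v] and [v + u].  Such an increment is dominated by [`|X l|], and
    this is what makes [e1] and [e2] local. *)
Record weakly_dependent (n : nat) (L : R) (X : nat -> T -> R) (c e1 : nat -> R)
    (e2 : nat -> nat -> R) : Prop := WeaklyDependent {
  wd_bmf : forall k, bounded_measurable (X k);
  wd_bound : forall k w, `|X k w| <= L;
  wd_c_ge0 : forall u, 0 <= c u;
  wd_e1_ge0 : forall v, 0 <= e1 v;
  wd_e2_ge0 : forall v u, 0 <= e2 v u;
  wd_cov : forall k u, (0 < k)%N -> (k + u <= n)%N ->
    `|\int[mu]_w (X k w * X (k + u)%N w)| <= c u;
  wd_e1 : forall (phi : R -> R) (K : R) l k,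
    (forall a b, `|phi a - phi b| <= K * `|a - b|) ->
    (0 < l < k)%N -> (k <= n)%N ->
    `|\int[mu]_w ((phi (partial_sum X l w) - phi (partial_sum X l.-1 w))
                  * X k w)| <= K * e1 (k - l)%N;
  wd_e2 : forall (phi : R -> R) (K : R) l k u,
    (forall a b, `|phi a - phi b| <= K * `|a - b|) ->
    (0 < l < k)%N -> (k + u <= n)%N ->
    `|\int[mu]_w ((phi (partial_sum X l w) - phi (partial_sum X l.-1 w))
        * (X k w * X (k + u)%N w - \int[mu]_w' (X k w' * X (k + u)%N w')))|
      <= K * e2 (k - l)%N u }.

Variables (n : nat) (L : R) (X : nat -> T -> R) (c e1 : nat -> R).
Variable e2 : nat -> nat -> R.
Hypothesis wdX : weakly_dependent n L X c e1 e2.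

Local Notation S := (partial_sum X).

Definition long_variance := 2 * \sum_(0 <= u < n.+1) c u.
Definition tail1 q := \sum_(q <= v < n.+1) e1 v.
Definition tail2 q := \sum_(q <= v < n.+1) \sum_(0 <= u < q) e2 v u.

Lemma bmf_partial_sum k : bounded_measurable (S k).
Proof. by apply: bmf_sum => l _; exact: wd_bmf wdX l. Qed.

Lemma partial_sumS k w : S k.+1 w = S k w + X k.+1 w.
Proof. by rewrite /partial_sum big_nat_recr. Qed.

Lemma partial_sum0 w : S 0 w = 0.
Proof. by rewrite /partial_sum big_geq. Qed.

Lemma partial_sum_increment a N w :
  S (a + N) w - S a w = \sum_(0 <= i < N) X (a + i.+1)%N w.
Proof.
elim: N => [|N IHN]; first by rewrite addn0 subrr big_geq.
by rewrite big_nat_recr//= -IHN addnS partial_sumS addrAC.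
Qed.

Lemma partial_sum_increment_le a N w : `|S (a + N) w - S a w| <= N%:R * L.
Proof.
rewrite partial_sum_increment; apply: le_trans (ler_norm_sum _ _ _) _.
apply: (@le_trans _ _ (\sum_(0 <= i < N) L)).
  by apply: ler_sum => i _; exact: wd_bound wdX _ _.
by rewrite sumr_const_nat subn0 [leRHS]mulr_natl.
Qed.

Lemma bmf_lip_partial_sum (phi : R -> R) (K : R) k :
  (forall a b, `|phi a - phi b| <= K * `|a - b|) ->
  bounded_measurable (fun w => phi (S k w)).
Proof. by move=> phiK; exact: bmf_lipschitz phiK (bmf_partial_sum k). Qed.

Lemma long_variance_ge0 : 0 <= long_variance.
Proof. by rewrite mulr_ge0// sumr_ge0// => u _; exact: wd_c_ge0 wdX u. Qed.

Lemma tail1_ge0 q : 0 <= tail1 q.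
Proof. by rewrite sumr_ge0// => v _; exact: wd_e1_ge0 wdX v. Qed.

Lemma tail2_ge0 q : 0 <= tail2 q.
Proof. by do 2! [apply: sumr_ge0 => ? _]; exact: wd_e2_ge0 wdX _ _. Qed.

Lemma lip_sum_expand (phi : R -> R) t w : phi 0 = 0 ->
  phi (S t w) = \sum_(1 <= l < t.+1) (phi (S l w) - phi (S l.-1 w)).
Proof.
move=> phi0; rewrite big_add1/= telescope_sum partial_sum0 phi0 subr0.
by [].
Qed.

(** The increments of [phi (S t)] end at least [q] steps before [k], so that the
    errors [e1] add up to the tail from [q] on. *)
Lemma lip_sum_cov1 (phi : R -> R) (K : R) t q k : 0 <= K ->
  (forall a b, `|phi a - phi b| <= K * `|a - b|) -> phi 0 = 0 ->
  t = 0%N \/ (t + q < k)%N -> (0 < k <= n)%N ->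
  `|\int[mu]_w (phi (S t w) * X k w)| <= K * tail1 q.
Proof.
move=> K0 phiK phi0 [->|tqk] /andP[k0 kn].
  under eq_Rintegral do rewrite partial_sum0 phi0 mul0r.
  by rewrite bmf_Rintegral_cst// normr0 mulr_ge0// tail1_ge0.
under eq_Rintegral do rewrite lip_sum_expand// mulr_suml.
rewrite bmf_Rintegral_sum//; last first.
  move=> l _; apply: bmfM; last exact: wd_bmf wdX k.
  by apply: bmfB; exact: bmf_lip_partial_sum phiK.
apply: le_trans (ler_norm_sum _ _ _) _.
apply: (@le_trans _ _ (\sum_(1 <= l < t.+1) K * e1 (k - l)%N)).
  apply: ler_sum_nat => l /andP[l0 lt].
  by apply: (wd_e1 wdX) => //; lia.
rewrite -mulr_sumr ler_wpM2l// sum_lag_le//; [exact: wd_e1_ge0 wdX|lia].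
Qed.

(** The product [X k * X (k + u)] is replaced by its mean, at the price of the
    errors [e2]; the mean keeps the factor [A], and this is what makes the
    recursion over the scales contract. *)
Lemma lip_sum_cov2 (phi : R -> R) (K : R) t q k u A : 0 <= K ->
  (forall a b, `|phi a - phi b| <= K * `|a - b|) -> phi 0 = 0 ->
  `|\int[mu]_w phi (S t w)| <= A ->
  t = 0%N \/ (t + q < k)%N -> (0 < k)%N -> (k + u <= n)%N ->
  `|\int[mu]_w (phi (S t w) * (X k w * X (k + u)%N w))| <=
    A * c u + K * \sum_(q <= v < n.+1) e2 v u.
Proof.
move=> K0 phiK phi0 phiA tqk k0 kn.
have A0 : 0 <= A by exact: le_trans phiA.
have R0 : 0 <= K * \sum_(q <= v < n.+1) e2 v u.
  by rewrite mulr_ge0// sumr_ge0// => v _; exact: wd_e2_ge0 wdX _ _.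
case: tqk => [->|tqk].
  under eq_Rintegral do rewrite partial_sum0 phi0 mul0r.
  rewrite bmf_Rintegral_cst// normr0 addr_ge0// mulr_ge0//.
  exact: wd_c_ge0 wdX _.
set m := \int[mu]_w (X k w * X (k + u)%N w).
have bX j : bounded_measurable (X j) by exact: wd_bmf wdX j.
have bXX : bounded_measurable (fun w => X k w * X (k + u)%N w) by exact: bmfM.
have bXm : bounded_measurable (fun w => X k w * X (k + u)%N w - m).
  by apply: bmfB => //; exact: bmf_cst.
have bS j : bounded_measurable (fun w => phi (S j w)).
  exact: bmf_lip_partial_sum phiK.
have -> : \int[mu]_w (phi (S t w) * (X k w * X (k + u)%N w)) =
    m * \int[mu]_w phi (S t w)
    + \int[mu]_w (phi (S t w) * (X k w * X (k + u)%N w - m)).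
  rewrite -bmf_RintegralZ// -bmf_RintegralD//; first last.
  - exact: bmfM.
  - by apply: bmfM => //; exact: bmf_cst.
  by apply: eq_Rintegral => w _; ring.
apply: le_trans (ler_normD _ _) _; apply: lerD.
  by rewrite normrM mulrC ler_pM//; exact: (wd_cov wdX).
under eq_Rintegral do rewrite lip_sum_expand// mulr_suml.
rewrite bmf_Rintegral_sum//; last first.
  by move=> l _; apply: bmfM => //; exact: bmfB.
apply: le_trans (ler_norm_sum _ _ _) _.
apply: (@le_trans _ _ (\sum_(1 <= l < t.+1) K * e2 (k - l)%N u)).
  apply: ler_sum_nat => l /andP[l0 lt].
  by apply: (wd_e2 wdX) => //; lia.
rewrite -mulr_sumr ler_wpM2l// (@sum_lag_le _ (e2 ^~ u))//.
- by move=> v; exact: wd_e2_ge0 wdX _ _.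
- lia.
- lia.
Qed.

Lemma increment_cov (phi : R -> R) t q a N :
  (forall a b, `|phi a - phi b| <= 1 * `|a - b|) -> phi 0 = 0 ->
  [\/ N = 0%N, t = 0%N | (t + q <= a)%N] -> (a + N <= n)%N ->
  \int[mu]_w (phi (S t w) * (S (a + N) w - S a w)) <= N%:R * tail1 q.
Proof.
move=> phi1 phi0 tqa aNn.
under eq_Rintegral do rewrite partial_sum_increment mulr_sumr.
rewrite bmf_Rintegral_sum//; last first.
  move=> l _; apply: bmfM; last exact: wd_bmf wdX _.
  exact: bmf_lip_partial_sum phi1.
apply: (@le_trans _ _ (\sum_(0 <= i < N) tail1 q)); last first.
  by rewrite sumr_const_nat subn0 [leRHS]mulr_natl.
apply: ler_sum_nat => i /andP[_ iN]; apply: le_trans (ler_norm _) _.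
rewrite -[leRHS]mul1r; apply: lip_sum_cov1 => //; last by lia.
by case: tqa => [|->|]; [lia|left|right; lia].
Qed.

Lemma increment_sqr_cov (phi : R -> R) (K : R) t q a N A : 0 <= K ->
  (forall a b, `|phi a - phi b| <= K * `|a - b|) -> phi 0 = 0 ->
  `|\int[mu]_w phi (S t w)| <= A ->
  [\/ N = 0%N, t = 0%N | (t + q <= a)%N] -> (a + N <= n)%N -> (N <= q)%N ->
  \int[mu]_w (phi (S t w) * (S (a + N) w - S a w) ^+ 2) <=
    N%:R * (long_variance * A + 2 * (K * tail2 q)).
Proof.
move=> K0 phiK phi0 phiA tqa aNn Nq.
have A0 : 0 <= A by exact: le_trans phiA.
have bX j : bounded_measurable (X j) by exact: wd_bmf wdX j.
have bS j : bounded_measurable (fun w => phi (S j w)).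
  exact: bmf_lip_partial_sum phiK.
under eq_Rintegral do
  rewrite partial_sum_increment (sqr_sum_lag (fun i => X (a + i.+1)%N _)) mulr_sumr.
have bXX i u : bounded_measurable (fun w => phi (S t w) * ((u != 0)%N.+1%:R
    * (X (a + (i - u).+1)%N w * X (a + i.+1)%N w))).
  by apply: bmfM => //; apply: bmfM; [exact: bmf_cst|exact: bmfM].
rewrite bmf_Rintegral_sum//; last first.
  move=> i _; under eq_fun do rewrite mulr_sumr.
  exact: bmf_sum.
apply: (@le_trans _ _ (\sum_(0 <= i < N)
    (long_variance * A + 2 * (K * tail2 q)))); last first.
  by rewrite sumr_const_nat subn0 [leRHS]mulr_natl.
apply: ler_sum_nat => i /andP[_ iN].
under eq_Rintegral do rewrite mulr_sumr.
rewrite bmf_Rintegral_sum//.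
apply: (@le_trans _ _ (\sum_(0 <= u < i.+1)
    2 * (A * c u + K * \sum_(q <= v < n.+1) e2 v u))).
  apply: ler_sum_nat => u /andP[_ ui].
  under eq_Rintegral do rewrite mulrCA.
  rewrite bmf_RintegralZ//; last by do 2! apply: bmfM => //.
  have ge0 : 0 <= A * c u + K * \sum_(q <= v < n.+1) e2 v u.
    rewrite addr_ge0// mulr_ge0//; first exact: wd_c_ge0 wdX _.
    by rewrite sumr_ge0// => v _; exact: wd_e2_ge0 wdX _ _.
  apply: le_trans (ler_norm _) _; rewrite normrM ler_pM//.
    by rewrite ger0_norm// ler_nat; case: (u != 0).
  rewrite (_ : (a + i.+1)%N = (a + (i - u).+1 + u)%N); last by lia.
  apply: lip_sum_cov2 => //; [|lia|lia].
  by case: tqa => [|->|]; [lia|left|right; lia].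
rewrite -mulr_sumr big_split/= -!mulr_sumr mulrDr lerD//.
  rewrite /long_variance mulrAC -!mulrA ler_wpM2l// ler_wpM2l//.
  rewrite [leRHS](@big_cat_nat _ _ _ i.+1)//=; last by lia.
  by rewrite lerDl sumr_ge0// => u _; exact: wd_c_ge0 wdX _.
rewrite ler_wpM2l// ler_wpM2l// exchange_big/= ler_sum// => v _.
rewrite [leRHS](@big_cat_nat _ _ _ i.+1)//=; last by lia.
by rewrite lerDl sumr_ge0// => u _; exact: wd_e2_ge0 wdX _ _.
Qed.

End WeaklyDependent.

Section RampStep.
Context d (T : measurableType d) (R : realType).
Context (mu : {measure set T -> \bar R}).
Hypothesis mu1 : mu setT = 1%E.
Variables (n : nat) (L : R) (X : nat -> T -> R) (c e1 : nat -> R).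
Variable e2 : nat -> nat -> R.
Hypothesis wdX : weakly_dependent mu n L X c e1 e2.
Hypothesis L0 : 0 < L.

Local Notation S := (partial_sum X).

Lemma partial_sum_dist_le a b q w : (a <= b <= a + q)%N ->
  `|S b w - S a w| <= q%:R * L.
Proof.
move=> /andP[ab baq]; rewrite -(subnKC ab).
apply: le_trans (partial_sum_increment_le wdX _ _ _) _.
by rewrite ler_wpM2r ?(ltW L0)// ler_nat; lia.
Qed.

(** The passage from scale [x] to scale [4 * x], with blocks of length [q]
    proportional to [x]: the increment over a block is compared with the
    partial sum stopped at least [q] steps earlier, so that the dependence is
    paid at distance [q]. *)
Lemma ramp_step q A k : (0 < q)%N -> (k <= n)%N ->
  let x := 16 * L * q%:R in
  (forall j, (j <= n)%N -> \int[mu]_w ramp x (S j w) <= A) ->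
  x ^+ 2 * \int[mu]_w ramp (4 * x) (S k w) <=
  n%:R * (4 * long_variance n c * A + 2 * tail1 n e1 q + 32 / x * tail2 n e2 q).
Proof.
move=> q0 kn x SA.
have x0 : 0 < x by rewrite !mulr_gt0// ltr0n.
have x16 : x / 16 = q%:R * L by rewrite /x; field.
have rampL := fun a b => @ramp_lipschitz R x a b x0.
have excessL := fun a b => @excess_lipschitz R x a b x0.
have bS j := bmf_partial_sum wdX j.
have br j : bounded_measurable (fun w => ramp x (S j w)).
  exact: (bmf_lip_partial_sum wdX j rampL).
have be j : bounded_measurable (fun w => excess x (S j w)).
  exact: (bmf_lip_partial_sum wdX j excessL).
have be2 j : bounded_measurable (fun w => excess x (S j w) ^+ 2).
  by under eq_fun do rewrite expr2; exact: bmfM.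
have ramp0 : ramp x 0 = 0 by rewrite ramp_eq0// normr0 divr_ge0// ltW.
have excess0 : excess x 0 = 0 by rewrite excess_eq0// normr0 ltW.
have rA j : (j <= n)%N -> `|\int[mu]_w ramp x (S j w)| <= A.
  move=> jn; rewrite ger0_norm ?SA// Rintegral_ge0// => w _; exact: ramp_ge0.
have k4 : 0 <= 4 / x by rewrite divr_ge0// ltW.
pose t i := minn (i * q) k.
pose lv := long_variance n c; pose B := lv * A + 2 * (4 / x * tail2 n e2 q).
have A0 : 0 <= A by apply: le_trans (rA 0%N _).
have B0 : 0 <= B.
  apply: addr_ge0; first by rewrite mulr_ge0// (long_variance_ge0 wdX).
  by rewrite mulr_ge0// mulr_ge0// (tail2_ge0 wdX).
have tS i : (t i <= t i.+1 <= t i + q)%N by rewrite /t mulSn; lia.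
have tk i : (t i <= k)%N by rewrite /t; lia.
have incr i w : `|S (t i.+1) w - S (t i) w| <= x / 16.
  by rewrite x16; exact: partial_sum_dist_le.
have incr' i w : `|S (t i) w - S (t i.-1) w| <= x / 16.
  case: i => [|i]; last exact: incr.
  by rewrite [0.-1]/= subrr normr0 divr_ge0// ltW.
have step i : \int[mu]_w (excess x (S (t i.+1) w) ^+ 2)
      - \int[mu]_w (excess x (S (t i) w) ^+ 2) <=
    2 * ((t i.+1)%:R - (t i)%:R) * (tail1 n e1 q + B)
    + 2 * ((t i)%:R - (t i.-1)%:R) * B.
  pose V j w := S (t j.+1) w - S (t j) w.
  pose V' j w := S (t j) w - S (t j.-1) w.
  have bV j : bounded_measurable (V j) by exact: bmfB.
  have bV' j : bounded_measurable (V' j) by exact: bmfB.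
  have bV2 j : bounded_measurable (fun w => ramp x (S (t i.-2) w) * V j w ^+ 2).
    by apply: bmfM => //; under eq_fun do rewrite expr2; exact: bmfM.
  have bV'2 j : bounded_measurable (fun w => ramp x (S (t i.-2) w) * V' j w ^+ 2).
    by apply: bmfM => //; under eq_fun do rewrite expr2; exact: bmfM.
  have bE : bounded_measurable (fun w => excess x (S (t i.-1) w) * V i w).
    exact: bmfM.
  rewrite -bmf_RintegralB//.
  apply: (@le_trans _ _ (\int[mu]_w (2 * (excess x (S (t i.-1) w) * V i w)
     + 2 * (ramp x (S (t i.-2) w) * V' i w ^+ 2
            + ramp x (S (t i.-2) w) * V i w ^+ 2)))).
    apply: bmf_le_Rintegral => //.
    - exact: bmfB.
    - apply: bmfD; first by apply: bmfM => //; exact: bmf_cst.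
      by apply: bmfM; [exact: bmf_cst|exact: bmfD].
    move=> w; rewrite -(mulrDr (ramp _ _)).
    have := @excess_block R x (S (t i.-2) w) (V' i.-1 w) (V' i w) (V i w) x0
      (incr' _ _) (incr' _ _) (incr _ _).
    by rewrite /V /V' !subrKC.
  rewrite bmf_RintegralD//; first last.
  - by apply: bmfM; [exact: bmf_cst|exact: bmfD].
  - by apply: bmfM => //; exact: bmf_cst.
  rewrite !bmf_RintegralZ//; last exact: bmfD.
  rewrite bmf_RintegralD//.
  have sub j l : (j <= l)%N -> l%:R - j%:R = (l - j)%N%:R :> R.
    by move=> jl; rewrite natrB.
  have le1 : \int[mu]_w (excess x (S (t i.-1) w) * V i w) <=
      ((t i.+1)%:R - (t i)%:R) * tail1 n e1 q.
    have /andP[ti _] := tS i; rewrite sub// /V -{1}(subnKC ti).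
    apply: (increment_cov mu1 wdX) => //; last by have := tk i.+1; lia.
    case: i ti {bV2 bV'2 bE} => [|i] ti; first by apply: Or32; rewrite /t /=; lia.
    have [kiq|iqk] := leqP k (i.+1 * q).
      by apply: Or31; rewrite /t !mulSn in kiq *; lia.
    by apply: Or33; rewrite /t !mulSn /= in iqk *; lia.
  have le2 : \int[mu]_w (ramp x (S (t i.-2) w) * V' i w ^+ 2) <=
      ((t i)%:R - (t i.-1)%:R) * B.
    have ti : (t i.-1 <= t i)%N by case: (i) => [//|j]; case/andP: (tS j).
    rewrite sub// /V' -{1}(subnKC ti).
    apply: (increment_sqr_cov mu1 wdX) => //.
    - by apply: rA; rewrite (leq_trans (tk _)).
    - case: i ti {bV2 bV'2 bE le1} => [|[|i]] ti /=; [by apply: Or32; rewrite /t; lia.. |].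
      have [kiq|iqk] := leqP k (i.+1 * q).
        by apply: Or31; rewrite /t !mulSn in kiq *; lia.
      by apply: Or33; rewrite /t !mulSn /= in iqk *; lia.
    - by have := tk i; lia.
    - by case: (i) => [|j]; [rewrite subnn | have := tS j; rewrite [j.+1.-1]/=; lia].
  have le3 : \int[mu]_w (ramp x (S (t i.-2) w) * V i w ^+ 2) <=
      ((t i.+1)%:R - (t i)%:R) * B.
    have /andP[ti tiq] := tS i; rewrite sub// /V -{1}(subnKC ti).
    apply: (increment_sqr_cov mu1 wdX) => //.
    - by apply: rA; rewrite (leq_trans (tk _)).
    - case: i ti {tiq bV2 bV'2 bE le1 le2} => [|[|i]] ti /=; [by apply: Or32; rewrite /t; lia.. |].
      have [kiq|iqk] := leqP k (i.+2 * q).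
        by apply: Or31; rewrite /t !mulSn in kiq *; lia.
      by apply: Or33; rewrite /t !mulSn /= in iqk *; lia.
    - by have := tk i.+1; lia.
    - by lia.
  by lra.
apply: (@le_trans _ _ (\int[mu]_w (excess x (S k w) ^+ 2))).
  rewrite -bmf_RintegralZ//; last first.
    apply: (bmf_lip_partial_sum wdX k) => a b; apply: ramp_lipschitz.
    by rewrite mulr_gt0.
  apply: bmf_le_Rintegral => //.
    apply: bmfM; first exact: bmf_cst.
    apply: (bmf_lip_partial_sum wdX k) => a b; apply: ramp_lipschitz.
    by rewrite mulr_gt0.
  by move=> w; exact: ramp_le_excess.
have -> : \int[mu]_w (excess x (S k w) ^+ 2) =
    \sum_(0 <= i < k) (\int[mu]_w (excess x (S (t i.+1) w) ^+ 2)
                       - \int[mu]_w (excess x (S (t i) w) ^+ 2)).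
  rewrite (telescope_sum (fun i => \int[mu]_w (excess x (S (t i) w) ^+ 2))).
  have -> : t k = k by rewrite /t; nia.
  have -> : t 0%N = 0%N by rewrite /t; lia.
  under [X in _ = _ - X]eq_Rintegral do rewrite partial_sum0 excess0 expr0n.
  by rewrite bmf_Rintegral_cst// subr0.
apply: le_trans (ler_sum_nat (fun i _ => step i)) _.
rewrite big_split/= -!mulr_suml -!mulr_sumr.
rewrite (telescope_sum (fun i => (t i)%:R)).
rewrite (telescope_sum (fun i => (t i.-1)%:R)) /=.
have t0 : t 0%N = 0%N by rewrite /t; lia.
rewrite t0 !subr0.
have tn j : (t j)%:R <= n%:R :> R by rewrite ler_nat (leq_trans (tk _)).
have E0 := tail1_ge0 wdX q.
have := ler_wpM2r (addr_ge0 E0 B0) (tn k).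
have := ler_wpM2r B0 (tn k.-1).
have -> : n%:R * (4 * long_variance n c * A + 2 * tail1 n e1 q
    + 32 / x * tail2 n e2 q) = 2 * (n%:R * (tail1 n e1 q + B)) + 2 * (n%:R * B).
  by rewrite /B /lv; ring.
by move=> h1 h2; rewrite -!mulrA lerD// ler_pM2l.
Qed.

End RampStep.

Section PowerFacts.
Variable R : realType.
Implicit Types x y p : R.

Lemma powR_le p x y : 0 <= p -> 0 <= x -> x <= y -> x `^ p <= y `^ p.
Proof.
move=> p0 x0 xy; apply: ge0_ler_powR => //; rewrite nnegrE//.
exact: le_trans xy.
Qed.

Lemma powR_split2 p x : 2 < p -> 0 <= x -> x `^ p = x `^ (p - 2) * x ^+ 2.
Proof.
move=> p2 x0; rewrite -powR_mulrn// -powRD ?subrK//.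
by apply/implyP => /eqP; lra.
Qed.

Lemma powR_sqr_half p x : 0 <= x -> (x ^+ 2) `^ (p / 2) = x `^ p.
Proof. by move=> x0; rewrite -powR_mulrn// -powRrM mulrCA divff ?mulr1. Qed.

Lemma bmf_powR d (T : measurableType d) (f : T -> R) p : 0 <= p ->
  (forall w, 0 <= f w) -> bounded_measurable f ->
  bounded_measurable (fun w => f w `^ p).
Proof.
move=> p0 f0 [mf [M fM]]; split.
  exact: measurableT_comp (measurable_powR p) mf.
exists (M `^ p) => w; rewrite ger0_norm ?powR_ge0// powR_le//.
exact: le_trans (ler_norm _) (fM w).
Qed.

(** The layer cake formula for [`|s| `^ p], discretised at the scales
    [4 ^+ j * x]; below the base scale [x] the second moment is also available. *)
Lemma powR_le_ramps p x J s : 2 < p -> 0 < x -> `|s| < 4 ^+ J * x ->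
  `|s| `^ p <= Num.min (x `^ p) (x `^ (p - 2) * s ^+ 2)
    + \sum_(0 <= j < J) 4 `^ p * ((4 ^+ j * x) `^ p * ramp (4 ^+ j * x) s).
Proof.
move=> p2 x0; have p0 : 0 <= p by lra.
have term_ge0 j : 0 <= 4 `^ p * ((4 ^+ j * x) `^ p * ramp (4 ^+ j * x) s).
  by rewrite !mulr_ge0 ?powR_ge0 ?ramp_ge0.
elim: J => [|J IHJ] sJ.
  rewrite big_geq// addr0 expr0 mul1r in sJ *; have {}sJ := ltW sJ.
  rewrite le_min powR_le//= powR_split2// real_normK ?num_real//.
  by rewrite ler_wpM2r ?sqr_ge0// powR_le//; lra.
rewrite big_nat_recr//= addrA.
have [/IHJ IH|Js] := ltP `|s| (4 ^+ J * x); first by rewrite ler_wpDr.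
have y0 : 0 < 4 ^+ J * x by rewrite mulr_gt0// exprn_gt0.
rewrite ramp_eq1//; last by lra.
rewrite mulr1 -powRM ?(ltW y0)// mulrA -exprS ler_wpDl//; last first.
  by apply: powR_le => //; exact: ltW.
rewrite addr_ge0 ?sumr_ge0// le_min powR_ge0 mulr_ge0 ?powR_ge0//.
by rewrite sqr_ge0.
Qed.

End PowerFacts.

Section MomentInequality.
Context d (T : measurableType d) (R : realType).
Context (mu : {measure set T -> \bar R}).
Hypothesis mu1 : mu setT = 1%E.
Variables (n : nat) (L : R) (X : nat -> T -> R) (c e1 : nat -> R).
Variable e2 : nat -> nat -> R.
Hypothesis wdX : weakly_dependent mu n L X c e1 e2.

Local Notation S := (partial_sum X).
Local Notation lv := (long_variance n c).

Lemma partial_sum_variance k : (k <= n)%N ->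
  \int[mu]_w (S k w ^+ 2) <= k%:R * lv.
Proof.
move=> kn; have bX j : bounded_measurable (X j) by exact: wd_bmf wdX j.
have SE w : S k w = \sum_(0 <= i < k) X i.+1 w.
  by rewrite /partial_sum big_add1.
under eq_Rintegral do rewrite SE (sqr_sum_lag (fun i => X i.+1 _)).
have bXX i u : bounded_measurable (fun w => (u != 0)%N.+1%:R
    * (X (i - u).+1 w * X i.+1 w)).
  by apply: bmfM; [exact: bmf_cst|exact: bmfM].
rewrite bmf_Rintegral_sum//; last by move=> i _; exact: bmf_sum.
apply: (@le_trans _ _ (\sum_(0 <= i < k) lv)); last first.
  by rewrite sumr_const_nat subn0 [leRHS]mulr_natl.
apply: ler_sum_nat => i /andP[_ ik]; rewrite bmf_Rintegral_sum//.
apply: (@le_trans _ _ (\sum_(0 <= u < i.+1) 2 * c u)).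
  apply: ler_sum_nat => u /andP[_ ui]; rewrite bmf_RintegralZ//; last exact: bmfM.
  apply: le_trans (ler_norm _) _; rewrite normrM ler_pM//.
    by rewrite ger0_norm// ler_nat; case: (u != 0).
  rewrite (_ : i.+1 = ((i - u).+1 + u)%N); last by lia.
  by apply: (wd_cov wdX) => //; lia.
rewrite -mulr_sumr ler_wpM2l// [leRHS](@big_cat_nat _ _ _ i.+1)//=; last by lia.
by rewrite lerDl sumr_ge0// => u _; exact: wd_c_ge0 wdX _.
Qed.

End MomentInequality.

Lemma halving_sum (R : realFieldType) (z b : nat -> R) J :
  (forall j, 0 <= z j) -> (forall j, z j.+1 <= z j / 2 + b j) ->
  \sum_(0 <= j < J) z j <= 2 * z 0%N + 2 * \sum_(0 <= j < J) b j.
Proof.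
move=> z0 zS; have b_ge j : z j.+1 - z j / 2 <= b j by have := zS j; lra.
suff H : \sum_(0 <= j < J) z j + 2 * z J <=
    2 * z 0%N + 2 * \sum_(0 <= j < J) b j by have := z0 J; lra.
elim: J => [|J IHJ]; first by rewrite !big_geq//; lra.
by rewrite !big_nat_recr//=; have := b_ge J; lra.
Qed.

Definition moment_bound (R : realType) (p L C : R) : Prop :=
  forall d (T : measurableType d) (mu : {measure set T -> \bar R}) (n : nat)
    (X : nat -> T -> R) (c e1 : nat -> R) (e2 : nat -> nat -> R),
  mu setT = 1%E -> weakly_dependent mu n L X c e1 e2 ->
  \int[mu]_w (`|partial_sum X n w| `^ p) <=
  C * ((n%:R * long_variance n c) `^ (p / 2) + n%:R * long_variance n c
    + n%:R * \sum_(0 <= t < n.+1) (4 ^+ t) `^ (p - 2)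
        * (tail1 n e1 (4 ^ t) + tail2 n e2 (4 ^ t) / 4 ^+ t)).

(** A Rosenthal inequality.  One passes from the scale [x] to the scale [4 * x]
    by [ramp_step] with blocks of length [x / (16 * L)].  Above the scale
    [t0] where [n * lv] becomes small against [x ^+ 2], this step gains a
    factor [4 ^ - p / 2], so that the bounds [x ^ p * P(`|S_n| >= x)] are
    summable over the scales. *)
Theorem moment_inequality (R : realType) (p L : R) : 2 < p -> 0 < L ->
  exists2 C, 0 < C & moment_bound p L C.
Proof.
move=> p2 L0; have p0 : 0 <= p by lra.
pose M : R := 4 `^ p; have M0 : 0 < M by exact: powR_gt0.
pose x0 := 16 * L; have x0_gt0 : 0 < x0 by rewrite mulr_gt0.
pose C1 := (128 * M) `^ (p / 2) + 4 * x0 `^ (p - 2).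
pose C3 := x0 `^ (p - 2) * (2 + 2 / L).
exists ((1 + 2 * M) * C1 + 2 * M * M * C3).
  have C1_gt0 : 0 < C1 by rewrite addr_gt0 ?mulr_gt0 ?powR_gt0 ?mulr_gt0.
  have C3_gt0 : 0 < C3 by rewrite mulr_gt0 ?powR_gt0 ?addr_gt0 ?divr_gt0.
  apply: addr_gt0; last by do ![apply: mulr_gt0 => //].
  by apply: mulr_gt0 => //; apply: addr_gt0 => //; exact: mulr_gt0.
move=> d T mu n X c e1 e2 mu1 wdX.
set lv := long_variance n c; have lv0 : 0 <= lv by exact: long_variance_ge0 wdX.
set S := partial_sum X.
pose x t : R := 4 ^+ t * x0.
have x_gt0 t : 0 < x t by rewrite mulr_gt0// exprn_gt0.
have xS t : x t.+1 = 4 * x t by rewrite /x exprS mulrA.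
pose G t := x t `^ (p - 2) * (2 * tail1 n e1 (4 ^ t) + 32 / x t * tail2 n e2 (4 ^ t)).
have G0 t : 0 <= G t.
  rewrite mulr_ge0 ?powR_ge0// addr_ge0// mulr_ge0//.
  - exact: tail1_ge0 wdX _.
  - by rewrite divr_ge0// ltW.
  - exact: tail2_ge0 wdX _.
(* The constant [8 * 4 ^ p] turns [4 * lv * n / x ^ 2], the coefficient of the
   previous scale in [ramp_step], into at most half of [4 ^ - p]. *)
pose ok t := M * 8 * (n%:R * lv) <= x t ^+ 2.
have ok_mono t t' : (t <= t')%N -> ok t -> ok t'.
  move=> tt' /le_trans; apply; rewrite ler_pXn2r ?nnegrE ?(ltW (x_gt0 _))//.
  by rewrite ler_pM2r// ler_weXn2l// ler1n.
have /ex_minnP[t0 okt0 t0_min] : exists t, ok t.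
  pose B := M * 8 * (n%:R * lv) / x0 ^+ 2.
  exists (Num.truncn B).+1; rewrite /ok /x exprMn -ler_pdivrMr ?exprn_gt0//.
  rewrite -/B (le_trans (ltW (truncnS_gt B)))//.
  rewrite -exprM -natrX ler_nat (leq_trans (ltnW (ltn_expl _ (isT : 1 < 4)%N)))//.
  by rewrite leq_exp2l// leq_pmulr.
(* At the base scale, minimality of [t0] bounds [x t0 ^+ 2] by [n * lv], unless
   [t0 = 0], where Chebyshev's inequality takes over. *)
pose Z := if t0 == 0%N then 4 * (x 0%N `^ (p - 2) * (n%:R * lv)) else x t0 `^ p.
have nlv0 : 0 <= n%:R * lv by rewrite mulr_ge0.
have Z0 : 0 <= Z.
  rewrite /Z; case: ifP => _; last exact: powR_ge0.
  by apply: mulr_ge0 => //; apply: mulr_ge0 => //; exact: powR_ge0.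
(* [z j] bounds [x ^ p] times the expected ramp at the scale [x (j + t0)]: the
   contraction factor [1 / 2] comes from [ok], the error [G] from [ramp_step]. *)
pose z := fix z j := if j is j'.+1 then z j' / 2 + M * n%:R * G (j' + t0)%N else Z.
have z_ge0 j : 0 <= z j.
  elim: j => //= j IHj; rewrite addr_ge0 ?divr_ge0//.
  by rewrite mulr_ge0// mulr_ge0// ltW.
have bramp y k : 0 < y -> bounded_measurable (fun w => ramp y (S k w)).
  by move=> y0; apply: (bmf_lip_partial_sum wdX k) => a b; exact: ramp_lipschitz.
have bS2 k : bounded_measurable (fun w => S k w ^+ 2).
  by under eq_fun do rewrite expr2; apply: bmfM; exact: bmf_partial_sum wdX k.
have scale j k : (k <= n)%N ->
    x (j + t0)%N `^ p * \int[mu]_w ramp (x (j + t0)%N) (S k w) <= z j.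
  elim: j k => [|j IHj] k kn.
    rewrite add0n /= /Z; case: eqP => [t00|_]; last first.
      rewrite ler_piMr ?powR_ge0// -(bmf_Rintegral_cst mu1 1).
      by apply: bmf_le_Rintegral => //; [exact: bramp|exact: bmf_cst|
        move=> w; exact: ramp_le1].
    rewrite t00 (powR_split2 p2 (ltW (x_gt0 _))) -mulrA [leRHS]mulrCA ler_wpM2l ?powR_ge0//.
    apply: (@le_trans _ _ (x 0%N ^+ 2 * (4 / x 0%N ^+ 2 * (k%:R * lv)))).
      rewrite ler_wpM2l ?sqr_ge0//.
      apply: le_trans (_ : 4 / x 0%N ^+ 2 * \int[mu]_w (S k w ^+ 2) <= _); last first.
        rewrite ler_wpM2l ?divr_ge0 ?sqr_ge0//.
        exact: (partial_sum_variance mu1 wdX kn).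
      rewrite -bmf_RintegralZ//; apply: bmf_le_Rintegral => //; first exact: bramp.
        by apply: bmfM => //; exact: bmf_cst.
      by move=> w; exact: ramp_le_sqr.
    have -> : x 0%N ^+ 2 * (4 / x 0%N ^+ 2 * (k%:R * lv)) = 4 * (k%:R * lv).
      by field; rewrite gt_eqF.
    by rewrite ler_wpM2l// ler_wpM2r// ler_nat.
  set y := x (j + t0)%N in IHj.
  have y0 : 0 < y by exact: x_gt0.
  have yp0 : 0 < y `^ p by exact: powR_gt0.
  have q0 : (0 < 4 ^ (j + t0))%N by rewrite expn_gt0.
  have yE : 16 * L * (4 ^ (j + t0))%:R = y by rewrite natrX mulrC.
  have := @ramp_step _ _ _ mu mu1 n L X c e1 e2 wdX L0 (4 ^ (j + t0))%N
    (z j / y `^ p) k q0 kn.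
  rewrite /= yE -/lv => /(_ _)/wrap[].
    by move=> i ni; rewrite ler_pdivlMr// mulrC IHj.
  move=> step; rewrite addSn xS -/y powRM ?(ltW y0)// -/M.
  have := ler_wpM2l (mulr_ge0 (ltW M0) (powR_ge0 y (p - 2))) step.
  rewrite (_ : _ * (y ^+ 2 * _) =
    M * y `^ p * \int[mu]_w ramp (4 * y) (S k w)); last first.
    by rewrite (powR_split2 p2 (ltW y0)) !mulrA.
  move=> /le_trans; apply; rewrite /= -/y.
  have okj : M * 8 * (n%:R * lv) <= y ^+ 2 by apply: ok_mono okt0; rewrite leq_addl.
  have -> : M * y `^ (p - 2) * (n%:R * (4 * lv * (z j / y `^ p)
      + 2 * tail1 n e1 (4 ^ (j + t0)) + 32 / y * tail2 n e2 (4 ^ (j + t0)))) =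
      (M * 8 * (n%:R * lv)) / y ^+ 2 * (z j / 2) + M * n%:R * G (j + t0)%N.
    rewrite /G -/y (powR_split2 p2 (ltW y0)); field.
    by rewrite !gt_eqF// powR_gt0.
  by rewrite lerD2r ler_piMl ?divr_ge0// ler_pdivrMr ?exprn_gt0// mul1r.
have SnL w : `|S n w| < 4 ^+ (n.+1 - t0) * x t0.
  have := partial_sum_increment_le wdX 0 n w.
  rewrite add0n partial_sum0 subr0 => /le_lt_trans; apply.
  rewrite /x mulrA -exprD /x0 mulrA ltr_pM2r//.
  apply: (@lt_le_trans _ _ (4 ^+ n.+1)).
    by rewrite -natrX ltr_nat (ltn_trans _ (ltn_expl _ _)).
  apply: (@le_trans _ _ (4 ^+ (n.+1 - t0 + t0))).
    by rewrite ler_weXn2l ?ler1n//; lia.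
  by rewrite ler_peMr ?exprn_ge0// ler1n.
pose base s : R := Num.min (x t0 `^ p) (x t0 `^ (p - 2) * s ^+ 2).
pose rhs w := base (S n w) + \sum_(0 <= j < n.+1 - t0)
  M * (x (j + t0)%N `^ p * ramp (x (j + t0)%N) (S n w)).
have bbase : bounded_measurable (fun w => base (S n w)).
  split.
    apply: measurable_minr; first exact: measurable_cst.
    by apply: measurable_funM; [exact: measurable_cst|exact: (bS2 n).1].
  exists (x t0 `^ p) => w; rewrite ger0_norm /base ?ge_min ?lexx//.
  by rewrite le_min powR_ge0 mulr_ge0 ?powR_ge0 ?sqr_ge0.
have bterm j : bounded_measurable
    (fun w => M * (x (j + t0)%N `^ p * ramp (x (j + t0)%N) (S n w))).
  by do 2! [apply: bmfM; first exact: bmf_cst]; exact: bramp.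
have int_base : \int[mu]_w base (S n w) <= Z.
  rewrite /Z; case: eqP => [t00|_]; last first.
    rewrite -(bmf_Rintegral_cst mu1 (x t0 `^ p)).
    apply: bmf_le_Rintegral => //; first exact: bmf_cst.
    by move=> w; rewrite /base ge_min lexx.
  have -> : 4 * (x 0%N `^ (p - 2) * (n%:R * lv)) =
     x 0%N `^ (p - 2) * (4 * (n%:R * lv)) by ring.
  apply: (@le_trans _ _ (x 0%N `^ (p - 2) * \int[mu]_w (S n w ^+ 2))).
    rewrite -bmf_RintegralZ//; apply: bmf_le_Rintegral => //.
      by apply: bmfM => //; exact: bmf_cst.
    by move=> w; rewrite /base t00 ge_min lexx orbT.
  rewrite ler_wpM2l ?powR_ge0//.
  by have := partial_sum_variance mu1 wdX (leqnn n); rewrite -/lv -/S; lra.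
have int_le : \int[mu]_w (`|S n w| `^ p) <=
    Z + M * \sum_(0 <= j < n.+1 - t0) z j.
  apply: (@le_trans _ _ (\int[mu]_w rhs w)).
    apply: bmf_le_Rintegral => //.
    - apply: bmf_powR => //; apply: bmf_norm; exact: bmf_partial_sum wdX n.
    - by apply: bmfD => //; exact: bmf_sum.
    move=> w; have := powR_le_ramps p2 (x_gt0 t0) (SnL w).
    rewrite /rhs /base /x => /le_trans; apply; rewrite lerD2l.
    by apply: ler_sum => j _; rewrite !mulrA -exprD.
  rewrite /rhs bmf_RintegralD//; last exact: bmf_sum.
  rewrite lerD// bmf_Rintegral_sum// mulr_sumr ler_sum// => j _.
  rewrite bmf_RintegralZ//; last first.
    by apply: bmfM; [exact: bmf_cst|exact: bramp].
  rewrite bmf_RintegralZ//; last exact: bramp.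
  by rewrite ler_pM2l// scale.
apply: (le_trans int_le).
have := @halving_sum _ z (fun j => M * n%:R * G (j + t0)%N) (n.+1 - t0) z_ge0
  (fun j => lexx _).
rewrite -mulr_sumr [z 0%N]/= => sum_z.
have sumG : \sum_(0 <= j < n.+1 - t0) G (j + t0)%N <= \sum_(0 <= t < n.+1) G t.
  rewrite -(big_addn 0 _ _ xpredT) add0n.
  have [t0n|nt0] := leqP t0 n.+1; last by rewrite big_geq ?sumr_ge0// ltnW.
  by rewrite [leRHS](@big_cat_nat _ _ _ t0)//= lerDr sumr_ge0.
pose U := \sum_(0 <= t < n.+1) (4 ^+ t) `^ (p - 2)
        * (tail1 n e1 (4 ^ t) + tail2 n e2 (4 ^ t) / 4 ^+ t).
have GU : \sum_(0 <= t < n.+1) G t <= C3 * U.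
  rewrite mulr_sumr ler_sum// => t _; rewrite /G /x powRM ?exprn_ge0// ?(ltW x0_gt0)//.
  have E1 := tail1_ge0 wdX (4 ^ t); have E2 := tail2_ge0 wdX (4 ^ t).
  have t4 : 0 < 4 ^+ t :> R by rewrite exprn_gt0.
  have E2t : 0 <= tail2 n e2 (4 ^ t) / 4 ^+ t by rewrite divr_ge0// ltW.
  rewrite [_ `^ _ * x0 `^ _]mulrC /C3 -!mulrA ler_wpM2l ?powR_ge0//.
  rewrite [leRHS]mulrCA ler_wpM2l ?powR_ge0//.
  have -> : 32 * ((4 ^+ t * x0)^-1 * tail2 n e2 (4 ^ t)) =
      2 / L * (tail2 n e2 (4 ^ t) / 4 ^+ t).
    by rewrite /x0; field; rewrite !gt_eqF.
  have L1 : 0 <= 2 / L by rewrite divr_ge0// ltW.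
  by rewrite mulrDl !mulrDr; nra.
have ZC : Z <= C1 * ((n%:R * lv) `^ (p / 2) + n%:R * lv).
  rewrite /C1; have K0 : 0 <= (128 * M) `^ (p / 2) by exact: powR_ge0.
  have K1 : 0 <= 4 * x0 `^ (p - 2) by rewrite mulr_ge0// powR_ge0.
  have K2 : 0 <= (n%:R * lv) `^ (p / 2) by exact: powR_ge0.
  rewrite /Z; case: eqP => [_|/eqP t00].
    by rewrite /x expr0 mul1r mulrA; nra.
  suff : x t0 `^ p <= (128 * M) `^ (p / 2) * (n%:R * lv) `^ (p / 2) by nra.
  rewrite -powRM//; last by rewrite mulr_ge0// ltW.
  rewrite -(powR_sqr_half p (ltW (x_gt0 t0))) powR_le ?sqr_ge0 ?divr_ge0//.
  case: t0 t00 t0_min {okt0 Z Z0 z z_ge0 scale SnL base rhs bbase bterm int_base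
    int_le sum_z sumG} => // t _ t0_min.
  have : ~~ ok t by apply/negP => /t0_min; rewrite ltnn.
  by rewrite /ok -ltNge xS => ?; nra.
have nR0 : 0 <= n%:R :> R by [].
have U0 : 0 <= U.
  rewrite sumr_ge0// => t _; rewrite mulr_ge0 ?powR_ge0// addr_ge0//.
    exact: tail1_ge0 wdX _.
  by rewrite divr_ge0 ?exprn_ge0//; exact: tail2_ge0 wdX _.
have C30 : 0 <= C3 by rewrite mulr_ge0 ?powR_ge0// addr_ge0// divr_ge0// ltW.
have C10 : 0 <= C1 by rewrite addr_ge0// ?mulr_ge0// powR_ge0.
have V0 : 0 <= (n%:R * lv) `^ (p / 2) + n%:R * lv by rewrite addr_ge0// powR_ge0.
rewrite -/U; move: V0 ZC; set V := (_ `^ _ + _) => V0 ZC.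
apply: (@le_trans _ _ (Z + M * (2 * Z + 2 * (M * n%:R * (C3 * U))))).
  rewrite lerD2l ler_pM2l// (le_trans sum_z)// lerD2l ler_pM2l//.
  by rewrite ler_wpM2l ?mulr_ge0 ?(ltW M0)// (le_trans sumG).
have K0 : 0 <= 1 + 2 * M by rewrite addr_ge0// mulr_ge0// ltW.
have K1 : 0 <= 2 * M * M * C3 by apply: mulr_ge0 => //; nra.
have h := ler_wpM2l K0 ZC.
have nU0 : 0 <= n%:R * U by rewrite mulr_ge0.
have h2 : 0 <= (1 + 2 * M) * C1 * (n%:R * U).
  by apply: mulr_ge0 => //; exact: mulr_ge0.
have h3 : 0 <= 2 * M * M * C3 * V by apply: mulr_ge0.
apply: (@le_trans _ _ ((1 + 2 * M) * (C1 * V) + 2 * M * M * C3 * (n%:R * U))).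
  by apply: le_trans (lerD h (lexx _)); rewrite le_eqVlt; apply/orP; left; apply/eqP; ring.
rewrite (_ : (_ + _) * (V + _) = (1 + 2 * M) * (C1 * V)
   + 2 * M * M * C3 * (n%:R * U) + ((1 + 2 * M) * C1 * (n%:R * U)
   + 2 * M * M * C3 * V)); last by ring.
by rewrite lerDl addr_ge0.
Qed.

(** * Linear functionals on bounded measurable functions *)

Section BoundedFunctionals.
Context d (T : measurableType d) (R : realType).
Implicit Types (f g : T -> R) (La : (T -> R) -> R).

(** Integrals, conditional integrals and their differences all have this form;
    the theory is used to reduce identities to indicators, and estimates to
    indicators of half-lines. *)
Record bounded_functional La (K : R) : Prop := BoundedFunctional {
  bfD : forall f g, bounded_measurable f -> bounded_measurable g ->
    La (fun x => f x + g x) = La f + La g;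
  bfZ : forall (c : R) f, bounded_measurable f -> La (fun x => c * f x) = c * La f;
  bf_le : forall f (M : R), bounded_measurable f -> (forall x, `|f x| <= M) ->
    `|La f| <= K * M }.

Lemma bf_sum La K (I : Type) (s : seq I) (c : I -> R) (F : I -> T -> R) :
  bounded_functional La K -> (forall i, bounded_measurable (F i)) ->
  La (fun x => \sum_(i <- s) c i * F i x) = \sum_(i <- s) c i * La (F i).
Proof.
move=> bLa bF; have bcF i : bounded_measurable (fun x => c i * F i x).
  by apply: bmfM => //; exact: bmf_cst.
elim: s => [|i s IHs].
  under eq_fun do rewrite big_nil -(mul0r 0).
  by rewrite big_nil (bfZ bLa 0 (bmf_cst T 0)) mul0r.
under eq_fun do rewrite big_cons.
rewrite big_cons (bfD bLa)//; last exact: bmf_sum.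
by rewrite (bfZ bLa)// IHs.
Qed.

Lemma bf_dist_le La K f g e : bounded_functional La K ->
  bounded_measurable f -> bounded_measurable g ->
  (forall x, `|f x - g x| <= e) -> `|La f - La g| <= K * e.
Proof.
move=> bLa bf bg fge.
have -> : La f - La g = La (fun x => f x + (-1) * g x).
  rewrite (bfD bLa) ?(bfZ bLa) ?mulN1r//.
  by apply: bmfM => //; exact: bmf_cst.
apply: (bf_le bLa); last by move=> x; rewrite mulN1r.
by apply: bmfD => //; apply: bmfM => //; exact: bmf_cst.
Qed.

Lemma bf_ge0 La K : bounded_functional La K -> 0 <= K.
Proof.
move=> bLa; have := bf_le bLa (bmf_cst T 1) (fun=> lexx `|1|).
by rewrite normr1 mulr1; apply: le_trans.
Qed.

Lemma bfB La1 La2 K1 K2 : bounded_functional La1 K1 ->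
  bounded_functional La2 K2 ->
  bounded_functional (fun f => La1 f - La2 f) (K1 + K2).
Proof.
move=> b1 b2; split.
- by move=> f g bf bg; rewrite (bfD b1)// (bfD b2)//; ring.
- by move=> c f bf; rewrite (bfZ b1)// (bfZ b2)// mulrBr.
move=> f M bf fM; rewrite (le_trans (ler_normB _ _))// mulrDl lerD//.
  exact: (bf_le b1).
exact: (bf_le b2).
Qed.

(** The values of [f] are rounded down to a grid of mesh [e]. *)
Lemma bmf_simple_approx f e : 0 < e -> bounded_measurable f ->
  exists N (c : nat -> R) (A : nat -> set T), (forall i, measurable (A i)) /\
    forall x, `|f x - \sum_(0 <= i < N) c i * \1_(A i) x| <= e.
Proof.
move=> e0 [mf [M fM]].
pose A i := f @^-1` `[e * i%:R - M, e * i.+1%:R - M[.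
exists (Num.truncn (2 * M / e)).+1, (fun i => e * i%:R - M), A; split=> [i|x].
  by rewrite -[A i]setTI; exact: mf.
have /andP[Mf fM'] : - M <= f x <= M by rewrite -ler_norml.
pose y := (f x + M) / e.
have y0 : 0 <= y by rewrite divr_ge0 ?(ltW e0)// -lerBlDr sub0r.
have /andP[ky yk] := truncn_itv y0; set k := Num.truncn y in ky yk.
have fxE : f x = e * y - M by rewrite /y; field; rewrite gt_eqF.
have AE i : \1_(A i) x = (i == k)%:R :> R.
  rewrite indicE; congr ((nat_of_bool _)%:R); apply/idP/eqP => [|->]; rewrite inE /A /=.
    rewrite in_itv/= fxE lerD2r ltrD2r !(ler_pM2l, ltr_pM2l)// => /andP[iy yi].
    have := le_lt_trans ky yi; have := le_lt_trans iy yk.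
    by rewrite !ltr_nat !ltnS => ? ?; apply/eqP; rewrite eqn_leq; apply/andP.
  by rewrite in_itv/= fxE lerD2r ltrD2r !(ler_pM2l, ltr_pM2l)// ky yk.
have kN : (k < (Num.truncn (2 * M / e)).+1)%N.
  by rewrite ltnS le_truncn// ler_pM2r ?invr_gt0//; lra.
under eq_bigr do rewrite AE.
rewrite big_mkord (bigD1 (Ordinal kN))//= eqxx mulr1 big1 ?addr0; last first.
  by move=> i; rewrite -val_eqE/= => /negPf->; rewrite mulr0.
have -> : f x - (e * k%:R - M) = e * (y - k%:R) by rewrite fxE; ring.
rewrite ger0_norm; last by rewrite mulr_ge0 ?(ltW e0)// subr_ge0.
by rewrite ler_piMr ?(ltW e0)// lerBlDl natr1 ltW.
Qed.

Lemma bf_eq0 La K : bounded_functional La K ->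
  (forall A, measurable A -> La \1_A = 0) ->
  forall f, bounded_measurable f -> La f = 0.
Proof.
move=> bLa La1 f bf; apply/eqP; rewrite -normr_le0.
apply/ler_addgt0Pl => e e0; rewrite addr0.
have K0 := bf_ge0 bLa; have K1 : 0 < K + 1 by rewrite ltr_wpDl.
have [N [c [A [mA fA]]]] := bmf_simple_approx (divr_gt0 e0 K1) bf.
have bA i : bounded_measurable (\1_(A i) : T -> R) by exact: bmf_indic.
have bs : bounded_measurable (fun x => \sum_(0 <= i < N) c i * \1_(A i) x).
  by apply: bmf_sum => i _; apply: bmfM => //; exact: bmf_cst.
have := bf_dist_le bLa bf bs fA.
rewrite (bf_sum _ _ bLa)// big1 ?subr0; last by move=> i _; rewrite La1// mulr0.
move=> /le_trans; apply; rewrite mulrCA ler_piMr ?(ltW e0)//.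
by rewrite ler_pdivrMr// mul1r lerDl.
Qed.

End BoundedFunctionals.

Lemma bf_Rintegral d (T : measurableType d) (R : realType)
    (mu : {measure set T -> \bar R}) : mu setT = 1%E ->
  bounded_functional (fun f : T -> R => \int[mu]_x f x) 1.
Proof.
move=> mu1; split=> [f g bf bg|c f bf|f M bf fM].
- exact: bmf_RintegralD.
- exact: bmf_RintegralZ.
- by rewrite mul1r; exact: bmf_normr_Rintegral_cst.
Qed.

Lemma bmf_comp d (T : measurableType d) d' (U : measurableType d') (R : realType)
    (h : U -> R) (Z : T -> U) : measurable_fun setT Z ->
  bounded_measurable h -> bounded_measurable (fun w => h (Z w)).
Proof. by move=> mZ [mh [N hN]]; split; [exact: measurableT_comp|exists N]. Qed.

Lemma bf_comp d (T : measurableType d) d' (U : measurableType d') (R : realType)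
    (La : (T -> R) -> R) K (Z : T -> U) (A : T -> R) M :
  bounded_functional La K -> measurable_fun setT Z -> bounded_measurable A ->
  (forall w, `|A w| <= M) ->
  bounded_functional (fun h : U -> R => La (fun w => A w * h (Z w))) (K * M).
Proof.
move=> bLa mZ bA AM; have K0 := bf_ge0 bLa.
have bhZ h := @bmf_comp _ _ _ _ _ h Z mZ.
split=> [f g bf bg|c f bf|f N bf fN].
- under eq_fun do rewrite mulrDr.
  by rewrite (bfD bLa)//; apply: bmfM => //; exact: bhZ.
- under eq_fun do rewrite mulrCA.
  by rewrite (bfZ bLa)//; apply: bmfM => //; exact: bhZ.
- rewrite -mulrA; apply: (bf_le bLa); first by apply: bmfM => //; exact: bhZ.
  by move=> w; rewrite normrM ler_pM.
Qed.

(** * Conditioning on the past and stationarity *)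

Section PastSigmaAlgebra.
Context d (Omega : measurableType d) (R : realType) (P : probability Omega R).
Variable Y : int -> {RV P >-> R}.

Lemma past_measurable l A : <<s past Y l >> A -> measurable A.
Proof.
apply: smallest_sub; first exact: sigma_algebra_measurable.
move=> _ [i _ [B mB <-]]; exact: measurable_funPT.
Qed.

Lemma measurable_fun_past l d' (U : measurableType d')
    (A : Omega -> U) :
  measurable_fun [set: Fsigma Y l] (A : Fsigma Y l -> U) ->
  measurable_fun [set: Omega] A.
Proof.
by move=> mA _ B mB; exact: (@past_measurable l _ (mA measurableT B mB)).
Qed.

Lemma bmf_past l (A : Omega -> R) :
  bounded_measurable (A : Fsigma Y l -> R) -> bounded_measurable A.
Proof. by move=> [mA bA]; split=> //; exact: measurable_fun_past mA. Qed.

Lemma measurable_past_RV l i : (i <= l)%R ->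
  measurable_fun [set: Fsigma Y l] (Y i : Fsigma Y l -> R).
Proof.
by move=> il _ B mB; apply: sub_sigma_algebra; exists i => //; exists B.
Qed.

Section Kernel.
Variable l : int.
Context d' (U : measurableType d') (Z : Omega -> U).
Variable kappa : R.-pker (Fsigma Y l) ~> U.
Hypothesis mZ : measurable_fun setT Z.
Hypothesis kappaZ : is_cond_dist Z kappa.

Lemma bmf_kernel (h : U -> R) : bounded_measurable h ->
  bounded_measurable ((fun w => \int[kappa w]_u h u) : Fsigma Y l -> R).
Proof.
move=> bh; have k1 w : kappa w setT = 1%E by exact: prob_kernel.
have [mh [M hM]] := bh; split; last first.
  by exists M => w; exact: bmf_normr_Rintegral_cst.
have -> : (fun w => \int[kappa w]_u h u) =
    (fun w => fine (\int[kappa w]_u (h u + M)%:E)%E - M).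
  apply/funext => w; rewrite -[fine _]/(\int[kappa w]_u (h u + M)).
  by rewrite bmf_RintegralD ?bmf_Rintegral_cst ?addrK//; exact: bmf_cst.
apply: measurable_funB; last exact: measurable_cst.
apply: (measurableT_comp (fine_measurable measurableT)).
apply: (@measurable_fun_integral_kernel _ _ (Fsigma Y l) U R kappa).
- by move=> B mB; exact: measurable_kernel.
- by move=> u; rewrite lee_fin -lerBlDr sub0r; have := hM u; rewrite ler_norml => /andP[].
- by apply/measurable_EFinP; apply: measurable_funD => //; exact: measurable_cst.
Qed.

Lemma Rintegral_indic d1 (T : measurableType d1) (mu : {measure set T -> \bar R})
    (B : set T) : measurable B -> \int[mu]_u (\1_B u) = fine (mu B).
Proof. by move=> mB; rewrite /Rintegral integral_indic// setIT. Qed.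

(** The defining property of a conditional distribution, extended from sets to
    bounded functions by linearity and uniform approximation. *)
Lemma cond_int (A : Omega -> R) (h : U -> R) :
  bounded_measurable (A : Fsigma Y l -> R) -> bounded_measurable h ->
  \int[P]_w (A w * h (Z w)) = \int[P]_w (A w * \int[kappa w]_u h u).
Proof.
have P1 : P setT = 1%E by exact: probability_setT.
have bP := bf_Rintegral P1.
have k1 w : kappa w setT = 1%E by exact: prob_kernel.
move=> bA bh; apply/eqP; rewrite -subr_eq0; apply/eqP.
have [_ [M AM]] := bA; have bA' := bmf_past bA.
have bkernel g : bounded_measurable g ->
    bounded_measurable (fun w : Omega => \int[kappa w]_u g u).
  by move=> bg; apply: (@bmf_past l); exact: bmf_kernel.
have bK (B : Omega -> R) (N : R) : bounded_measurable B -> (forall w, `|B w| <= N) ->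
    bounded_functional (fun g : U -> R =>
      \int[P]_w (B w * \int[kappa w]_u g u)) N.
  move=> bB BN; split=> [f g bf bg|c f bf|f N' bf fN].
  - rewrite -bmf_RintegralD//; first last.
    + by apply: bmfM => //; exact: bkernel.
    + by apply: bmfM => //; exact: bkernel.
    apply: eq_Rintegral => w _.
    by rewrite (bmf_RintegralD (k1 w) bf bg) mulrDr.
  - rewrite -bmf_RintegralZ//; last by apply: bmfM => //; exact: bkernel.
    apply: eq_Rintegral => w _.
    by rewrite (bmf_RintegralZ (k1 w) c bf) mulrCA.
  - apply: bmf_normr_Rintegral_cst => //.
      by apply: bmfM => //; exact: bkernel.
    move=> w; rewrite normrM ler_pM//.
    by apply: bmf_normr_Rintegral_cst => //; exact: prob_kernel.
apply: (bf_eq0 (bfB (bf_comp bP mZ bA' AM) (bK A M bA' AM))) bh => B mB.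
have b1B : bounded_measurable (\1_B : U -> R) by exact: bmf_indic.
(* With [B] fixed, both sides are functionals of [A]. *)
have bZ (C : Omega -> R) (N : R) : bounded_measurable C -> (forall w, `|C w| <= N) ->
    bounded_functional (fun D : Fsigma Y l -> R => \int[P]_w (D w * C w)) N.
  move=> bC CN; split=> [f g /bmf_past bf /bmf_past bg|c f /bmf_past bf|
    f N' /bmf_past bf fN].
  - under eq_Rintegral do rewrite mulrDl.
    by rewrite bmf_RintegralD//; exact: bmfM.
  - under eq_Rintegral do rewrite -mulrA.
    by rewrite bmf_RintegralZ//; exact: bmfM.
  - rewrite mulrC; apply: bmf_normr_Rintegral_cst => //; first exact: bmfM.
    by move=> w; rewrite normrM ler_pM.
have b1Z : bounded_measurable (fun w => \1_B (Z w) : R) by exact: bmf_comp.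
have le1 (T : Type) (E : set T) x : `|\1_E x : R| <= 1.
  by rewrite indicE; case: (_ \in _); rewrite ?normr1 ?normr0.
have kB w : `|\int[kappa w]_u \1_B u| <= 1.
  by apply: bmf_normr_Rintegral_cst => //; exact: prob_kernel.
apply: (bf_eq0 (bfB (bZ (fun w => \1_B (Z w)) 1 b1Z (fun w => le1 _ _ _))
  (bZ _ 1 (bkernel _ b1B) kB))) bA => E mE.
have mE' : measurable (E : set Omega) by exact: past_measurable mE.
apply/eqP; rewrite subr_eq0; apply/eqP.
have mBZ : measurable (Z @^-1` B) by rewrite -[X in measurable X]setTI; exact: mZ.
transitivity (fine (P (E `&` Z @^-1` B))).
  rewrite -Rintegral_indic//; last exact: measurableI.
  by apply: eq_Rintegral => w _; rewrite indicI.
rewrite -(kappaZ mE mB) /Rintegral; congr fine.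
rewrite [LHS]integral_mkcond; apply: eq_integral => w _; rewrite patchE indicE.
case: (w \in E); last by rewrite mul0r.
rewrite mul1r integral_indic// setIT fineK//.
rewrite ge0_fin_numE// (le_lt_trans _ (ltry 1))// -(k1 w).
by apply: le_measure; rewrite ?inE.
Qed.

End Kernel.

(** Equality of laws on sets gives equality of expectations by uniform
    approximation; [Psi] looks at the whole path only to avoid tuples. *)
Lemma stationary_path n (Psi : (nat -> R) -> R) (h : int) :
  strictly_stationary Y ->
  (forall y y' : nat -> R, (forall k, (k <= n)%N -> y k = y' k) -> Psi y = Psi y') ->
  bounded_measurable (fun v : n.+1.-tuple R => Psi (fun k => tnth v (inord k))) ->
  \int[P]_w Psi (fun k => Y (k%:Z + h) w) = \int[P]_w Psi (fun k => Y k%:Z w).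
Proof.
move=> statY Psi_n bPsi; have P1 : P setT = 1%E by exact: probability_setT.
pose F (v : n.+1.-tuple R) := Psi (fun k => tnth v (inord k)).
pose V s w := [tuple Y ((i : 'I_n.+1)%:Z + s) w | i < n.+1].
have PsiE s w : Psi (fun k => Y (k%:Z + s) w) = F (V s w).
  by apply: Psi_n => k kn; rewrite tnth_mktuple inordK.
under eq_Rintegral do rewrite PsiE.
have -> : \int[P]_w Psi (fun k => Y k%:Z w) = \int[P]_w F (V 0 w).
  by apply: eq_Rintegral => w _; rewrite -PsiE; congr Psi; apply/funext => k; rewrite addr0.
have mV s : measurable_fun setT (V s).
  apply/measurable_fun_tnthP => i.
  rewrite (_ : _ \o _ = Y (i%:Z + s)); last by apply/funext => w /=; rewrite tnth_mktuple.
  exact: measurable_funPT.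
apply/eqP; rewrite -subr_eq0; apply/eqP.
have bV s : bounded_functional (fun G : n.+1.-tuple R -> R => \int[P]_w G (V s w)) 1.
  split=> [f g bf bg|c f bf|f M bf fM].
  - by rewrite bmf_RintegralD//; exact: (bmf_comp (mV s)).
  - by rewrite bmf_RintegralZ//; exact: (bmf_comp (mV s)).
  - by rewrite mul1r; apply: bmf_normr_Rintegral_cst => //; exact: (bmf_comp (mV s)).
apply: (bf_eq0 (bfB (bV h) (bV 0))) bPsi => A mA.
have mVA s : measurable (V s @^-1` A) by rewrite -[X in measurable X]setTI; exact: mV.
have int1 s : \int[P]_w \1_A (V s w) = fine (P (V s @^-1` A)).
  exact: (Rintegral_indic P (mVA s)).
have VhE : P (V h @^-1` A) = P [set w | A [tuple Y (i : 'I_n.+1)%:Z w | i < n.+1]].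
  exact: statY n.+1 (fun i => i%:Z) h A mA.
have V0E w : V 0 w = [tuple Y (i : 'I_n.+1)%:Z w | i < n.+1].
  by apply: eq_mktuple => i; rewrite addr0.
rewrite !int1 VhE; apply/eqP; rewrite subr_eq0; apply/eqP.
by congr (fine (P _)); apply/seteqP; split => w; rewrite /preimage /= V0E.
Qed.

End PastSigmaAlgebra.

(** * Functions of the observations form a weakly dependent sequence *)

Section Observations.
Context d (Omega : measurableType d) (R : realType) (P : probability Omega R).
Variable Y : int -> {RV P >-> R}.
Hypothesis statY : strictly_stationary Y.
Variables (g : R -> R) (M : R).
Hypothesis mg : measurable_fun setT g.
Hypothesis gM : forall y, `|g y| <= M.

Let P1 : P setT = 1%E. Proof. exact: probability_setT. Qed.

Definition mean := \int[P]_w g (Y 0 w).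

Definition obs (k : int) w := g (Y k w) - mean.

Lemma bmf_g : bounded_measurable g. Proof. by split=> //; exists M. Qed.

Lemma bmf_g_sub_mean : bounded_measurable (fun y => g y - mean).
Proof. by apply: bmfB; [exact: bmf_g|exact: bmf_cst]. Qed.

Lemma bmf_gY k : bounded_measurable (fun w => g (Y k w)).
Proof. by apply: bmf_comp bmf_g; exact: measurable_funPT. Qed.

Lemma bmf_obs k : bounded_measurable (obs k).
Proof. by apply: bmfB; [exact: bmf_gY|exact: bmf_cst]. Qed.

Lemma mean_le : `|mean| <= M.
Proof. by apply: bmf_normr_Rintegral_cst => //; exact: bmf_gY. Qed.

Lemma obs_le k w : `|obs k w| <= 2 * M.
Proof.
by rewrite (le_trans (ler_normB _ _))// mulr_natl mulr2n lerD// mean_le.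
Qed.

Lemma Rintegral_gY k : \int[P]_w g (Y k w) = mean.
Proof.
pose Psi (y : nat -> R) := g (y 0%N).
have := @stationary_path _ _ _ _ Y 0 Psi k statY.
rewrite /Psi; under eq_Rintegral do rewrite add0r.
apply; first by move=> y y' ->.
by apply: bmf_comp bmf_g; exact: measurable_tnth.
Qed.

Lemma Rintegral_obs k : \int[P]_w obs k w = 0.
Proof.
rewrite bmf_RintegralB//; [|exact: bmf_gY|exact: bmf_cst].
by rewrite Rintegral_gY bmf_Rintegral_cst// subrr.
Qed.

Lemma bmf_tnth_obs n i :
  bounded_measurable (fun v : n.+1.-tuple R => g (tnth v (inord i)) - mean).
Proof. by apply: bmf_comp bmf_g_sub_mean; exact: measurable_tnth. Qed.

Definition autocov u := \int[P]_w (obs 0 w * obs u%:Z w).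

Lemma Rintegral_obs_mul k u :
  \int[P]_w (obs k%:Z w * obs (k + u)%N%:Z w) = autocov u.
Proof.
pose Psi (y : nat -> R) := (g (y 0%N) - mean) * (g (y u) - mean).
have := @stationary_path _ _ _ _ Y u Psi k%:Z statY; rewrite /Psi.
rewrite -/(autocov u) => <-; first last.
- by apply: bmfM; exact: bmf_tnth_obs.
- by move=> y y' yy'; rewrite !yy'.
apply: eq_Rintegral => w _; rewrite /obs.
by congr ((g (Y _ w) - _) * (g (Y _ w) - _)); lia.
Qed.

Definition shifted_sum (h : int) l w := \sum_(1 <= i < l.+1) obs (i%:Z + h) w.

(** Stationarity moves time [l] to the origin; the increment is then a function
    of the past dominated by [`|obs 0|], and conditioning applies. *)
Lemma increment_cond d' (U : measurableType d') (zeta : R * R -> U) (H : U -> R)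
    (phi : R -> R) (K : R) l k u (kappa : R.-pker (Fsigma Y 0) ~> U) :
  measurable_fun setT zeta -> bounded_measurable H ->
  (forall a b, `|phi a - phi b| <= K * `|a - b|) -> (0 < l < k)%N ->
  is_cond_dist (fun w => zeta (Y (k - l + u)%N%:Z w, Y (k - l)%N%:Z w)) kappa ->
  `|\int[P]_w ((phi (partial_sum (fun i => obs i%:Z) l w)
       - phi (partial_sum (fun i => obs i%:Z) l.-1 w))
       * H (zeta (Y (k + u)%N%:Z w, Y k%:Z w)))| <=
  K * \int[P]_w (`|obs 0 w| * `|\int[kappa w]_z H z|).
Proof.
move=> mzeta bH phiK /andP[l0 lk] hkappa.
pose Z w := zeta (Y (k - l + u)%N%:Z w, Y (k - l)%N%:Z w).
have mZ : measurable_fun setT Z.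
  by apply: measurableT_comp mzeta _; apply/measurable_fun_pairP; split;
    exact: measurable_funPT.
pose sigma (y : nat -> R) j := \sum_(1 <= i < j.+1) (g (y i) - mean).
pose Psi (y : nat -> R) := (phi (sigma y l) - phi (sigma y l.-1))
  * H (zeta (y (k + u)%N, y k)).
pose A w := phi (shifted_sum (- l%:Z) l w) - phi (shifted_sum (- l%:Z) l.-1 w).
have bA : bounded_measurable (A : Fsigma Y 0 -> R).
  have bs j : (j <= l)%N ->
      bounded_measurable (shifted_sum (- l%:Z) j : Fsigma Y 0 -> R).
    move=> jl; have -> : shifted_sum (- l%:Z) j = (fun w =>
        \sum_(1 <= i < j.+1 | (i <= l)%N) obs (i%:Z + - l%:Z) w).
      apply/funext => w; rewrite /shifted_sum big_nat_cond [RHS]big_nat_cond.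
      by apply: eq_bigl => i; lia.
    apply: bmf_sum => i il; apply: (bmf_comp _ bmf_g_sub_mean).
    by apply: measurable_past_RV; lia.
  by apply: bmfB; apply: bmf_lipschitz phiK _; apply: bs; lia.
have Al w : `|A w| <= K * `|obs 0 w|.
  rewrite (le_trans (phiK _ _))// le_eqVlt; apply/orP; left; apply/eqP.
  rewrite /shifted_sum; case: l l0 {lk hkappa Z mZ Psi A bA} => // l _ /=.
  by rewrite big_nat_recr//= subrr addrAC subrr add0r.
have -> : \int[P]_w ((phi (partial_sum (fun i => obs i%:Z) l w)
       - phi (partial_sum (fun i => obs i%:Z) l.-1 w))
       * H (zeta (Y (k + u)%N%:Z w, Y k%:Z w))) = \int[P]_w (A w * H (Z w)).
  have := @stationary_path _ _ _ _ Y (k + u)%N Psi (- l%:Z) statY.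
  rewrite /Psi => H0; rewrite -[LHS]H0; first last.
  - apply: bmfM.
      by apply: bmfB; apply: bmf_lipschitz phiK _; apply: bmf_sum => i _;
        exact: bmf_tnth_obs.
    apply: bmf_comp bH; apply: measurableT_comp mzeta _.
    by apply/measurable_fun_pairP; split; exact: measurable_tnth.
  - move=> y y' yy'; rewrite !yy'//; last by lia.
    have sE j : (j <= l)%N -> sigma y j = sigma y' j.
      by move=> jl; apply: eq_big_nat => i /andP[_ ij]; rewrite yy'//; lia.
    by rewrite !sE//; lia.
  apply: eq_Rintegral => w _; rewrite /A /Z.
  by congr (_ * H (zeta (Y _ w, Y _ w))); lia.
rewrite (cond_int mZ hkappa bA bH) -bmf_RintegralZ//; last first.
  apply: bmfM; first exact: bmf_norm (bmf_obs _).
  by apply: bmf_norm; apply: (@bmf_past _ _ _ _ Y 0); exact: bmf_kernel.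
have bK : bounded_measurable (fun w : Omega => \int[kappa w]_z H z).
  by apply: (@bmf_past _ _ _ _ Y 0); exact: bmf_kernel.
apply: bmf_normr_Rintegral_le => //.
- by apply: bmfM => //; exact: bmf_past bA.
- apply: bmfM; first exact: bmf_cst.
  by apply: bmfM; [exact: bmf_norm (bmf_obs _)|exact: bmf_norm].
- by move=> w; rewrite normrM mulrA ler_wpM2r.
Qed.

Variables (kappa1 : int -> R.-pker (Fsigma Y 0) ~> R)
  (kappa2 : int -> int -> R.-pker (Fsigma Y 0) ~> (R * R)%type).
Hypothesis hkappa1 : forall k, is_cond_dist (Y k) (kappa1 k).
Hypothesis hkappa2 : forall i j, is_cond_dist (fun w => (Y i w, Y j w)) (kappa2 i j).

(** Deviations of conditional expectations given the past from the means.  The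
    case [u = 0] of [dev2], the square of one observation, involves the
    conditional law of a single variable. *)
Definition dev1 (v : nat) w := \int[kappa1 v%:Z w]_y (g y - mean).

Definition dev2 (v u : nat) w :=
  if u == 0%N then \int[kappa1 v%:Z w]_y ((g y - mean) ^+ 2 - autocov 0)
  else \int[kappa2 (v + u)%N%:Z v%:Z w]_z
         ((g z.1 - mean) * (g z.2 - mean) - autocov u).

(** The weight is [g (Y 0)] itself rather than [obs 0]: it vanishes off the
    support of [g], which localises the variance. *)
Definition obs_cov u := \int[P]_w (`|g (Y 0 w)| * `|dev1 u w|).
Definition obs_e1 v := \int[P]_w (`|obs 0 w| * `|dev1 v w|).
Definition obs_e2 v u := \int[P]_w (`|obs 0 w| * `|dev2 v u w|).

Lemma bmf_dev1 v : bounded_measurable (dev1 v : Omega -> R).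
Proof.
apply: (@bmf_past _ _ _ _ Y 0); apply: bmf_kernel => //; exact: bmf_g_sub_mean.
Qed.

Lemma bmf_prod_sub u : bounded_measurable (fun z : R * R =>
  (g z.1 - mean) * (g z.2 - mean) - autocov u).
Proof.
apply: bmfB; last exact: bmf_cst.
by apply: bmfM; apply: bmf_comp bmf_g_sub_mean.
Qed.

Lemma bmf_sqr_sub : bounded_measurable (fun y => (g y - mean) ^+ 2 - autocov 0).
Proof.
apply: bmfB; last exact: bmf_cst.
by under eq_fun do rewrite expr2; apply: bmfM; exact: bmf_g_sub_mean.
Qed.

Lemma bmf_dev2 v u : bounded_measurable (dev2 v u : Omega -> R).
Proof.
apply: (@bmf_past _ _ _ _ Y 0); rewrite /dev2; case: eqP => _.
  by apply: bmf_kernel => //; exact: bmf_sqr_sub.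
by apply: bmf_kernel => //; exact: bmf_prod_sub.
Qed.

Lemma obs_weakly_dependent n :
  weakly_dependent P n (2 * M) (fun k => obs k%:Z) obs_cov obs_e1 obs_e2.
Proof.
split.
- by move=> k; exact: bmf_obs.
- by move=> k w; exact: obs_le.
- by move=> u; apply: Rintegral_ge0 => w _; rewrite mulr_ge0.
- by move=> v; apply: Rintegral_ge0 => w _; rewrite mulr_ge0.
- by move=> v u; apply: Rintegral_ge0 => w _; rewrite mulr_ge0.
- move=> k u _ _; rewrite Rintegral_obs_mul /autocov.
  have bgo : bounded_measurable (fun w => g (Y 0 w) * obs u%:Z w).
    by apply: bmfM; [exact: bmf_gY|exact: bmf_obs].
  have -> : \int[P]_w (obs 0 w * obs u%:Z w) = \int[P]_w (g (Y 0 w) * obs u%:Z w).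
    under eq_Rintegral do rewrite /obs mulrBl -/(obs u%:Z _).
    rewrite bmf_RintegralB//; last by apply: bmfM; [exact: bmf_cst|exact: bmf_obs].
    by rewrite bmf_RintegralZ ?Rintegral_obs ?mulr0 ?subr0//; exact: bmf_obs.
  rewrite (cond_int (kappa := kappa1 u%:Z) _ (hkappa1 _) _ bmf_g_sub_mean); first last.
  + by apply: (bmf_comp _ bmf_g); exact: measurable_past_RV.
  + exact: measurable_funPT.
  apply: bmf_normr_Rintegral_le => //.
  + by apply: bmfM; [exact: bmf_gY|exact: bmf_dev1].
  + by apply: bmfM; apply: bmf_norm; [exact: bmf_gY|exact: bmf_dev1].
  + by move=> w; rewrite normrM.
- move=> phi K l k phiK lk _.
  have := @increment_cond _ R (fun z => z.2) _ phi K l k 0 (kappa1 (k - l)%N%:Z)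
    _ bmf_g_sub_mean phiK lk (hkappa1 _).
  by apply; exact: measurable_snd.
- move=> phi K l k u phiK lk _; rewrite Rintegral_obs_mul /obs_e2 /dev2.
  case: eqP => [->|_].
    rewrite addn0; under eq_Rintegral do rewrite -expr2.
    have := @increment_cond _ R (fun z => z.2) _ phi K l k 0 (kappa1 (k - l)%N%:Z)
      _ bmf_sqr_sub phiK lk (hkappa1 _).
    by apply; exact: measurable_snd.
  under eq_Rintegral do rewrite [_ * obs (k + u)%N%:Z _]mulrC.
  exact: (@increment_cond _ (R * R)%type id _ phi K l k u
    (kappa2 (k - l + u)%N%:Z (k - l)%N%:Z) (@measurable_id _ _ _)
    (bmf_prod_sub u) phiK lk (hkappa2 _ _)).
Qed.

End Observations.

(** * Functions of bounded variation against half-lines *)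

Section StepApproximation.
Variable R : realType.
Implicit Types (g : R -> R) (D : R) (q : {poly R}).

Definition half_line (t y : R) : R := \1_(`]-oo, t]%classic) y.

(** Uniform approximation by combinations of half-line indicators whose
    coefficients have a bounded sum: what bounded variation is used for. *)
Definition step_approximable D g := forall e, 0 < e ->
  exists s : seq (R * R), \sum_(z <- s) `|z.1| <= D /\
    forall y, `|g y - \sum_(z <- s) z.1 * half_line z.2 y| <= e.

Lemma half_lineE t y : half_line t y = (y <= t)%R%:R.
Proof.
rewrite /half_line indicE; congr ((nat_of_bool _)%:R).
by apply/idP/idP; rewrite inE/= in_itv.
Qed.

Lemma bmf_half_line t : bounded_measurable (half_line t).
Proof. by apply: bmf_indic; exact: measurable_itv. Qed.

Lemma horner_lipschitz q : exists2 K, 0 <= K & forall x y, 0 <= x <= 1 ->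
  0 <= y <= 1 -> `|q.[x] - q.[y]| <= K * `|x - y|.
Proof.
elim/poly_ind: q => [|q c [K K0 qK]].
  by exists 0 => // x y _ _; rewrite !horner0 subrr normr0 mul0r.
exists (`|q.[0]| + K + K); first by rewrite !addr_ge0.
move=> x y x01 y01; rewrite !hornerMXaddC.
have -> : q.[x] * x + c - (q.[y] * y + c) = q.[x] * (x - y) + (q.[x] - q.[y]) * y.
  ring.
have qx : `|q.[x]| <= `|q.[0]| + K.
  rewrite -[q.[x]](subrKC q.[0]) (le_trans (ler_normD _ _))// lerD2l.
  have := qK x 0 x01; rewrite lexx ler01 subr0 => /(_ isT) /le_trans; apply.
  by rewrite ler_piMr// ler_norml; move: x01 => /andP[? ?]; apply/andP; split; lra.
rewrite (le_trans (ler_normD _ _))// !normrM mulrDl lerD// ?ler_wpM2r//.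
rewrite (le_trans (ler_wpM2r _ (qK _ _ x01 y01)))// -mulrA ler_wpM2l//.
by rewrite ler_piMr// ler_norml; move: y01 => /andP[? ?]; apply/andP; split; lra.
Qed.

Lemma horner_bounded q : exists2 M, 0 < M & forall x, 0 <= x <= 1 -> `|q.[x]| <= M.
Proof.
have [K K0 qK] := horner_lipschitz q.
exists (`|q.[0]| + K + 1); first by rewrite ltr_wpDl// addr_ge0.
move=> x x01; rewrite -[q.[x]](subrKC q.[0]) (le_trans (ler_normD _ _))//.
rewrite -addrA lerD2l; have := qK x 0 x01; rewrite lexx ler01 subr0 => /(_ isT).
move=> /le_trans; apply; rewrite ler_wpDr// ler_piMr//.
by rewrite ler_norml; move: x01 => /andP[? ?]; apply/andP; split; lra.
Qed.

(** Sampling [Rfun q] at the points [i / N] gives a sum that telescopes, on the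
    [k]-th cell, to the value of [q] at its right end.  The size of the
    coefficients is the total variation of the samples, which the change of
    variable [m * y - j] leaves unchanged: hence one [D] for all [m] and [j]. *)
Lemma Rfun_step_approximable q : exists2 D, 0 < D &
  forall m j : nat, (0 < m)%N ->
    step_approximable D (fun y => Rfun q (m%:R * y - j%:R)).
Proof.
have [K K0 qK] := horner_lipschitz q.
exists (`|q.[1]| + `|q.[0]| + K + 1); first by rewrite ltr_wpDl// !addr_ge0.
move=> m j m0 e e0; have mR : 0 < m%:R :> R by rewrite ltr0n.
have [N NR KN] : exists2 N : nat, 0 < N%:R :> R & K / N%:R <= e.
  exists (Num.truncn (K / e)).+1; first by rewrite ltr0n.
  by rewrite ler_pdivrMr ?ltr0n// mulrC -ler_pdivrMr// ltW// truncnS_gt.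
pose x i : R := i%:R / N%:R.
have x01 i : (i <= N)%N -> 0 <= x i <= 1.
  by move=> iN; rewrite divr_ge0//= ler_pdivrMr// mul1r ler_nat.
have xN : x N = 1 by rewrite /x divff// gt_eqF.
have x0 : x 0%N = 0 by rewrite /x mul0r.
have xS i : x i.+1 - x i = N%:R^-1 by rewrite /x -mulrBl -natr1 addrAC subrr add0r mul1r.
pose u i := (x i + j%:R) / m%:R.
have uE i y : half_line (u i) y = (m%:R * y - j%:R <= x i)%R%:R.
  by rewrite half_lineE /u ler_pdivlMr// lerBlDr mulrC.
exists ((q.[1], u N) :: (- q.[0], u 0%N) ::
  [seq (- (q.[x i.+1] - q.[x i]), u i) | i <- iota 0 N]).
split.
  rewrite !big_cons big_map /= normrN addrA -(addrA _ K) lerD2l.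
  rewrite (@le_trans _ _ (\sum_(i <- iota 0 N) K / N%:R))//; last first.
    rewrite big_const_seq count_predT size_iota iter_addr_0 -[_ *+ N]mulr_natr.
    by rewrite divfK ?gt_eqF// lerDl.
  rewrite [leLHS]big_seq [leRHS]big_seq; apply: ler_sum => i; rewrite mem_iota => /andP[_ iN].
  rewrite add0n in iN; rewrite normrN (le_trans (qK _ _ (x01 _ iN) (x01 _ (ltnW iN))))//.
  by rewrite xS ger0_norm ?invr_ge0// ltW.
move=> y; rewrite !big_cons big_map /= !uE xN x0; set z := _ - j%:R.
under eq_bigr do rewrite uE -/z.
have -> : \sum_(i <- iota 0 N) - (q.[x i.+1] - q.[x i]) * (z <= x i)%R%:R =
    - \sum_(0 <= i < N) (q.[x i.+1] - q.[x i]) * (z <= x i)%R%:R.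
  by rewrite -sumrN /index_iota subn0; apply: eq_bigr => i _; rewrite mulNr.
rewrite /Rfun; have [z0|z0] := leP z 0.
  rewrite (eq_big_nat _ _ (F2 := fun i => q.[x i.+1] - q.[x i])); last first.
    move=> i _; rewrite (le_trans z0) ?mulr1// divr_ge0//.
  rewrite (telescope_sum (fun i => q.[x i])) xN x0 ifF; last first.
    by apply/negbTE; rewrite in_itv/= negb_and -leNgt z0.
  rewrite (le_trans z0 ler01) !mulr1 (_ : 0 - _ = 0) ?normr0 ?(ltW e0)//; ring.
have [z1|z1] := leP z 1; last first.
  rewrite big_nat_cond big1 => [|i /andP[/andP[_ iN] _]]; last first.
    rewrite leNgt (le_lt_trans _ z1) ?mulr0//.
    by have /andP[] := x01 i (ltnW iN).
  by rewrite in_itv/= z0/= [z <= 1]leNgt z1/= !mulr0 oppr0 !addr0 subr0 normr0 ltW.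
rewrite in_itv/= z0 z1/= mulr1 mulr0 add0r.
have [k [kN kz zk]] : exists k, [/\ (k < N)%N, x k < z & z <= x k.+1].
  have ex : exists i, z <= x i by exists N; rewrite xN.
  case: (ex_minnP ex) => -[|k] zk kmin; first by rewrite x0 leNgt z0 in zk.
  exists k; split=> //; first by apply: kmin; rewrite xN.
  by rewrite ltNge; apply/negP => /kmin; rewrite ltnn.
have xmono a b : (a <= b)%N -> x a <= x b.
  by move=> ab; rewrite ler_pM2r ?invr_gt0// ler_nat.
have -> : \sum_(0 <= i < N) (q.[x i.+1] - q.[x i]) * (z <= x i)%R%:R =
    q.[1] - q.[x k.+1].
  rewrite (@big_cat_nat _ _ _ k.+1)//= big_nat_cond big1 ?add0r; last first.
    move=> i /andP[/andP[_ ik] _]; rewrite leNgt (le_lt_trans _ kz) ?mulr0//.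
    by apply: xmono; rewrite -ltnS.
  rewrite (eq_big_nat _ _ (F2 := fun i => q.[x i.+1] - q.[x i])); last first.
    by move=> i /andP[ki _]; rewrite (le_trans zk) ?mulr1//; exact: xmono.
  by rewrite telescope_sumr// xN.
rewrite (_ : q.[z] - _ = q.[z] - q.[x k.+1]); last by ring.
have zx : `|z - x k.+1| <= N%:R^-1.
  by rewrite -(xS k) ler_norml; apply/andP; split; lra.
rewrite (le_trans (qK _ _ _ (x01 _ kN)))//; first by rewrite (ltW z0) z1.
by rewrite (le_trans (ler_wpM2l K0 zx)).
Qed.

(** The estimate passes to combinations of half-lines by linearity, and to [g]
    by uniform approximation. *)
Lemma bv_functional (La : (R -> R) -> R) (K D : R) g (b : R) : bounded_functional La K ->
  bounded_measurable g -> step_approximable D g ->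
  (forall t, `|La (half_line t)| <= b) -> `|La g| <= D * b.
Proof.
move=> bLa bg gD Lab; apply/ler_addgt0Pl => eta eta0.
have K0 := bf_ge0 bLa; have K1 : 0 < K + 1 by rewrite ltr_wpDl.
have b0 : 0 <= b := le_trans (normr_ge0 _) (Lab 0).
have [s [sD sg]] := gD _ (divr_gt0 eta0 K1).
have bs : bounded_measurable (fun y => \sum_(z <- s) z.1 * half_line z.2 y).
  by apply: bmf_sum => z _; apply: bmfM; [exact: bmf_cst|exact: bmf_half_line].
have := bf_dist_le bLa bg bs sg.
rewrite (bf_sum _ _ bLa); last by move=> z; exact: bmf_half_line.
set y := \sum_(z <- s) _ => gy.
have yDb : `|y| <= D * b.
  rewrite (le_trans (ler_norm_sum _ _ _))//.
  rewrite (@le_trans _ _ ((\sum_(z <- s) `|z.1|) * b)) ?ler_wpM2r//.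
  by rewrite mulr_suml ler_sum// => z _; rewrite normrM ler_wpM2l.
rewrite -(subrK y (La g)) (le_trans (ler_normD _ _))// lerD//.
rewrite (le_trans gy)// mulrCA ler_piMr ?(ltW eta0)//.
by rewrite ler_pdivrMr// mul1r lerDl.
Qed.

(** The bilinear version, for functions centered by an expectation [E]. *)
Lemma bv_functional2 (La : (R * R -> R) -> R) (K : R) (E : (R -> R) -> R)
    (D M : R) g (b : R) :
  bounded_functional La K -> bounded_functional E 1 -> E (fun=> 1) = 1 ->
  bounded_measurable g -> (forall y, `|g y| <= M) -> 0 <= D ->
  step_approximable D g ->
  (forall s t, `|La (fun z : R * R => (half_line t z.1 - E (half_line t))
      * (half_line s z.2 - E (half_line s)))| <= b) ->
  `|La (fun z => (g z.1 - E g) * (g z.2 - E g))| <= D * D * b.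
Proof.
move=> bLa bE E1 bg gM D0 gD Lab; apply/ler_addgt0Pl => eta eta0.
have K0 := bf_ge0 bLa; have M0 : 0 <= M := le_trans (normr_ge0 _) (gM 0).
have b0 : 0 <= b := le_trans (normr_ge0 _) (Lab 0 0).
pose W := K * (8 * M + 4) + 1.
have W0 : 0 < W by rewrite ltr_wpDl// mulr_ge0// addr_ge0// mulr_ge0.
pose e := Num.min 1 (eta / W).
have e0 : 0 < e by rewrite lt_min ltr01 divr_gt0.
have e1 : e <= 1 by rewrite ge_min lexx.
have eW : K * (e * (8 * M + 4)) <= eta.
  have : e <= eta / W by rewrite ge_min lexx orbT.
  rewrite ler_pdivlMr// /W => eW; apply: le_trans eW.
  by rewrite mulrCA ler_wpM2l ?(ltW e0)// lerDl.
have [s [sD sg]] := gD _ e0.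
pose f0 t y := half_line t y - E (half_line t).
have bf0 t : bounded_measurable (f0 t).
  by apply: bmfB; [exact: bmf_half_line|exact: bmf_cst].
pose gs y := \sum_(z <- s) z.1 * half_line z.2 y.
pose gs0 y := \sum_(z <- s) z.1 * f0 z.2 y.
have bs : bounded_measurable gs.
  by apply: bmf_sum => z _; apply: bmfM; [exact: bmf_cst|exact: bmf_half_line].
have bs0 : bounded_measurable gs0.
  by apply: bmf_sum => z _; apply: bmfM; [exact: bmf_cst|exact: bf0].
have gs0E y : gs0 y = gs y - E gs.
  rewrite /gs0 /gs (bf_sum _ _ bE); last by move=> z; exact: bmf_half_line.
  by rewrite -sumrB; apply: eq_bigr => z _; rewrite mulrBr.
pose g0 y := g y - E g.
have bg0 : bounded_measurable g0 by apply: bmfB => //; exact: bmf_cst.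
have EgM : `|E g| <= M by rewrite -[M]mul1r; exact: (bf_le bE).
have g0M y : `|g0 y| <= 2 * M.
  by rewrite (le_trans (ler_normB _ _))// mulr_natl mulr2n lerD.
have g0s y : `|g0 y - gs0 y| <= 2 * e.
  rewrite gs0E /g0 (_ : _ - _ - _ = (g y - gs y) - (E g - E gs)); last ring.
  rewrite (le_trans (ler_normB _ _))// mulr_natl mulr2n lerD//.
  by rewrite -[e]mul1r; exact: bf_dist_le.
have gs0M y : `|gs0 y| <= 2 * M + 2 * e.
  rewrite -[gs0 y](subKr (g0 y)) (le_trans (ler_normB _ _))// lerD//.
have b2 (h : R -> R) : bounded_measurable h -> bounded_measurable (fun z : R * R => h z.1 * h z.2).
  by move=> bh; apply: bmfM; apply: bmf_comp bh; [exact: measurable_fst|exact: measurable_snd].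
have dist z : `|g0 z.1 * g0 z.2 - gs0 z.1 * gs0 z.2| <= e * (8 * M + 4).
  rewrite (_ : _ - _ = g0 z.1 * (g0 z.2 - gs0 z.2) + (g0 z.1 - gs0 z.1) * gs0 z.2).
    rewrite (le_trans (ler_normD _ _))// !normrM.
    apply: (@le_trans _ _ (2 * M * (2 * e) + 2 * e * (2 * M + 2 * e))).
      by rewrite lerD// ler_pM.
    by nra.
  by ring.
have := bf_dist_le bLa (b2 g0 bg0) (b2 gs0 bs0) dist.
set y := La (fun z => gs0 z.1 * gs0 z.2) => gy.
have yDb : `|y| <= D * D * b.
  have -> : y = \sum_(z <- s) z.1 * \sum_(z' <- s) z'.1 *
      La (fun x => f0 z.2 x.1 * f0 z'.2 x.2).
    have bff t t' : bounded_measurable (fun x : R * R => f0 t x.1 * f0 t' x.2).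
      by apply: bmfM; apply: bmf_comp (bf0 _); [exact: measurable_fst|exact: measurable_snd].
    rewrite /y; under [fun z => _]eq_fun do rewrite /gs0 mulr_suml.
    under [fun z => _]eq_fun do under eq_bigr do rewrite mulr_sumr.
    transitivity (La (fun x => \sum_(z <- s) z.1 *
        \sum_(z' <- s) z'.1 * (f0 z.2 x.1 * f0 z'.2 x.2))).
      congr La; apply/funext => x; apply: eq_bigr => z _; rewrite mulr_sumr.
      by apply: eq_bigr => z' _; ring.
    rewrite (bf_sum _ _ bLa); last first.
      by move=> z; apply: bmf_sum => z' _; apply: bmfM => //; exact: bmf_cst.
    by apply: eq_bigr => z _; rewrite (bf_sum _ _ bLa).
  rewrite (le_trans (ler_norm_sum _ _ _))//.
  rewrite (@le_trans _ _ ((\sum_(z <- s) `|z.1|) * (D * b)))//; last first.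
    by rewrite -mulrA ler_wpM2r// mulr_ge0.
  rewrite mulr_suml ler_sum// => z _; rewrite normrM ler_wpM2l//.
  rewrite (le_trans (ler_norm_sum _ _ _))//.
  rewrite (@le_trans _ _ ((\sum_(z' <- s) `|z'.1|) * b))//; last first.
    by rewrite ler_wpM2r.
  rewrite mulr_suml ler_sum// => z' _; rewrite normrM ler_wpM2l//; exact: Lab.
rewrite -(subrK y (La _)) (le_trans (ler_normD _ _))// lerD//.
exact: le_trans gy eW.
Qed.

End StepApproximation.

(** * Comparison with the dependence coefficients *)

Local Open Scope ereal_scope.

(** No measurability is assumed, as the integral of a nonnegative function is a
    supremum over the simple functions below it; this is applied to the suprema
    [b1] and [b2]. *)
Lemma ge0_le_integral_lower d (T : measurableType d) (R : realType)
    (mu : {measure set T -> \bar R}) (f h : T -> \bar R) :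
  (forall x, 0 <= f x) -> (forall x, f x <= h x) ->
  \int[mu]_x f x <= \int[mu]_x h x.
Proof.
move=> f0 fh; have h0 x : 0 <= h x by exact: le_trans (fh x).
rewrite !ge0_integralTE//; apply: ereal_sup_le => _ [s /= sf <-].
by exists s => // x; exact: le_trans (fh x).
Qed.

Lemma Rintegral_le_lower d (T : measurableType d) (R : realType)
    (mu : {measure set T -> \bar R}) (F : T -> R) (h : T -> \bar R) (c : R) :
  mu setT = 1 -> (0 < c)%R -> bounded_measurable F -> (forall x, 0 <= F x)%R ->
  (forall x, (F x)%:E <= c%:E * h x) ->
  (\int[mu]_x F x)%R%:E <= c%:E * \int[mu]_x h x.
Proof.
move=> mu1 c0 bF F0 Fh.
have bFc : bounded_measurable (fun x => c^-1 * F x)%R.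
  by apply: bmfM => //; exact: bmf_cst.
have -> : (\int[mu]_x F x)%R = (c * \int[mu]_x (c^-1 * F x))%R.
  by rewrite bmf_RintegralZ// mulrA divff ?mul1r// gt_eqF.
rewrite EFinM lee_pmul2l// -bmf_RintegralE//.
apply: ge0_le_integral_lower => x; first by rewrite lee_fin mulr_ge0// invr_ge0 ltW.
by rewrite EFinM muleC lee_pdivrMr// muleC.
Qed.

Lemma le_scaled_bound (R : realType) (x D : R) (b : \bar R) : (0 < D)%R ->
  0 <= b -> (forall r : R, b <= r%:E -> (x <= D * r)%R) -> x%:E <= D%:E * b.
Proof.
move=> D0; case: b => [r _ H|_ _|//]; first by rewrite -EFinM lee_fin H.
by rewrite gt0_muley// leey.
Qed.

Section CoefficientBounds.
Context d (Omega : measurableType d) (R : realType) (P : probability Omega R).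
Variable Y : int -> {RV P >-> R}.
Hypothesis statY : strictly_stationary Y.
Variables (g : R -> R) (M D D' : R).
Hypothesis mg : measurable_fun setT g.
Hypothesis gM : forall y, (`|g y| <= M)%R.
Hypothesis D0 : (0 < D)%R.
Hypothesis D'0 : (0 < D')%R.
Hypothesis gD : step_approximable D g.
Hypothesis g2D : step_approximable D' (fun y => g y ^+ 2)%R.
Variables (kappa1 : int -> R.-pker (Fsigma Y 0) ~> R)
  (kappa2 : int -> int -> R.-pker (Fsigma Y 0) ~> (R * R)%type).

Let P1 : P setT = 1. Proof. exact: probability_setT. Qed.
Let M0 : (0 <= M)%R. Proof. exact: le_trans (gM 0%R). Qed.
Let bg : bounded_measurable g. Proof. by split=> //; exists M. Qed.
Let mY k : measurable_fun setT (Y k). Proof. exact: measurable_funPT. Qed.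

Let kernel_dev d' (U : measurableType d') (kappa : R.-pker (Fsigma Y 0) ~> U)
    (Z : Omega -> U) w (h : U -> R) : R :=
  (\int[kappa w]_u h u - \int[P]_w' h (Z w'))%R.

Let bf_kernel_dev d' (U : measurableType d') (kappa : R.-pker (Fsigma Y 0) ~> U)
    (Z : Omega -> U) w : measurable_fun setT Z ->
  bounded_functional (kernel_dev kappa Z w) 2.
Proof.
move=> mZ; have k1 : kappa w setT = 1 by exact: prob_kernel.
have bZ : bounded_functional (fun h : U -> R => \int[P]_w' h (Z w'))%R 1.
  split=> [f h bf bh|c f bf|f N bf fN].
  - by rewrite bmf_RintegralD//; exact: (bmf_comp mZ).
  - by rewrite bmf_RintegralZ//; exact: (bmf_comp mZ).
  - by rewrite mul1r; apply: bmf_normr_Rintegral_cst => //; exact: (bmf_comp mZ).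
exact: bfB (bf_Rintegral k1) bZ.
Qed.

Lemma f_E t (x : R) : f_ t x = (half_line t x)%:E. Proof. by []. Qed.

Lemma integral_f_ t :
  \int[distribution P (Y 0)]_y f_ t y = (\int[P]_w half_line t (Y 0 w))%R%:E.
Proof.
have bt := bmf_half_line t.
rewrite ge0_integral_distribution//.
- by rewrite -bmf_RintegralE//; exact: (bmf_comp (mY 0)).
- by apply/measurable_EFinP; exact: bt.1.
- by move=> y; rewrite f_E lee_fin half_lineE.
Qed.

Lemma f0_E t (x : R) :
  f0_ Y t x = (half_line t x - \int[P]_w half_line t (Y 0 w))%R%:E.
Proof. by rewrite /f0_ integral_f_ EFinB. Qed.

Lemma b1_ge0 (kappa : R.-pker (Fsigma Y 0) ~> R) w : 0 <= b1 kappa w.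
Proof.
apply: le_trans (abse_ge0 _) (_ : `| \int[kappa w]_x f_ 0%R x -
  \int[distribution P (Y 0)]_x f_ 0%R x | <= _).
by apply: ereal_sup_ubound; exists 0%R.
Qed.

Lemma b2_ge0 i j (kappa : R.-pker (Fsigma Y 0) ~> (R * R)%type) w :
  0 <= b2 i j kappa w.
Proof.
rewrite /b2; set F := (X in range X).
apply: (@le_trans _ _ (F (0, 0)%R)); first exact: abse_ge0.
by apply: ereal_sup_ubound; exists (0, 0)%R.
Qed.

Lemma b1_half_line (kappa : R.-pker (Fsigma Y 0) ~> R) w (r : R) k :
  b1 kappa w <= r%:E -> forall t,
  (`|kernel_dev kappa (Y k) w (half_line t)| <= r)%R.
Proof.
move=> br t; rewrite -lee_fin; apply: le_trans br.
have bt := bmf_half_line t; have k1 : kappa w setT = 1 by exact: prob_kernel.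
apply: ereal_sup_ubound; exists t => //.
rewrite integral_f_ (bmf_RintegralE k1 bt) -EFinB /kernel_dev.
have h1 y : (`|half_line t y| <= 1)%R.
  by rewrite half_lineE; case: (y <= t)%R; rewrite ?normr1 ?normr0.
by rewrite (Rintegral_gY statY bt.1 h1 k).
Qed.

Lemma dev1E v w : dev1 g kappa1 v w = kernel_dev (kappa1 v%:Z) (Y v%:Z) w g.
Proof.
have k1 : kappa1 v%:Z w setT = 1 by exact: prob_kernel.
rewrite /dev1 bmf_RintegralB//; last exact: bmf_cst.
by rewrite bmf_Rintegral_cst// /kernel_dev (Rintegral_gY statY mg gM).
Qed.

Lemma dev1_le v w : `|(dev1 g kappa1 v w)%:E| <= D%:E * b1 (kappa1 v%:Z) w.
Proof.
apply: le_scaled_bound => //; first exact: b1_ge0.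
move=> r br; rewrite dev1E.
apply: bv_functional => //; first exact: bf_kernel_dev.
exact: b1_half_line.
Qed.

(** [(g - mean) ^+ 2] is expanded: its square term is controlled by the variation
    of [g ^+ 2], its linear term by the one of [g]. *)
Lemma dev2_0_le v w :
  `|(dev2 g kappa1 kappa2 v 0 w)%:E| <= (D' + 2 * M * D)%:E * b1 (kappa1 v%:Z) w.
Proof.
have bLa := bf_kernel_dev (kappa1 v%:Z) w (mY v%:Z).
set La := kernel_dev _ _ _ in bLa.
have D20 : (0 < D' + 2 * M * D)%R by rewrite ltr_pwDl// !mulr_ge0// ltW.
apply: le_scaled_bound => //; first exact: b1_ge0.
move=> r br; have Lar := b1_half_line v%:Z br.
have k1 : kappa1 v%:Z w setT = 1 by exact: prob_kernel.
have bg2 : bounded_measurable (fun y => g y ^+ 2)%R.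
  by under eq_fun do rewrite expr2; exact: bmfM.
set a := mean Y g.
have am : (`|a| <= M)%R by exact: mean_le.
have bc c : bounded_measurable (fun=> c : R) by move=> *; exact: bmf_cst.
have b2 : bounded_measurable (fun y => (g y - a) ^+ 2)%R.
  by under eq_fun do rewrite expr2; apply: bmfM; exact: bmfB.
have devE : dev2 g kappa1 kappa2 v 0 w =
    (La (fun y => g y ^+ 2) + (- (2 * a)) * La g)%R.
  have -> : dev2 g kappa1 kappa2 v 0 w = La (fun y => (g y - a) ^+ 2)%R.
    rewrite /dev2 eqxx bmf_RintegralB// bmf_Rintegral_cst// /La /kernel_dev.
    congr (_ - _)%R.
    have := Rintegral_obs_mul statY mg gM v 0; rewrite addn0 => <-.
    by apply: eq_Rintegral => w' _; rewrite -expr2.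
  have -> : (fun y => (g y - a) ^+ 2)%R =
      (fun y => (g y ^+ 2 + (- (2 * a)) * g y) + a ^+ 2 * 1)%R.
    by apply/funext => y; ring.
  rewrite (bfD bLa)//; first last.
  - by apply: bmfD => //; exact: bmfM.
  rewrite (bfD bLa)//; last exact: bmfM.
  rewrite !(bfZ bLa)// [La (fun=> 1%R)](_ : _ = 0)%R ?mulr0 ?addr0//.
  by rewrite /La /kernel_dev !bmf_Rintegral_cst// subrr.
have h1 := bv_functional bLa bg2 g2D Lar.
have h2 := bv_functional bLa bg gD Lar.
rewrite devE; apply: le_trans (ler_normD _ _) _.
rewrite normrM [leRHS]mulrDl; apply: lerD => //.
rewrite normrN normrM ger0_norm// -[leRHS]mulrA ler_pM// ?mulr_ge0//.
by rewrite ler_pM2l.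
Qed.

Lemma dev2_le v u w : (0 < u)%N -> `|(dev2 g kappa1 kappa2 v u w)%:E| <=
  (D * D)%:E * b2 (v + u)%N%:Z v%:Z (kappa2 (v + u)%N%:Z v%:Z) w.
Proof.
move=> u0; set kappa := kappa2 _ _; pose Z w := (Y (v + u)%N%:Z w, Y v%:Z w).
have mZ : measurable_fun setT Z by exact: measurable_fun_pair.
have bLa := bf_kernel_dev kappa w mZ.
set La := kernel_dev _ _ _ in bLa.
have k1 : kappa w setT = 1 by exact: prob_kernel.
pose E (h : R -> R) := (\int[P]_w h (Y 0 w))%R.
have bE : bounded_functional E 1.
  split=> [f h bf bh|c f bf|f N bf fN].
  - by rewrite /E bmf_RintegralD//; exact: (bmf_comp (mY 0)).
  - by rewrite /E bmf_RintegralZ//; exact: (bmf_comp (mY 0)).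
  - by rewrite mul1r; apply: bmf_normr_Rintegral_cst => //; exact: (bmf_comp (mY 0)).
have E1 : E (fun=> 1%R) = 1%R by exact: bmf_Rintegral_cst.
pose ff t s (z : R * R) := ((half_line t z.1 - E (half_line t))
  * (half_line s z.2 - E (half_line s)))%R.
have bff t s : bounded_measurable (ff t s).
  apply: bmfM; apply: bmfB; try exact: bmf_cst.
    by apply: (bmf_comp _ (bmf_half_line t)); exact: measurable_fst.
  by apply: (bmf_comp _ (bmf_half_line s)); exact: measurable_snd.
have tensE t s z : tens (f0_ Y t) (f0_ Y s) z = (ff t s z)%:E.
  by rewrite /tens !f0_E -EFinM.
have supE st : `| \int[kappa w]_z tens (f0_ Y st.2) (f0_ Y st.1) z
       - \int[pushforward P (fun v => Z v)]_z tens (f0_ Y st.2) (f0_ Y st.1) z |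
    = (`|La (ff st.2 st.1)|)%R%:E.
  under eq_integral do rewrite tensE.
  rewrite (bmf_RintegralE k1 (bff _ _)) integral_pushforward//; first last.
  - have -> : tens (f0_ Y st.2) (f0_ Y st.1) \o Z = EFin \o (ff st.2 st.1 \o Z).
      by apply/funext => x /=; rewrite tensE.
    by apply: bmf_integrable => //; exact: (bmf_comp mZ).
  - have -> : tens (f0_ Y st.2) (f0_ Y st.1) = EFin \o ff st.2 st.1.
      by apply/funext => x /=; rewrite tensE.
    by apply/measurable_EFinP; have [] := bff st.2 st.1.
  under [X in _ - X]eq_integral do rewrite /= tensE.
  rewrite preimage_setT bmf_RintegralE//; first exact: (bmf_comp mZ).
apply: le_scaled_bound; first exact: mulr_gt0.
  apply: (@le_trans _ _ (`|La (ff 0 0)|)%R%:E); first by rewrite lee_fin.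
  by rewrite -(supE (0, 0)%R); apply: ereal_sup_ubound; exists (0, 0)%R.
move=> r br.
have -> : dev2 g kappa1 kappa2 v u w = La (fun z => (g z.1 - E g) * (g z.2 - E g))%R.
  rewrite /dev2 ifN -?lt0n// bmf_RintegralB//; last exact: bmf_cst.
    rewrite bmf_Rintegral_cst// /La /kernel_dev; congr (_ - _)%R.
    rewrite -(Rintegral_obs_mul statY mg gM v u).
    by apply: eq_Rintegral => w' _; rewrite mulrC.
  by apply: bmfM; apply: bmfB; try exact: bmf_cst;
    apply: (bmf_comp _ bg); [exact: measurable_fst|exact: measurable_snd].
apply: (bv_functional2 bLa bE E1 bg gM (ltW D0) gD) => s t.
rewrite -lee_fin; apply: le_trans br; rewrite -(supE (s, t)).
by apply: ereal_sup_ubound; exists (s, t).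
Qed.

End CoefficientBounds.

Local Close Scope ereal_scope.

(** * Inequalities for powers *)

Section PowerInequalities.
Variable R : realType.
Implicit Types p q a b : R.

Definition scales_bound p K : Prop :=
  forall (N n : nat) (b : nat -> R), (forall v, 0 <= b v) ->
  \sum_(0 <= t < N) (4 ^+ t) `^ (p - 2) * \sum_((4 ^ t)%N <= v < n.+1) b v <=
  K * \sum_(0 <= v < n.+1) v.+1%:R `^ (p - 2) * b v.

(** Only the scales [4 ^ t <= v] see the index [v], and [(4 ^ t) `^ (p - 2)]
    grows geometrically. *)
Lemma sum_scales_le p : 2 < p -> exists2 K, 0 < K & scales_bound p K.
Proof.
move=> p2; have p20 : 0 <= p - 2 by lra.
pose a : R := 4 `^ (p - 2).
have a1 : 1 < a.
  have := @gt0_ltr_powR _ (p - 2) _ 1 4; rewrite powR1; apply; rewrite ?nnegrE ?subr_gt0//.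
  by rewrite ltr1n.
have a0 : 0 < a - 1 by rewrite subr_gt0.
have aE t : (4 ^+ t) `^ (p - 2) = a ^+ t.
  by rewrite -[4 ^+ t]powR_mulrn// powRAC powR_mulrn ?powR_ge0.
exists (a / (a - 1)); first by rewrite divr_gt0// (lt_trans _ a1).
move=> N n b b0.
have scale v : \sum_(0 <= t < N | (4 ^ t <= v)%N) a ^+ t <=
    a / (a - 1) * v.+1%:R `^ (p - 2).
  rewrite mulrAC ler_pdivlMr// mulr_suml.
  suff H M : \sum_(0 <= t < M | (4 ^ t <= v)%N) a ^+ t * (a - 1) <=
      a * v.+1%:R `^ (p - 2) /\ ((4 ^ M <= v)%N ->
      \sum_(0 <= t < M | (4 ^ t <= v)%N) a ^+ t * (a - 1) = a ^+ M - 1).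
    by have [] := H N.
  elim: M => [|M [IH1 IH2]].
    by rewrite !big_geq// expr0 subrr mulr_ge0 ?powR_ge0// ltW// (lt_trans _ a1).
  have Mv : (4 ^ M.+1 <= v)%N -> (4 ^ M <= v)%N.
    by apply: leq_trans; rewrite leq_exp2l.
  rewrite !big_mkcond !big_nat_recr//= -!big_mkcond; split; last first.
    by move=> /Mv Mv'; rewrite IH2// Mv' exprSr; ring.
  case: ifPn => [Mv'|_]; last by rewrite addr0.
  rewrite IH2//; apply: (@le_trans _ _ (a * a ^+ M)); first by nra.
  rewrite ler_pM2l ?(lt_trans _ a1)// -aE powR_le//.
  by rewrite -natrX ler_nat ltnW.
apply: (@le_trans _ _ (\sum_(0 <= v < n.+1)
    (\sum_(0 <= t < N | (4 ^ t <= v)%N) a ^+ t) * b v)).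
  rewrite le_eqVlt; apply/orP; left; apply/eqP.
  transitivity (\sum_(0 <= t < N) \sum_(0 <= v < n.+1 | (4 ^ t <= v)%N) a ^+ t * b v).
    apply: eq_bigr => t _; rewrite aE mulr_sumr.
    by rewrite (big_nat_widenl _ 0).
  under [RHS]eq_bigr do rewrite mulr_suml big_mkcond.
  under [LHS]eq_bigr do rewrite big_mkcond.
  by rewrite exchange_big.
by rewrite mulr_sumr ler_sum// => v _; rewrite mulrA ler_wpM2r.
Qed.

Lemma powR_sub_le q a b : 1 < q -> 0 <= a -> 0 <= b ->
  (a + b) `^ q - a `^ q <= q * ((a + b) `^ (q - 1) * b).
Proof.
move=> q1 a0 b0; set y := a + b; have q0 : 0 < q by lra.
have y0 : 0 <= y by rewrite addr_ge0.
have conj : q^-1 + (q / (q - 1))^-1 = 1.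
  by rewrite invf_div; field; rewrite gt_eqF.
have := conjugate_powR a0 (powR_ge0 y (q - 1)) q0 _ conj.
rewrite -powRrM mulrCA divff ?mulr1 ?gt_eqF ?subr_gt0//.
rewrite divr_gt0 ?subr_gt0// => /(_ isT).
rewrite invf_div => H; have := ler_wpM2l (ltW q0) H.
have -> : q * (a `^ q / q + y `^ q * ((q - 1) / q)) = a `^ q + (q - 1) * y `^ q.
  by field; rewrite gt_eqF.
have yq : y `^ q = y `^ (q - 1) * y.
  by rewrite -{3}[y]powRr1// -powRD ?subrK//; apply/implyP => /eqP; lra.
by rewrite yq /y; move: (_ `^ (q - 1)) (a `^ q) => ? ?; nra.
Qed.

(** Adding [b k] to the partial sum of the earlier terms, which is at most [k],
    raises its [q]-th power by at most [q * k.+1 ^ (q - 1) * b k]. *)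
Lemma powR_sum_le q N (b : nat -> R) : 1 < q -> (forall k, 0 <= b k <= 1) ->
  (\sum_(0 <= k < N) b k) `^ q <= q * \sum_(0 <= k < N) k.+1%:R `^ (q - 1) * b k.
Proof.
move=> q1 b01; have q0 : 0 < q by lra.
have sN M : 0 <= \sum_(0 <= k < M) b k <= M%:R.
  rewrite sumr_ge0/= => [|k _]; last by case/andP: (b01 k).
  rewrite (le_trans (ler_sum _ (fun k _ => (andP (b01 k)).2)))//.
  by rewrite sumr_const_nat subn0.
elim: N => [|N IHN]; first by rewrite !big_geq// powR0 ?mulr0// gt_eqF.
rewrite !big_nat_recr//= mulrDr.
have /andP[bN0 bN1] := b01 N; have /andP[s0 sNN] := sN N.
have := powR_sub_le q1 s0 bN0; rewrite lerBlDl => /le_trans; apply.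
rewrite lerD// ler_wpM2l ?(ltW q0)// ler_wpM2r// powR_le//; [lra|exact: addr_ge0|].
by rewrite -natr1 lerD.
Qed.

(** Weighted Young inequality, normalised so as to be summed. *)
Lemma young_weighted th a b A B : 0 < th < 1 -> 0 <= a -> 0 <= b ->
  0 < A -> 0 < B ->
  a `^ (1 - th) * b `^ th <=
  A `^ (1 - th) * B `^ th * ((1 - th) * (a / A) + th * (b / B)).
Proof.
move=> /andP[th0 th1] a0 b0 A0 B0.
have th'0 : 0 < 1 - th by rewrite subr_gt0.
have -> : a `^ (1 - th) = A `^ (1 - th) * (a / A) `^ (1 - th).
  by rewrite -powRM ?divr_ge0 ?(ltW A0)// mulrC divfK// gt_eqF.
have -> : b `^ th = B `^ th * (b / B) `^ th.
  by rewrite -powRM ?divr_ge0 ?(ltW B0)// mulrC divfK// gt_eqF.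
rewrite mulrACA ler_wpM2l ?mulr_ge0 ?powR_ge0//.
have conj : (1 - th)^-1^-1 + th^-1^-1 = 1 by rewrite !invrK subrK.
have := conjugate_powR (powR_ge0 (a / A) (1 - th)) (powR_ge0 (b / B) th) _ _ conj.
rewrite !invr_gt0 th0 th'0 => /(_ isT isT) /le_trans; apply.
rewrite -!powRrM !mulfV ?gt_eqF// !powRr1 ?divr_ge0 ?(ltW A0) ?(ltW B0)//.
by rewrite !invrK mulrC [_ * th]mulrC.
Qed.

Lemma hoelder_sum (I : finType) th (a b : I -> R) : 0 < th < 1 ->
  (forall i, 0 <= a i) -> (forall i, 0 <= b i) ->
  \sum_i a i `^ (1 - th) * b i `^ th <=
  (\sum_i a i) `^ (1 - th) * (\sum_i b i) `^ th.
Proof.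
move=> th01 a0 b0; have /andP[th0 th1] := th01.
have th'0 : 0 < 1 - th by rewrite subr_gt0.
have sa : 0 <= \sum_i a i by exact: sumr_ge0.
have sb : 0 <= \sum_i b i by exact: sumr_ge0.
have zero (c : I -> R) : (forall i, 0 <= c i) -> \sum_i c i = 0 -> forall i, c i = 0.
  move=> c0 /eqP; rewrite psumr_eq0// => /allP H i.
  by apply/eqP; apply: H; rewrite mem_index_enum.
have [sa0|sa_neq0] := eqVneq (\sum_i a i) 0.
  rewrite big1 ?mulr_ge0 ?powR_ge0// => i _.
  by rewrite (zero a)// powR0 ?mul0r// gt_eqF.
have [sb0|sb_neq0] := eqVneq (\sum_i b i) 0.
  rewrite big1 ?mulr_ge0 ?powR_ge0// => i _.
  by rewrite (zero b)// [0 `^ th]powR0 ?mulr0// gt_eqF.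
have A0 : 0 < \sum_i a i by rewrite lt_def sa_neq0.
have B0 : 0 < \sum_i b i by rewrite lt_def sb_neq0.
apply: le_trans (ler_sum _ (fun i _ => young_weighted th01 (a0 i) (b0 i) A0 B0)) _.
rewrite -mulr_sumr big_split/= -!mulr_sumr -!mulr_suml !divff ?gt_eqF//.
by rewrite !mulr1 subrK mulr1.
Qed.

Lemma sum_powR_le (N : nat) (a : 'I_N -> R) p : 1 <= p -> (forall i, 0 <= a i) ->
  (\sum_i a i) `^ p <= N%:R `^ p * \sum_i a i `^ p.
Proof.
move=> p1 a0; have p0 : 0 <= p by lra.
case: N a a0 => [|N] a a0; first by rewrite !big_ord0 powR0 ?mulr0//; apply/eqP; lra.
have [k ka] : exists k, forall i, a i <= a k.
  by exists [arg max_(i > ord0) a i]%O; case: arg_maxP => //= k _ H i; exact: H.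
apply: (@le_trans _ _ ((N.+1%:R * a k) `^ p)).
  apply: powR_le => //; first exact: sumr_ge0.
  by rewrite (le_trans (ler_sum _ (fun i _ => ka i)))// sumr_const card_ord mulr_natl.
rewrite powRM// ler_wpM2l ?powR_ge0// (bigD1 k)//= lerDl sumr_ge0// => i _.
exact: powR_ge0.
Qed.

End PowerInequalities.

(** Hölder's inequality for the factors [\1_A] and [\1_A * B]. *)
Lemma hoelder_indic d (T : measurableType d) (R : realType)
    (mu : {measure set T -> \bar R}) (A : set T) (B : T -> R) (q : R) :
  mu setT = 1%E -> measurable A -> 1 < q -> bounded_measurable B ->
  (forall w, 0 <= B w) ->
  \int[mu]_w (\1_A w * B w) <=
  (\int[mu]_w \1_A w) `^ (1 - q^-1) * (\int[mu]_w (\1_A w * B w `^ q)) `^ (q^-1).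
Proof.
move=> mu1 mA q1 bB B0; have q0 : 0 < q by lra.
have bA : bounded_measurable (\1_A : T -> R) by exact: bmf_indic.
have b1B : bounded_measurable (fun w => \1_A w * B w) by exact: bmfM.
have bBq : bounded_measurable (fun w => B w `^ q) by apply: bmf_powR => //; exact: ltW.
have b1Bq : bounded_measurable (fun w => \1_A w * B w `^ q) by exact: bmfM.
have q'0 : 0 < 1 - q^-1 by rewrite subr_gt0 invf_lt1.
pose q' := (1 - q^-1)^-1; have q'_gt0 : 0 < q' by rewrite invr_gt0.
have conj : q'^-1 + q^-1 = 1 by rewrite invrK subrK.
have A01 w : \1_A w = 0 :> R \/ \1_A w = 1 :> R.
  by rewrite indicE; case: (_ \in _); [right|left].
have := hoelder mu bA.1 b1B.1 q'_gt0 q0 conj.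
rewrite Lnorm1 unlock/=.
have -> : (\int[mu]_x `|(\1_A x * (\1_A x * B x))%:E|)%E =
    (\int[mu]_w (\1_A w * B w))%:E.
  rewrite -(bmf_RintegralE mu1)//; apply: eq_integral => w _ /=.
  by congr (_%:E); case: (A01 w) => ->; rewrite ?mul0r ?mul1r ?normr0 ?ger0_norm.
have -> : (\int[mu]_x (`|\1_A x| `^ q')%:E)%E = (\int[mu]_w \1_A w)%:E.
  rewrite -(bmf_RintegralE mu1)//; apply: eq_integral => w _ /=.
  by congr (_%:E); case: (A01 w) => ->; rewrite ?normr0 ?normr1 ?powR1 ?powR0 ?gt_eqF.
have -> : (\int[mu]_x (`|(\1_A x * B x)%R| `^ q)%:E)%E =
    (\int[mu]_w (\1_A w * B w `^ q))%:E.
  rewrite -(bmf_RintegralE mu1)//; apply: eq_integral => w _ /=.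
  congr (_%:E); case: (A01 w) => ->; rewrite ?mul0r ?mul1r ?normr0.
    by rewrite powR0 ?gt_eqF.
  by rewrite ger0_norm.
by rewrite invrK -EFinM lee_fin.
Qed.

(** * Summation over the cells of a partition *)

Section Family.
Context d (Omega : measurableType d) (R : realType) (P : probability Omega R).
Variable Y : int -> {RV P >-> R}.
Hypothesis statY : strictly_stationary Y.
Variables (kappa1 : int -> R.-pker (Fsigma Y 0) ~> R)
  (kappa2 : int -> int -> R.-pker (Fsigma Y 0) ~> (R * R)%type).
Hypothesis hkappa1 : forall k, is_cond_dist (Y k) (kappa1 k).
Hypothesis hkappa2 : forall i j, is_cond_dist (fun w => (Y i w, Y j w)) (kappa2 i j).
Variables (m : nat) (g : 'I_m -> R -> R) (I : 'I_m -> set R) (M D D' : R).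
Hypothesis M0 : 0 < M.
Hypothesis D0 : 0 < D.
Hypothesis D'0 : 0 < D'.
Hypothesis MD : 2 * M <= D.
Hypothesis mI : forall j, measurable (I j).
Hypothesis I1 : forall y, \sum_j (\1_(I j) y : R) <= 1.
Hypothesis mg : forall j, measurable_fun setT (g j).
Hypothesis gM : forall j y, `|g j y| <= M * \1_(I j) y.
Hypothesis gD : forall j, step_approximable D (g j).
Hypothesis g2D : forall j, step_approximable D' (fun y => g j y ^+ 2).

Let P1 : P setT = 1%E. Proof. exact: probability_setT. Qed.

Let indic01 (A : set R) y : 0 <= (\1_A y : R) <= 1.
Proof. by rewrite indicE; case: (_ \in _); rewrite ?lexx ?ler01. Qed.

Let gM' j y : `|g j y| <= M.
Proof.
by rewrite (le_trans (gM j y))// ler_piMr ?(ltW M0)//; case/andP: (indic01 (I j) y).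
Qed.

Let sum_g y : \sum_j `|g j y| <= M.
Proof.
rewrite (le_trans (ler_sum _ (fun j _ => gM j y)))// -mulr_sumr.
by rewrite ler_piMr ?(ltW M0).
Qed.

Lemma sum_obs_le k w : \sum_j `|obs Y (g j) k w| <= 2 * M.
Proof.
rewrite (le_trans (ler_sum _ (fun j _ => ler_normB _ _)))// big_split/=.
rewrite mulr_natl mulr2n lerD//.
have bgY j : bounded_measurable (fun w => `|g j (Y 0 w)|).
  exact: bmf_norm (bmf_gY _ (mg j) (gM' j) 0).
rewrite (@le_trans _ _ (\sum_j \int[P]_w `|g j (Y 0 w)|))//.
  apply: ler_sum => j _; apply: bmf_normr_Rintegral => //.
  exact: bmf_gY (mg j) (gM' j) 0.
rewrite -bmf_Rintegral_sum// -(bmf_Rintegral_cst P1 M).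
by apply: bmf_le_Rintegral => //; [exact: bmf_sum|exact: bmf_cst].
Qed.

Let bobs j k : bounded_measurable (fun w => `|obs Y (g j) k w|).
Proof. exact: bmf_norm (bmf_obs Y (mg j) (gM' j) k). Qed.

Let bdev1 j v : bounded_measurable (fun w : Omega => `|dev1 (g j) kappa1 v w|).
Proof. exact: bmf_norm (bmf_dev1 (mg j) (gM' j) kappa1 v). Qed.

Let bdev2 j v u : bounded_measurable (fun w : Omega => `|dev2 (g j) kappa1 kappa2 v u w|).
Proof. exact: bmf_norm (bmf_dev2 (mg j) (gM' j) kappa1 kappa2 v u). Qed.

(** The weights [`|obs (g j) 0|] add up to a bounded function, so a bound on the
   deviations that does not depend on the cell is paid only once. *)
Let weighted_dev_le (dev : 'I_m -> Omega -> R) (b : Omega -> \bar R) (c : R) :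
  (forall j, bounded_measurable (fun w => `|dev j w|)) -> 0 < c ->
  (forall w, (0 <= b w)%E) -> (forall j w, (`|dev j w|%:E <= c%:E * b w)%E) ->
  ((\sum_j \int[P]_w (`|obs Y (g j) 0 w| * `|dev j w|))%:E <=
    (2 * M * c)%:E * \int[P]_w b w)%E.
Proof.
move=> bdev c0 b0 devb; rewrite -bmf_Rintegral_sum//; last by move=> j _; exact: bmfM.
apply: Rintegral_le_lower => //.
- by rewrite !mulr_gt0.
- by apply: bmf_sum => j _; exact: bmfM.
- by move=> w; apply: sumr_ge0 => j _; rewrite mulr_ge0.
move=> w; apply: le_scaled_bound => //; first by rewrite !mulr_gt0.
move=> r br; have devr j : `|dev j w| <= c * r.
  rewrite -lee_fin (le_trans (devb j w))// EFinM lee_pmul2l//.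
have r0 : 0 <= r by rewrite -lee_fin (le_trans (b0 w)).
rewrite (le_trans (ler_sum _ (fun j _ => ler_wpM2l _ (devr j))))//.
by rewrite -mulr_suml -mulrA ler_wpM2r ?sum_obs_le// mulr_ge0// ltW.
Qed.

Lemma sum_obs_e1_le v :
  ((\sum_j obs_e1 (g j) kappa1 v)%:E <= (2 * M * D)%:E * beta1 kappa1 v%:Z)%E.
Proof.
apply: weighted_dev_le => //.
- by move=> w; exact: b1_ge0.
- by move=> j w; exact: (dev1_le statY (mg j) (gM' j) D0 (gD j)).
Qed.

Definition dev_bound := D' + 2 * M * D + D * D.

Lemma dev_bound_gt0 : 0 < dev_bound.
Proof. by rewrite /dev_bound; do ?[apply: addr_gt0]; rewrite ?mulr_gt0. Qed.

Lemma sum_obs_e2_le v u : ((\sum_j obs_e2 (g j) kappa1 kappa2 v u)%:E <=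
  (2 * M * dev_bound)%:E * beta2 kappa1 kappa2 v%:Z)%E.
Proof.
have MM : 0 < 2 * M by rewrite mulr_gt0.
have DD := dev_bound_gt0.
case: u => [|u].
  apply: (@le_trans _ _ ((2 * M * (D' + 2 * M * D))%:E * beta1 kappa1 v%:Z)%E).
    apply: weighted_dev_le => //.
    - by rewrite addr_gt0// mulr_gt0.
    - by move=> w; exact: b1_ge0.
    move=> j w; exact: (dev2_0_le statY (mg j) (gM' j) D0 D'0 (gD j) (g2D j)).
  have beta1_0 : (0 <= beta1 kappa1 v%:Z)%E.
    by apply: integral_ge0 => w _; exact: b1_ge0.
  apply: lee_pmul => //; first by rewrite lee_fin !mulr_ge0 ?addr_ge0 ?mulr_ge0 ?ltW.
    by rewrite lee_fin ler_pM2l// /dev_bound lerDl mulr_ge0 ?(ltW D0).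
  by rewrite /beta2 le_max lexx.
apply: (@le_trans _ _ ((2 * M * (D * D))%:E *
    \int[P]_w b2 (v + u.+1)%N%:Z v%:Z (kappa2 (v + u.+1)%N%:Z v%:Z) w)%E).
  apply: weighted_dev_le => //.
  - exact: mulr_gt0.
  - by move=> w; exact: b2_ge0.
  move=> j w; exact: (dev2_le statY (mg j) (gM' j) D0 (gD j)).
apply: lee_pmul.
- by rewrite lee_fin !mulr_ge0 ?ltW.
- by apply: integral_ge0 => w _; exact: b2_ge0.
- rewrite lee_fin ler_pM2l// /dev_bound lerDr addr_ge0 ?(ltW D'0)//.
  by rewrite !mulr_ge0 ?ltW.
rewrite /beta2 le_max; apply/orP; right; apply: ereal_sup_ubound.
by exists (v + u.+1)%N%:Z, v%:Z; split => //; lia.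
Qed.

Definition scale_error p n j := \sum_(0 <= t < n.+1) (4 ^+ t) `^ (p - 2)
  * (tail1 n (obs_e1 (g j) kappa1) (4 ^ t)
     + tail2 n (obs_e2 (g j) kappa1 kappa2) (4 ^ t) / 4 ^+ t).

Lemma beta2_ge0 v : (0 <= beta2 kappa1 kappa2 v)%E.
Proof.
rewrite /beta2 le_max; apply/orP; left.
by apply: integral_ge0 => w _; exact: b1_ge0.
Qed.

Lemma sum_scale_error_le (p K : R) n : 0 < K ->
  scales_bound p K ->
  ((\sum_j scale_error p n j)%:E <=
    (K * (2 * (2 * M * (dev_bound + D))))%:E * V2 kappa1 kappa2 p n)%E.
Proof.
move=> K0 HK; set W := 2 * M * (dev_bound + D).
have W0 : 0 < W by rewrite !mulr_gt0// addr_gt0// dev_bound_gt0.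
have C0 : 0 < K * (2 * W) by rewrite mulr_gt0// mulr_gt0.
apply: le_scaled_bound => //.
  apply: sume_ge0 => k _; rewrite mule_ge0 ?beta2_ge0// lee_fin powR_ge0//.
move=> s V2s.
have beta2_fin v : (v <= n)%N -> beta2 kappa1 kappa2 v%:Z \is a fin_num.
  move=> vn; rewrite ge0_fin_numE ?beta2_ge0// ltNge leye_eq; apply/negP => /eqP bv.
  move: V2s; rewrite /V2 big_mkord (bigD1 (Ordinal (vn : (v < n.+1)%N)))//= bv.
  rewrite gt0_muley ?lte_fin ?powR_gt0// addye ?leye_eq//.
  rewrite -ltNye; apply: (lt_le_trans ltNy0); apply: sume_ge0 => k _.
  by rewrite mule_ge0 ?beta2_ge0// lee_fin powR_ge0.
pose b v : R := fine (beta2 kappa1 kappa2 v%:Z).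
have b0 v : 0 <= b v by apply: fine_ge0; exact: beta2_ge0.
have bE v : (v <= n)%N -> (beta2 kappa1 kappa2 v%:Z = (b v)%:E)%E.
  by move=> vn; rewrite fineK// beta2_fin.
have V2E : V2 kappa1 kappa2 p n =
    (\sum_(0 <= v < n.+1) v.+1%:R `^ (p - 2) * b v)%:E.
  rewrite /V2 -sumEFin; apply: eq_big_nat => v /andP[_ vn].
  by rewrite EFinM -bE.
have e1W v : (v <= n)%N -> \sum_j obs_e1 (g j) kappa1 v <= W * b v.
  move=> vn; rewrite -lee_fin EFinM -(bE _ vn); apply: le_trans (sum_obs_e1_le v) _.
  apply: lee_pmul.
  - by rewrite lee_fin !mulr_ge0 ?ltW.
  - by apply: integral_ge0 => w _; exact: b1_ge0.
  - rewrite lee_fin /W ler_pM2l ?mulr_gt0// lerDr ltW//; exact: dev_bound_gt0.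
  - by rewrite /beta2 le_max lexx.
have e2W v u : (v <= n)%N -> \sum_j obs_e2 (g j) kappa1 kappa2 v u <= W * b v.
  move=> vn; rewrite -lee_fin EFinM -(bE _ vn); apply: le_trans (sum_obs_e2_le v u) _.
  apply: lee_pmul => //.
  - by rewrite lee_fin !mulr_ge0 ?ltW// dev_bound_gt0.
  - exact: beta2_ge0.
  - by rewrite lee_fin /W ler_pM2l ?mulr_gt0// lerDl ltW.
apply: (@le_trans _ _ (\sum_(0 <= t < n.+1) (4 ^+ t) `^ (p - 2) *
    \sum_((4 ^ t)%N <= v < n.+1) 2 * W * b v)).
  rewrite /scale_error exchange_big/= ler_sum// => t _.
  rewrite -mulr_sumr ler_wpM2l ?powR_ge0// big_split/= -mulr_suml.
  have -> : \sum_((4 ^ t)%N <= v < n.+1) 2 * W * b v =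
      \sum_((4 ^ t)%N <= v < n.+1) W * b v + \sum_((4 ^ t)%N <= v < n.+1) W * b v.
    by rewrite -big_split/=; apply: eq_bigr => v _; ring.
  apply: lerD.
    by rewrite exchange_big/=; apply: ler_sum_nat => v /andP[_ vn]; exact: e1W.
  rewrite ler_pdivrMr ?exprn_gt0// exchange_big/= mulr_suml.
  apply: ler_sum_nat => v /andP[_ vn]; rewrite exchange_big/=.
  apply: (@le_trans _ _ (\sum_(0 <= u < 4 ^ t) W * b v)).
    by apply: ler_sum => u _; exact: e2W.
  by rewrite sumr_const_nat subn0 -[_ *+ (4 ^ t)]mulr_natr natrX.
apply: le_trans (HK _ _ _ _) _.
  by move=> v; rewrite mulr_ge0// mulr_ge0// ltW.
rewrite -[leRHS]mulrA ler_pM2l//.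
apply: (@le_trans _ _ (2 * W * \sum_(0 <= v < n.+1) v.+1%:R `^ (p - 2) * b v)).
  by rewrite mulr_sumr ler_sum// => v _; rewrite mulrCA.
rewrite ler_pM2l; last exact: mulr_gt0.
by rewrite -lee_fin -V2E.
Qed.

(** The cells being disjoint, this is the deviation attached to the cell that
    contains [Y 0]: a measurable function below [b1], with values in [0, 1]. *)
Definition cell_dev u w :=
  \sum_j \1_(I j) (Y 0 w) * (`|dev1 (g j) kappa1 u w| / D).

Let b1I j : bounded_measurable (fun w => \1_(I j) (Y 0 w) : R).
Proof. by apply: (bmf_comp _ (bmf_indic R (mI j))); exact: measurable_funPT. Qed.

Let bmf_cell_dev u : bounded_measurable (cell_dev u : Omega -> R).
Proof.
apply: bmf_sum => j _; apply: bmfM => //.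
by apply: bmfM; [exact: bdev1|exact: bmf_cst].
Qed.

Lemma cell_dev01 u w : 0 <= cell_dev u w <= 1.
Proof.
have term j : 0 <= \1_(I j) (Y 0 w) * (`|dev1 (g j) kappa1 u w| / D)
    <= (\1_(I j) (Y 0 w) : R).
  have /andP[i0 _] := indic01 (I j) (Y 0 w).
  rewrite mulr_ge0 ?divr_ge0 ?(ltW D0)//= ler_piMr//.
  rewrite ler_pdivrMr// mul1r (le_trans _ MD)//.
  apply: bmf_normr_Rintegral_cst; first exact: prob_kernel.
    exact: bmf_g_sub_mean (mg j) (gM' j).
  move=> y; rewrite (le_trans (ler_normB _ _))// mulr_natl mulr2n lerD//.
  exact: mean_le (mg j) (gM' j).
rewrite sumr_ge0/= => [|j _]; last by case/andP: (term j).
rewrite (le_trans _ (I1 (Y 0 w)))// ler_sum// => j _.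
by case/andP: (term j).
Qed.

Lemma Rintegral_cell_dev_le u :
  ((\int[P]_w cell_dev u w)%:E <= beta1 kappa1 u%:Z)%E.
Proof.
rewrite -[leRHS]mul1e; apply: Rintegral_le_lower => //.
  by move=> w; case/andP: (cell_dev01 u w).
move=> w; apply: le_scaled_bound => //; first exact: b1_ge0.
move=> r br.
have r0 : 0 <= r by rewrite -lee_fin; apply: le_trans br; exact: b1_ge0.
have term j : \1_(I j) (Y 0 w) * (`|dev1 (g j) kappa1 u w| / D) <= \1_(I j) (Y 0 w) * r.
  have /andP[i0 _] := indic01 (I j) (Y 0 w).
  rewrite ler_wpM2l// ler_pdivrMr// mulrC -lee_fin.
  rewrite (le_trans (dev1_le statY (mg j) (gM' j) D0 (gD j) kappa1 u w))//.
  by rewrite EFinM lee_pmul2l.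
rewrite mul1r (le_trans (ler_sum _ (fun j _ => term j)))// -mulr_suml.
by rewrite ler_piMl.
Qed.

Section FamilyMoment.
Variables (p : R) (n : nat).
Hypothesis p2 : 2 < p.

Let theta := p / (2 * (p - 1)).
Let B w := \sum_(0 <= u < n.+1) cell_dev u w.
Let V := \sum_(0 <= u < n.+1) u.+1%:R `^ (p - 2) * \int[P]_w cell_dev u w.

Definition cell_prob j := \int[P]_w (\1_(I j) (Y 0 w) : R).

Let X j := \int[P]_w (\1_(I j) (Y 0 w) * B w).

Let p1 : 1 < p - 1. Proof. by have := p2; lra. Qed.
Let p1_gt0 : 0 < p - 1. Proof. by have := p2; lra. Qed.

Let theta01 : 0 < theta < 1.
Proof.
have p0 : 0 < p by have := p2; lra.
rewrite /theta divr_gt0 ?mulr_gt0//= ltr_pdivrMr ?mulr_gt0//.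
by have := p2; lra.
Qed.

Let bB : bounded_measurable (B : Omega -> R).
Proof. by apply: bmf_sum => u _; exact: bmf_cell_dev. Qed.

Let B0 w : 0 <= B w.
Proof. by apply: sumr_ge0 => u _; case/andP: (cell_dev01 u w). Qed.

Let cell_int_ge0 u : 0 <= \int[P]_w cell_dev u w.
Proof. by apply: Rintegral_ge0 => w _; case/andP: (cell_dev01 u w). Qed.

Let V0 : 0 <= V.
Proof. by apply: sumr_ge0 => u _; rewrite mulr_ge0 ?powR_ge0. Qed.

Let X0 j : 0 <= X j.
Proof.
by apply: Rintegral_ge0 => w _; rewrite mulr_ge0.
Qed.

Let V_le_V1 : (V%:E <= V1 kappa1 p n)%E.
Proof.
rewrite /V /V1 -sumEFin; apply: lee_sum => u _; rewrite EFinM.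
by rewrite lee_pmul ?lee_fin ?powR_ge0// Rintegral_cell_dev_le.
Qed.

Let V1_le_V2 : (V1 kappa1 p n <= V2 kappa1 kappa2 p n)%E.
Proof.
apply: lee_sum => u _; rewrite lee_pmul ?lee_fin ?powR_ge0//.
  by apply: integral_ge0 => w _; exact: b1_ge0.
by rewrite /beta2 le_max lexx.
Qed.

(** With [B = \sum_u cell_dev u], the long variance of the cell [j] is at most a
    constant times the integral of [B] over the event that [Y 0] is in [I j]. *)
Let variance_le j : long_variance n (obs_cov (g j) kappa1) <= 2 * M * D * X j.
Proof.
rewrite /long_variance -!mulrA ler_wpM2l//.
have -> : M * (D * X j) = \sum_(0 <= u < n.+1)
    M * D * \int[P]_w (\1_(I j) (Y 0 w) * cell_dev u w).
  rewrite -mulr_sumr -bmf_Rintegral_sum//; last by move=> u _; exact: bmfM.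
  rewrite mulrA /X; congr (_ * _); apply: eq_Rintegral => w _.
  by rewrite /B mulr_sumr.
apply: ler_sum => u _; rewrite -bmf_RintegralZ//; last exact: bmfM.
apply: bmf_le_Rintegral => //.
- by apply: bmfM => //; exact: bmf_norm (bmf_gY _ (mg j) (gM' j) 0).
- by apply: bmfM; [exact: bmf_cst|exact: bmfM].
move=> w; have /andP[i0 i1] := indic01 (I j) (Y 0 w).
apply: (@le_trans _ _ (M * \1_(I j) (Y 0 w) * `|dev1 (g j) kappa1 u w|)).
  by rewrite ler_wpM2r.
have H : \1_(I j) (Y 0 w) * `|dev1 (g j) kappa1 u w| <= D * cell_dev u w.
  rewrite [leRHS]mulrC -ler_pdivrMr// -mulrA /cell_dev (bigD1 j)//= lerDl.
  by apply: sumr_ge0 => i _; rewrite mulr_ge0 ?divr_ge0 ?(ltW D0).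
rewrite -!mulrA ler_wpM2l ?(ltW M0)//; move: H; rewrite indicE.
by case: (_ \in _); rewrite ?mul1r// !mul0r mulr0.
Qed.

Let sum_X_le : \sum_j X j <= V.
Proof.
rewrite -bmf_Rintegral_sum//; last by move=> j _; exact: bmfM.
apply: (@le_trans _ _ (\int[P]_w B w)).
  apply: bmf_le_Rintegral => //; first by apply: bmf_sum => j _; exact: bmfM.
  by move=> w; rewrite -mulr_suml ler_piMl.
rewrite /B bmf_Rintegral_sum// ler_sum// => u _; rewrite ler_peMl//.
rewrite -[leLHS](powRr0 u.+1%:R) ler_powR//; first by rewrite ler1n.
by rewrite subr_ge0 ltW.
Qed.

(** Hölder's inequality twice: in each cell, with the exponent [p - 1] on [B], and
    over the cells, with the exponents [1 - theta] and [theta].  The integral of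
    [B ^ (p - 1)] is then compared with [V1] by [powR_sum_le], as the deviations
    are in [0, 1]. *)
Let sum_X_powR_le : \sum_j X j `^ (p / 2) <=
  (\sum_j cell_prob j `^ p) `^ (1 - theta) * ((p - 1) * V) `^ theta.
Proof.
have q1 := p1; have q0 := p1_gt0.
have bBq : bounded_measurable (fun w => B w `^ (p - 1)).
  by apply: bmf_powR => //; exact: ltW.
pose W j := \int[P]_w (\1_(I j) (Y 0 w) * B w `^ (p - 1)).
have W0 j : 0 <= W j.
  by apply: Rintegral_ge0 => w _; rewrite mulr_ge0 ?powR_ge0.
have sumW : \sum_j W j <= (p - 1) * V.
  rewrite -bmf_Rintegral_sum//; last by move=> j _; exact: bmfM.
  have -> : (p - 1) * V = \int[P]_w ((p - 1) * \sum_(0 <= u < n.+1)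
      u.+1%:R `^ (p - 1 - 1) * cell_dev u w).
    have bt u : bounded_measurable
      (fun w : Omega => u.+1%:R `^ (p - 1 - 1) * cell_dev u w).
      by apply: bmfM => //; exact: bmf_cst.
    rewrite bmf_RintegralZ//; last exact: bmf_sum.
    rewrite bmf_Rintegral_sum//; congr (_ * _); apply: eq_bigr => u _.
    by rewrite bmf_RintegralZ// (_ : p - 1 - 1 = p - 2)//; ring.
  apply: bmf_le_Rintegral => //.
  - by apply: bmf_sum => j _; exact: bmfM.
  - apply: bmfM; first exact: bmf_cst.
    by apply: bmf_sum => u _; apply: bmfM => //; exact: bmf_cst.
  move=> w; rewrite -mulr_suml; apply: le_trans (_ : B w `^ (p - 1) <= _).
    by rewrite ler_piMl// powR_ge0.
  by apply: powR_sum_le => // u; exact: cell_dev01.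
have Xle j : X j `^ (p / 2) <= (cell_prob j `^ p) `^ (1 - theta) * W j `^ theta.
  have mA : measurable (Y 0 @^-1` I j) by exact: measurable_funPTI.
  have := hoelder_indic P1 mA q1 bB B0.
  rewrite -[X in X <= _]/(X j) -/(cell_prob j) -/(W j) => H.
  have := powR_le (_ : 0 <= p / 2) (X0 j) H; rewrite divr_ge0 ?(ltW (lt_trans _ p2))//.
  move=> /(_ isT); rewrite powRM ?powR_ge0// -!powRrM => /le_trans; apply.
  have -> : (1 - (p - 1)^-1) * (p / 2) = p * (1 - theta).
    by rewrite /theta; field; rewrite gt_eqF.
  have -> : (p - 1)^-1 * (p / 2) = theta.
    by rewrite /theta; field; rewrite gt_eqF.
  by [].
apply: le_trans (ler_sum _ (fun j _ => Xle j)) _.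
apply: le_trans (hoelder_sum theta01 _ _) _ => // [j|]; first exact: powR_ge0.
rewrite ler_wpM2l ?powR_ge0// powR_le//.
- by case/andP: theta01 => /ltW.
- exact: sumr_ge0.
Qed.

Definition family_const (C K : R) :=
  C * ((2 * M * D) `^ (p / 2) * (p - 1) `^ (p / (2 * (p - 1))) + 2 * M * D
       + K * (2 * (2 * M * (dev_bound + D)))).

(** In the sum of the moment inequalities over the cells, the variance term keeps
    the probabilities of the cells; all other terms are bounded by [V2]. *)
Theorem family_moment (C K : R) : 0 < C -> 0 < K -> (0 < n)%N ->
  moment_bound p (2 * M) C -> scales_bound p K ->
  ((\sum_j \int[P]_w (`|partial_sum (fun k => obs Y (g j) k%:Z) n w| `^ p))%:E <=
  (family_const C K)%:E *
    ((n%:R `^ (p / 2)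
        * (\sum_j cell_prob j `^ p) `^ ((p - 2) / (2 * (p - 1))))%:E
       * V1 kappa1 p n `^ (p / (2 * (p - 1)))
     + n%:R%:E * V2 kappa1 kappa2 p n))%E.
Proof.
move=> C0 K0 n0 HC HK; have hp0 : 0 <= p / 2 by have := p2; lra.
have MD0 : 0 < 2 * M * D by rewrite !mulr_gt0.
have n0R : 0 < n%:R :> R by rewrite ltr0n.
have [/andP[th0 th1] q0] := (theta01, p1_gt0).
have -> : (p - 2) / (2 * (p - 1)) = 1 - theta.
  by rewrite /theta; field; rewrite gt_eqF.
rewrite -/theta; set S := \sum_j \int[P]_w _.
pose Ts := \sum_j scale_error p n j.
pose c3 := K * (2 * (2 * M * (dev_bound + D))).
have c30 : 0 < c3.
  rewrite mulr_gt0// mulr_gt0// mulr_gt0 ?mulr_gt0//.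
  by rewrite addr_gt0// dev_bound_gt0.
pose c1 := (2 * M * D) `^ (p / 2) * (p - 1) `^ theta.
have c10 : 0 < c1 by rewrite mulr_gt0 ?powR_gt0.
have fcE : family_const C K = C * (c1 + 2 * M * D + c3) by [].
have fc0 : 0 < family_const C K by rewrite fcE mulr_gt0// !addr_gt0.
pose Pth := (\sum_j cell_prob j `^ p) `^ (1 - theta).
have Pth0 : 0 <= Pth by exact: powR_ge0.
have TsV2 : (Ts%:E <= c3%:E * V2 kappa1 kappa2 p n)%E by exact: sum_scale_error_le.
have S_le : S <= C * (c1 * (n%:R `^ (p / 2) * Pth * V `^ theta)
    + 2 * M * D * (n%:R * V) + n%:R * Ts).
  apply: (@le_trans _ _ (\sum_j C * ((n%:R * (2 * M * D * X j)) `^ (p / 2)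
      + n%:R * (2 * M * D * X j) + n%:R * scale_error p n j))).
    apply: ler_sum => j _.
    have wd := obs_weakly_dependent statY (mg j) (gM' j) hkappa1 hkappa2 n.
    apply: le_trans (HC _ _ _ _ _ _ _ _ P1 wd) _.
    have lv0 := long_variance_ge0 wd; have lvX := variance_le j.
    rewrite ler_pM2l// lerD2r lerD//; last by rewrite ler_pM2l.
    apply: powR_le => //; first by rewrite mulr_ge0.
    by rewrite ler_pM2l.
  rewrite -mulr_sumr ler_pM2l// !big_split/= -!mulr_sumr !lerD//; last first.
    by rewrite mulrCA ler_pM2l// ler_pM2l.
  have -> : c1 * (n%:R `^ (p / 2) * Pth * V `^ theta) = n%:R `^ (p / 2)
      * (2 * M * D) `^ (p / 2) * (Pth * ((p - 1) * V) `^ theta).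
    rewrite (@powRM _ (p - 1) V theta) ?(ltW q0)// /c1.
    by ring.
  apply: le_trans (_ : n%:R `^ (p / 2) * (2 * M * D) `^ (p / 2) *
    \sum_j X j `^ (p / 2) <= _).
    rewrite mulr_sumr ler_sum// => j _.
    by rewrite !powRM ?mulr_ge0 ?(ltW M0) ?(ltW D0)// !mulrA.
  by rewrite ler_wpM2l ?mulr_ge0 ?powR_ge0// sum_X_powR_le.
have V1_0 : (0 <= V1 kappa1 p n)%E by apply: le_trans V_le_V1; rewrite lee_fin.
have V2_0 := le_trans V1_0 V1_le_V2.
move: V_le_V1 V1_le_V2 TsV2 V1_0 V2_0.
case: (V2 kappa1 kappa2 p n) => [v2||//]; last first.
  move=> _ _ _ _ _; rewrite gt0_muley ?lte_fin// addey ?gt0_muley ?leey//.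
  rewrite -ltNye (lt_le_trans ltNy0)// mule_ge0 ?poweR_ge0// lee_fin.
  by rewrite mulr_ge0 ?powR_ge0.
case: (V1 kappa1 p n) => [v1||//]; last by rewrite leye_eq.
rewrite -EFinM !lee_fin => Vv1 v1v2 Tsv2 v10 v20.
rewrite -/Pth -[leRHS]/(family_const C K *
  (n%:R `^ (p / 2) * Pth * v1 `^ theta + n%:R * v2)).
apply: le_trans S_le _; rewrite fcE -[leRHS]mulrA ler_pM2l//.
have Vth : V `^ theta <= v1 `^ theta by rewrite powR_le// ltW.
pose a := n%:R `^ (p / 2) * Pth; have a0 : 0 <= a by rewrite mulr_ge0 ?powR_ge0.
have h1 : a * V `^ theta <= a * v1 `^ theta by rewrite ler_wpM2l.
have h2 : n%:R * V <= n%:R * v2 by rewrite ler_pM2l// (le_trans Vv1).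
have h3 : n%:R * Ts <= c3 * (n%:R * v2) by rewrite mulrCA ler_pM2l.
have h4 : 0 <= a * v1 `^ theta by rewrite mulr_ge0 ?powR_ge0.
have h5 : 0 <= n%:R * v2 by rewrite mulr_ge0.
rewrite -/a; move: (a * V `^ theta) (a * v1 `^ theta) (n%:R * V) (n%:R * v2)
  (n%:R * Ts) (2 * M * D) MD0 h1 h2 h3 h4 h5 => x1 x2 x3 x4 x5 x6 *; nra.
Qed.

End FamilyMoment.

End Family.

(** * The regular partition and the density *)

Section Cells.
Variable R : realType.

Definition cell (m : nat) (j : 'I_m) : set R :=
  `]j%:R / m%:R, j.+1%:R / m%:R]%classic.

Lemma cellE m (j : 'I_m) y : (y \in cell j) = (m%:R * y - j%:R \in `]0, 1]).
Proof.
have m0 : 0 < m%:R :> R by rewrite ltr0n (leq_ltn_trans _ (ltn_ord j)).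
have E : (m%:R * y - j%:R \in `]0, 1]) = (y \in `]j%:R / m%:R, j.+1%:R / m%:R]).
  rewrite !in_itv/= subr_gt0 lerBlDr ltr_pdivrMr// ler_pdivlMr//.
  by rewrite [_ + j%:R]addrC natr1 ![y * _]mulrC.
by rewrite E; apply/idP/idP => [/set_mem|H]; [|apply: mem_set].
Qed.

Lemma measurable_cell m (j : 'I_m) : measurable (cell j).
Proof. exact: measurable_itv. Qed.

Lemma cell_inj m (i j : 'I_m) y : y \in cell i -> y \in cell j -> i = j.
Proof.
rewrite !cellE !in_itv/= !subr_gt0 !lerBlDr => /andP[iy yi] /andP[jy yj].
have := lt_le_trans iy yj; have := lt_le_trans jy yi.
rewrite ![1 + _]addrC !natr1 !ltr_nat !ltnS => ji ij.
by apply/val_inj/eqP; rewrite eqn_leq ij ji.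
Qed.

Lemma sum_cell_cases m y : (forall j : 'I_m, \1_(cell j) y = 0 :> R) \/
  exists j : 'I_m, forall i, \1_(cell i) y = (i == j)%:R :> R.
Proof.
case: (pickP (fun j : 'I_m => y \in cell j)) => [j jy|ny]; last first.
  by left=> j; rewrite indicE ny.
right; exists j => i; rewrite indicE; congr ((nat_of_bool _)%:R).
by apply/idP/eqP => [iy|->//]; exact: cell_inj iy jy.
Qed.

Lemma sum_cell_le1 m y : \sum_(j < m) (\1_(cell j) y : R) <= 1.
Proof.
case: (sum_cell_cases m y) => [j0|[j jE]]; first by rewrite big1.
by rewrite (bigD1 j)//= jE eqxx big1 ?addr0// => i /negPf ij; rewrite jE ij.
Qed.

Lemma sum_cell_powR m (b : 'I_m -> R) y p : p != 0 ->
  (\sum_j b j * \1_(cell j) y) `^ p = \sum_j b j `^ p * \1_(cell j) y.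
Proof.
move=> p0; case: (sum_cell_cases m y) => [j0|[j jE]].
  rewrite !big1 ?powR0// => j _; by rewrite j0 mulr0.
rewrite (bigD1 j)//= [RHS](bigD1 j)//= jE eqxx !mulr1 !big1 ?addr0//;
  by move=> i /negPf ij; rewrite jE ij mulr0.
Qed.

Lemma cell_sub01 m (j : 'I_m) : cell j `<=` `[0, 1]%classic.
Proof.
have m0 : 0 < m%:R :> R by rewrite ltr0n (leq_ltn_trans _ (ltn_ord j)).
move=> y; rewrite /cell /= !in_itv/= => /andP[jy yj].
rewrite (le_trans _ (ltW jy)) ?divr_ge0//= (le_trans yj)//.
by rewrite ler_pdivrMr// mul1r ler_nat.
Qed.

Lemma lebesgue_cell m (j : 'I_m) :
  lebesgue_measure (cell j) = (m%:R^-1 : R)%:E.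
Proof.
have m0 : 0 < m%:R :> R by rewrite ltr0n (leq_ltn_trans _ (ltn_ord j)).
rewrite /cell lebesgue_measure_itv/= lte_fin ltr_pM2r ?invr_gt0// ltr_nat ltnSn.
by rewrite -EFinB -mulrBl -natr1 addrAC subrr add0r mul1r.
Qed.

End Cells.
Arguments cell : clear implicits.
Arguments cell {R} m j.

Section Density.
Context d (Omega : measurableType d) (R : realType) (P : probability Omega R).
Variables (Y : int -> {RV P >-> R}) (f : R -> R) (p : R) (m : nat).
Hypothesis hf : marginal_density Y f.
Hypothesis p2 : 2 < p.
Hypothesis hfp : (f \* \1_(`[0%R, 1%R]))%R \in Lfun (@lebesgue_measure R) p%:E.
Hypothesis m0 : (0 < m)%N.

Local Notation mu := (@lebesgue_measure R).
Local Notation N :=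
  (Lnorm mu p%:E (EFin \o (f \* \1_(`[0%R, 1%R]))%R)).

Let p0 : 0 < p. Proof. by have := p2; lra. Qed.

Lemma Lnorm_density_fin : N \is a fin_num.
Proof.
rewrite ge0_fin_numE ?Lnorm_ge0//.
by have := sub_Lfun_finLfun hfp; rewrite inE.
Qed.

Let mf : measurable_fun setT f. Proof. by case: hf. Qed.
Let f0 x : 0 <= f x. Proof. by case: hf => _ + _; apply. Qed.

(** Hölder's inequality on each cell, then additivity of the integral of
    [f `^ p]. *)
Lemma sum_cell_prob_le :
  \sum_(j < m) cell_prob Y (cell m) j `^ p <= m%:R `^ (1 - p) * fine N `^ p.
Proof.
have mR : 0 < m%:R :> R by rewrite ltr0n.
have p1 : 1 < p by have := p2; lra.
have m1 (A : set R) : measurable A -> measurable_fun setT (\1_A : R -> R).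
  by move=> mA; exact: measurable_indic.
pose F (j : 'I_m) x := f x * \1_(cell m j) x.
have mF j : measurable_fun setT (F j).
  by apply: measurable_funM => //; apply: m1; exact: measurable_cell.
have F0 j x : 0 <= F j x by rewrite mulr_ge0.
have Fp0 j x : (0 <= (F j x `^ p)%:E)%E by rewrite lee_fin powR_ge0.
have mFp j : measurable_fun setT (fun x => (F j x `^ p)%:E).
  apply/measurable_EFinP; exact: measurableT_comp (measurable_powR p) (mF j).
pose J j := (\int[mu]_x (F j x `^ p)%:E)%E.
have J0 j : (0 <= J j)%E by exact: integral_ge0.
have NE : (N `^ p = \int[mu]_x (((f \* \1_(`[0%R, 1%R])) x) `^ p)%:E)%E.
  rewrite poweR_Lnorm ?gt_eqF//; apply: eq_integral => x _ /=.
  by rewrite ger0_norm// mulr_ge0.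
have sumJ : (\sum_(j < m) J j <= (fine N `^ p)%:E)%E.
  rewrite -poweR_EFin fineK ?Lnorm_density_fin// NE -ge0_integral_sum//.
  apply: ge0_le_integral_lower => x; first by apply: sume_ge0.
  rewrite sumEFin lee_fin.
  have -> : \sum_(j < m) F j x `^ p = (\sum_(j < m) f x * \1_(cell m j) x) `^ p.
    rewrite sum_cell_powR ?gt_eqF//; apply: eq_bigr => j _.
    rewrite /F powRM// indicE; case: (_ \in _); rewrite ?powR1 ?powR0 ?gt_eqF//.
  apply: powR_le; [exact: ltW|by apply: sumr_ge0 => j _; rewrite mulr_ge0|].
  rewrite -mulr_sumr ler_wpM2l//; case: (sum_cell_cases m x) => [j0|[j jE]].
    by rewrite big1.
  rewrite (le_trans (sum_cell_le1 m x))//.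
  have : x \in cell m j by move: (jE j); rewrite eqxx indicE; case: (_ \in _) => // /eqP;
    rewrite eq_sym oner_eq0.
  by rewrite inE => /cell_sub01 x01; rewrite indicE mem_set.
have Jfin j : J j \is a fin_num.
  rewrite ge0_fin_numE// (le_lt_trans _ (ltry (fine N `^ p)))//.
  by apply: le_trans sumJ; rewrite (bigD1 j)//= leeDl// sume_ge0.
have prob_le j : cell_prob Y (cell m) j `^ p <= m%:R `^ (1 - p) * fine (J j).
  have mc : measurable (cell m j : set R) by exact: measurable_cell.
  have b1 : bounded_measurable (fun w => \1_(cell m j) (Y 0 w) : R).
    by apply: (bmf_comp _ (bmf_indic R mc)); exact: measurable_funPT.
  have P1 : P setT = 1%E by exact: probability_setT.
  have q'0 : 0 < 1 - p^-1 by rewrite subr_gt0 invf_lt1.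
  have conj : p^-1 + (1 - p^-1)^-1^-1 = 1 by rewrite invrK subrKC.
  have q0 : 0 < (1 - p^-1)^-1 by rewrite invr_gt0.
  have := hoelder mu (mF j) (m1 _ mc) p0 q0 conj.
  rewrite Lnorm1 unlock/= invrK.
  have -> : (\int[mu]_x `|(F j x * \1_(cell m j) x)%:E|)%E =
      (cell_prob Y (cell m) j)%:E.
    rewrite /cell_prob -(bmf_RintegralE P1 b1).
    have -> : (\int[P]_x (\1_(cell m j) (Y 0 x))%:E)%E =
        distribution P (Y 0) (cell m j).
      have mA : measurable (Y 0 @^-1` cell m j) by exact: measurable_funPTI.
      rewrite -[RHS]/(P (Y 0 @^-1` cell m j)) -[Y 0 @^-1` _]setIT.
      by rewrite -integral_indic.
    case: hf => _ _ ->//; rewrite [RHS]integral_mkcond.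
    apply: eq_integral => x _ /=; rewrite patchE /F indicE.
    by case: (x \in _); rewrite ?mulr0 ?mul0r ?normr0// !mulr1 ger0_norm.
  have -> : (\int[mu]_x (`|F j x| `^ p)%:E)%E = J j.
    by apply: eq_integral => x _; rewrite ger0_norm.
  have -> : (\int[mu]_x (`|\1_(cell m j) x : R| `^ (1 - p^-1)^-1)%:E)%E =
      (m%:R^-1)%:E.
    rewrite -(lebesgue_cell R j) -[cell m j]setIT -integral_indic//.
    apply: eq_integral => x _; congr (_%:E); rewrite setIT indicE.
    by case: (_ \in _); rewrite ?normr1 ?normr0 ?powR1 ?powR0// gt_eqF// invr_gt0.
  rewrite -[J j]fineK// !poweR_EFin -EFinM lee_fin => H.
  have Pj0 : 0 <= cell_prob Y (cell m) j by apply: Rintegral_ge0.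
  have := powR_le (ltW p0) Pj0 H.
  rewrite powRM ?powR_ge0// -!powRrM mulVf ?gt_eqF// powRr1 ?fine_ge0//.
  rewrite (_ : (1 - p^-1) * p = p - 1); last by field; rewrite gt_eqF.
  move=> /le_trans; apply; rewrite mulrC ler_wpM2r ?fine_ge0//.
  by rewrite -powR_inv1// -powRrM mulN1r opprB.
rewrite (le_trans (ler_sum _ (fun j _ => prob_le j)))// -mulr_sumr.
rewrite ler_wpM2l ?powR_ge0// -lee_fin -sumEFin.
by under eq_bigr do rewrite fineK//.
Qed.

End Density.

(** * The estimator *)

Section Estimator.
Context d (Omega : measurableType d) (R : realType) (P : probability Omega R).
Variable Y : int -> {RV P >-> R}.
Hypothesis statY : strictly_stationary Y.
Variables (r : nat) (Q : 'I_r.+1 -> {poly R}) (M p : R) (m n : nat).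
Hypothesis p2 : 2 < p.
Hypothesis M0 : 0 < M.
Hypothesis QM : forall i x, 0 <= x <= 1 -> `|(Q i).[x]| <= M.
Hypothesis n0 : (0 < n)%N.

Local Notation mu := (@lebesgue_measure R).

Definition local_poly (i : 'I_r.+1) (j : 'I_m) (y : R) :=
  Rfun (Q i) (m%:R * y - j%:R).

Let P1 : P setT = 1%E. Proof. exact: probability_setT. Qed.
Let p0 : 0 < p. Proof. by have := p2; lra. Qed.

Lemma local_polyE i j y : local_poly i j y =
  (Q i).[m%:R * y - j%:R] * \1_(cell m j) y.
Proof.
rewrite /local_poly /Rfun indicE cellE.
by case: (_ \in `]0, 1]); rewrite ?mulr1 ?mulr0.
Qed.

Lemma local_poly_le i j y : `|local_poly i j y| <= M * \1_(cell m j) y.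
Proof.
rewrite local_polyE indicE normrM cellE in_itv/=.
case: (boolP (_ < _ <= _)) => [/andP[h0 h1]|_]; last by rewrite normr0 !mulr0.
by rewrite normr1 !mulr1 QM// (ltW h0).
Qed.

Lemma measurable_local_poly i j : measurable_fun setT (local_poly i j).
Proof.
rewrite (_ : local_poly i j = fun y => (Q i).[m%:R * y - j%:R] * \1_(cell m j) y).
  apply: measurable_funM; last by apply: measurable_indic; exact: measurable_cell.
  have mQ : measurable_fun setT (horner (Q i)).
    by apply: continuous_measurable_fun; exact: continuous_horner.
  have ma : measurable_fun setT (fun y : R => m%:R * y - j%:R).
    by apply: measurable_funB; [exact: mulrl_measurable|exact: measurable_cst].
  exact: measurableT_comp mQ ma.
by apply/funext => y; rewrite local_polyE.
Qed.

Let local_poly_leM i j y : `|local_poly i j y| <= M.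
Proof.
by rewrite (le_trans (local_poly_le i j y))// ler_piMr ?(ltW M0).
Qed.

Let S i j w := partial_sum (fun k => obs Y (local_poly i j) k%:Z) n w.

Let bgY i j k : bounded_measurable (fun w => local_poly i j (Y k w)).
Proof. exact: bmf_gY (measurable_local_poly i j) (local_poly_leM i j) k. Qed.

Let bcoef (i : 'I_r.+1) (j : 'I_m) : bounded_measurable (fun w => Defs.coefX Y Q n i j w).
Proof.
apply: bmfM; first exact: bmf_cst.
apply: bmf_sum => k _; apply: bmfM; first exact: bmf_cst.
exact: bgY.
Qed.

Let coefE (i : 'I_r.+1) (j : 'I_m) w : Defs.coefX Y Q n i j w =
  \int[P]_w' Defs.coefX Y Q n i j w' + Num.sqrt m%:R / n%:R * S i j w.
Proof.
have nR : n%:R != 0 :> R by rewrite pnatr_eq0 -lt0n.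
have intE : \int[P]_w' Defs.coefX Y Q n i j w' =
    Num.sqrt m%:R * mean Y (local_poly i j).
  rewrite /Defs.coefX bmf_RintegralZ//; last first.
    by apply: bmf_sum => k _; apply: bmfM; [exact: bmf_cst|exact: bgY].
  rewrite bmf_Rintegral_sum//; last first.
    by move=> k _; apply: bmfM; [exact: bmf_cst|exact: bgY].
  rewrite (eq_bigr (fun=> Num.sqrt m%:R * mean Y (local_poly i j))); last first.
    move=> k _; rewrite bmf_RintegralZ//; last exact: bgY.
    congr (_ * _).
    by apply: (Rintegral_gY statY);
      [exact: measurable_local_poly|exact: local_poly_leM].
  by rewrite sumr_const_nat subSS subn0 -[(_ * _) *+ n]mulr_natl mulKf.
rewrite intE /S /partial_sum /Defs.coefX.
have -> : \sum_(1 <= k < n.+1) phi Q i j (Y k%:Z w) =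
    \sum_(1 <= k < n.+1) (Num.sqrt m%:R * obs Y (local_poly i j) k%:Z w
      + Num.sqrt m%:R * mean Y (local_poly i j)).
  apply: eq_bigr => k _; rewrite -mulrDr /obs subrK.
  by [].
rewrite big_split/= sumr_const_nat subSS subn0 -mulr_sumr -[(_ * _) *+ n]mulr_natl.
by field.
Qed.

Lemma estimator_dev w x :
  (`| (estimator Y Q m n w x)%:E - 'E_P[fun v => estimator Y Q m n v x] | `^ p =
  (`| m%:R / n%:R * \sum_i \sum_j S i j w * local_poly i j x| `^ p)%:E)%E.
Proof.
have best : bounded_measurable (fun v => estimator Y Q m n v x).
  by apply: bmf_sum => i _; apply: bmf_sum => j _; apply: bmfM => //; exact: bmf_cst.
rewrite unlock (bmf_RintegralE P1 best) -EFinB -poweR_EFin.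
congr ((`| _%:E | `^ p)%E).
have intE : \int[P]_w' estimator Y Q m n w' x =
    \sum_i \sum_(j < m) (\int[P]_w' Defs.coefX Y Q n i j w') * phi Q i j x.
  rewrite /estimator bmf_Rintegral_sum//; last first.
    by move=> i _; apply: bmf_sum => j _; apply: bmfM => //; exact: bmf_cst.
  apply: eq_bigr => i _; rewrite bmf_Rintegral_sum//; last first.
    by move=> j _; apply: bmfM => //; exact: bmf_cst.
  apply: eq_bigr => j _.
  under eq_Rintegral do rewrite mulrC.
  by rewrite bmf_RintegralZ// mulrC.
rewrite intE /estimator -sumrB mulr_sumr; apply: eq_bigr => i _.
rewrite -sumrB mulr_sumr; apply: eq_bigr => j _.
rewrite coefE mulrDl addrAC subrr add0r /phi -/(local_poly i j x).
have sm : Num.sqrt m%:R * Num.sqrt m%:R = m%:R :> R by rewrite -expr2 sqr_sqrtr.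
by rewrite -[in RHS]sm; ring.
Qed.

Let term j w := \sum_i `|S i j w| `^ p.

Let dev_le w x :
  `| m%:R / n%:R * \sum_i \sum_j S i j w * local_poly i j x| `^ p <=
  \sum_j (m%:R / n%:R) `^ p * (r.+1%:R * M) `^ p * term j w * \1_(cell m j) x.
Proof.
have mn0 : 0 <= m%:R / n%:R :> R by rewrite divr_ge0.
pose a i := M * \sum_j `|S i j w| * \1_(cell m j) x.
have a0 i : 0 <= a i.
  by rewrite mulr_ge0 ?(ltW M0)// sumr_ge0// => j _; rewrite mulr_ge0.
have H : `|\sum_i \sum_j S i j w * local_poly i j x| <= \sum_i a i.
  rewrite (le_trans (ler_norm_sum _ _ _))// ler_sum// => i _.
  rewrite (le_trans (ler_norm_sum _ _ _))// /a mulr_sumr ler_sum// => j _.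
  by rewrite normrM [leRHS]mulrCA ler_wpM2l// local_poly_le.
rewrite normrM ger0_norm// [leLHS]powRM//.
have p1 : 1 <= p by have := p2; lra.
apply: le_trans (_ : (m%:R / n%:R) `^ p * (r.+1%:R `^ p * \sum_i a i `^ p) <= _).
  rewrite ler_wpM2l ?powR_ge0// (le_trans _ (sum_powR_le p1 a0))//.
  by rewrite powR_le// ltW.
rewrite le_eqVlt; apply/orP; left; apply/eqP.
under [RHS]eq_bigr do rewrite -!mulrA.
rewrite -mulr_sumr; congr (_ * _); rewrite powRM ?(ltW M0)//.
under [RHS]eq_bigr do rewrite -mulrA.
rewrite -mulr_sumr; congr (_ * _).
under [RHS]eq_bigr do rewrite /term mulr_suml mulr_sumr.
rewrite exchange_big/=; apply: eq_bigr => i _.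
rewrite /a powRM ?(ltW M0)//; last by rewrite sumr_ge0// => j _; rewrite mulr_ge0.
by rewrite sum_cell_powR ?gt_eqF// mulr_sumr.
Qed.

Let integral_cells (c : 'I_m -> R) : (forall j, 0 <= c j) ->
  (\int[mu]_x (\sum_j c j * \1_(cell m j) x)%:E = (\sum_j c j / m%:R)%:E)%E.
Proof.
move=> c0; under eq_integral do rewrite -sumEFin.
rewrite ge0_integral_sum//.
- rewrite -sumEFin; apply: eq_bigr => j _.
  under eq_integral do rewrite EFinM.
  rewrite ge0_integralZl_EFin//.
  + rewrite integral_indic//; last exact: measurable_cell.
    by rewrite setIT EFinM -(lebesgue_cell R j).
  + apply/measurable_EFinP; apply: measurable_indic; exact: measurable_cell.
- move=> j; apply/measurable_EFinP; apply: measurable_funM; first exact: measurable_cst.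
  by apply: measurable_indic; exact: measurable_cell.
- by move=> j x _; rewrite lee_fin mulr_ge0.
Qed.

Definition loss_const := (m%:R / n%:R) `^ p * (r.+1%:R * M) `^ p / m%:R.

(** At each point only one cell contributes to the estimator, which separates the
    partial sums of the cells; the factor [m^-1] is the length of a cell. *)
Lemma estimator_loss_le :
  (\int[P]_w \int[mu]_(x in `[0%R, 1%R])
    (`| (estimator Y Q m n w x)%:E - 'E_P[fun v => estimator Y Q m n v x] | `^ p)
  <= loss_const%:E *
     \sum_i (\sum_j \int[P]_w
       (`|partial_sum (fun k => obs Y (local_poly i j) k%:Z) n w| `^ p)%R)%R%:E)%E.
Proof.
have K0 : 0 <= (m%:R / n%:R) `^ p * (r.+1%:R * M) `^ p by rewrite mulr_ge0 ?powR_ge0.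
have bS i j : bounded_measurable (fun w => `|S i j w| `^ p).
  apply: bmf_powR => //; first exact: ltW.
  apply: bmf_norm; apply: bmf_sum => k _.
  exact: bmf_obs (measurable_local_poly i j) (local_poly_leM i j) k%:Z.
have bterm j : bounded_measurable (term j) by exact: bmf_sum.
have term0 j w : 0 <= term j w by apply: sumr_ge0 => i _; exact: powR_ge0.
pose h w := \sum_j loss_const * term j w.
have bh : bounded_measurable h.
  by apply: bmf_sum => j _; apply: bmfM => //; exact: bmf_cst.
apply: (@le_trans _ _ (\int[P]_w (h w)%:E)%E).
  apply: ge0_le_integral_lower => w; first by apply: integral_ge0 => x _; exact: poweR_ge0.
  have -> : h w = \sum_j (m%:R / n%:R) `^ p * (r.+1%:R * M) `^ p * term j w / m%:R.
    by apply: eq_bigr => j _; rewrite /loss_const mulrAC.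
  rewrite -integral_cells; last by move=> j; rewrite mulr_ge0.
  rewrite integral_mkcond; apply: ge0_le_integral_lower => x; rewrite patchE.
    by case: ifP => // _; exact: poweR_ge0.
  case: ifP => _; first by rewrite estimator_dev lee_fin.
  suff : 0 <= \sum_j (m%:R / n%:R) `^ p * (r.+1%:R * M) `^ p * term j w
      * \1_(cell m j) x by rewrite -lee_fin.
  by apply: sumr_ge0 => j _; rewrite mulr_ge0// mulr_ge0.
rewrite (bmf_RintegralE P1 bh) sumEFin -EFinM lee_fin.
rewrite /h bmf_Rintegral_sum//; last by move=> j _; apply: bmfM => //; exact: bmf_cst.
rewrite exchange_big/= mulr_sumr ler_sum// => j _.
by rewrite bmf_RintegralZ// /term bmf_Rintegral_sum.
Qed.

End Estimator.

(** * Positivity of the constants *)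

Section Constants.
Variable R : realType.
Implicit Types q : {poly R}.

(** A polynomial vanishing on a half-open unit interval vanishes at the points
    [1 / k], which are too many. *)
Lemma horner_neq0 q : q != 0 -> exists2 x, 0 < x <= 1 & q.[x] != 0.
Proof.
move=> q0; apply: contrapT => H.
pose s : seq R := [seq i.+1%:R^-1 | i <- iota 0 (size q)].
suff : (size s < size q)%N by rewrite size_map size_iota ltnn.
apply: max_poly_roots => //.
  apply/allP => _ /mapP[i _ ->]; apply/rootP/eqP/negP => /negP qi.
  apply: H; exists i.+1%:R^-1 => //.
  by rewrite invr_gt0 ltr0n/= invf_le1 ?ltr0n// ler1n.
rewrite map_inj_uniq ?iota_uniq// => i j /invr_inj /eqP.
by rewrite eqr_nat eqSS => /eqP.
Qed.

Lemma tvnorm_ge (nu : {charge set R -> \bar R}) A : measurable A ->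
  (`|nu A| <= tvnorm nu)%E.
Proof.
move=> mA; rewrite /tvnorm; set nuPN := (X in charge_variation X).
apply: le_trans (abse_charge_variation nuPN mA) _.
by rewrite /charge_variation leeD// le_measure ?inE.
Qed.

Let supnorm_gt0 q x : Rfun q x != 0 -> exists2 c, 0 < c & (c%:E <= supnorm (Rfun q))%E.
Proof.
move=> qx; exists `|Rfun q x|; first by rewrite normr_gt0.
by apply: ereal_sup_ubound; exists x.
Qed.

Let tvnorm_gt0 q (nu : {charge set R -> \bar R}) x : is_stieltjes_charge (Rfun q) nu ->
  0 < x -> Rfun q x != 0 -> exists2 c, 0 < c & (c%:E <= tvnorm nu)%E.
Proof.
move=> hnu x0 qx; exists `|Rfun q x|; first by rewrite normr_gt0.
apply: (le_trans _ (tvnorm_ge nu (measurable_itv `[0, x[))).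
have R0 : Rfun q 0 = 0 by rewrite /Rfun in_itv/= ltxx.
by rewrite hnu// R0 subr0.
Qed.

Let sum_gt0 r (F : 'I_r.+1 -> \bar R) : (forall i, (0 <= F i)%E) ->
  (exists2 c, 0 < c & (c%:E <= F ord0)%E) -> exists2 c, 0 < c & (c%:E <= \sum_i F i)%E.
Proof.
move=> F0 [c c0 cF]; exists c => //.
by rewrite big_ord_recl (le_trans cF)// leeDl// sume_ge0.
Qed.

Let poweR_gt0_lower (x : \bar R) a : 0 <= a ->
  (exists2 c, 0 < c & (c%:E <= x)%E) -> exists2 c, 0 < c & (c%:E <= x `^ a)%E.
Proof.
move=> a0 [c c0 cx]; exists (c `^ a); first exact: powR_gt0.
have c0' : (0 <= c%:E)%E by rewrite lee_fin ltW.
rewrite -poweR_EFin; apply: gt0_ler_poweR => //.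
  by rewrite in_itv/= c0' leey.
by rewrite in_itv/= leey andbT (le_trans c0').
Qed.

Let mul_gt0_lower (x y : \bar R) :
  (exists2 c, 0 < c & (c%:E <= x)%E) -> (exists2 c, 0 < c & (c%:E <= y)%E) ->
  exists2 c, 0 < c & (c%:E <= x * y)%E.
Proof.
move=> [a a0 ax] [b b0 by_]; exists (a * b); first exact: mulr_gt0.
by rewrite EFinM lee_pmul// lee_fin ltW.
Qed.

(** [Q ord0] has norm 1, hence it is nonzero at some point [x] of ]0, 1].  The
    absolute value of [Rfun (Q ord0) x] is a lower bound of the supremum norm, and
    of the total variation, since [Rfun (Q ord0)] vanishes at 0. *)
Lemma constants_gt0 r (Q : 'I_r.+1 -> {poly R}) (dR : 'I_r.+1 -> {charge set R -> \bar R}) p :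
  orthonormal_poly_basis Q -> (forall i, is_stieltjes_charge (Rfun (Q i)) (dR i)) ->
  2 < p -> exists2 c, 0 < c & (c%:E <= C1 Q dR p)%E /\ (c%:E <= C2 Q dR p)%E.
Proof.
move=> [_ hQ _] hdR p2.
have Q0 : Q ord0 != 0.
  apply/eqP => Q0; have := hQ ord0 ord0; rewrite eqxx Q0.
  under eq_integral do rewrite horner0 mulr0.
  rewrite integral0 => /eqP; rewrite eqe eq_sym oner_eq0.
  by [].
have [x /andP[x0 x1] Qx] := horner_neq0 Q0.
have Rx : Rfun (Q ord0) x != 0.
  by rewrite /Rfun in_itv/= x0 x1.
have sup0 := supnorm_gt0 Rx; have tv0 := tvnorm_gt0 (hdR ord0) x0 Rx.
have term0 i a b : (0 <= supnorm (Rfun (Q i)) `^ a * tvnorm (dR i) `^ b)%E.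
  by rewrite mule_ge0 ?poweR_ge0.
have [c1 c10 h1] : exists2 c, 0 < c & (c%:E <= C1 Q dR p)%E.
  apply: sum_gt0 => //; apply: mul_gt0_lower; apply: poweR_gt0_lower => //; lra.
have [c2 c20 h2] : exists2 c, 0 < c & (c%:E <= C2 Q dR p)%E.
  apply: sum_gt0 => //; apply: mul_gt0_lower; apply: poweR_gt0_lower => //; lra.
exists (Num.min c1 c2); first by rewrite lt_min c10.
by split; [apply: le_trans h1|apply: le_trans h2]; rewrite lee_fin ge_min lexx ?orbT.
Qed.

End Constants.
(** * The moment bound for the estimator *)

Lemma step_approximable_le (R : realType) (D D' : R) (g : R -> R) : D <= D' ->
  step_approximable D g -> step_approximable D' g.
Proof.
move=> DD' gD e e0; have [s [sD sg]] := gD e e0.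
by exists s; split => //; exact: le_trans DD'.
Qed.

Lemma uniform_constants (R : realType) (r : nat) (Q : 'I_r.+1 -> {poly R}) :
  exists M D D' : R, [/\ 0 < M, 0 < D, 0 < D' & 2 * M <= D] /\
  [/\ forall i x, 0 <= x <= 1 -> `|(Q i).[x]| <= M,
    forall i m j, (0 < m)%N -> step_approximable D (fun y => Rfun (Q i) (m%:R * y - j%:R))
  & forall i m j, (0 < m)%N ->
    step_approximable D' (fun y => Rfun (Q i) (m%:R * y - j%:R) ^+ 2)].
Proof.
have le_sum (F : 'I_r.+1 -> R) i : (forall k, 0 < F k) -> F i <= \sum_k F k.
  by move=> F0; rewrite (bigD1 i)//= lerDl sumr_ge0// => k _; rewrite ltW.
have sum_gt0 (F : 'I_r.+1 -> R) : (forall k, 0 < F k) -> 0 < \sum_k F k.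
  by move=> F0; rewrite (lt_le_trans (F0 ord0))// le_sum.
have /choice[M HM] : forall i, exists M, 0 < M /\
    forall x, 0 <= x <= 1 -> `|(Q i).[x]| <= M.
  by move=> i; have [M M0 H] := horner_bounded (Q i); exists M.
have /choice[D HD] : forall i, exists D, 0 < D /\ forall m j : nat, (0 < m)%N ->
    step_approximable D (fun y => Rfun (Q i) (m%:R * y - j%:R)).
  by move=> i; have [D D0 H] := Rfun_step_approximable (Q i); exists D.
have /choice[D' HD'] : forall i, exists D, 0 < D /\ forall m j : nat, (0 < m)%N ->
    step_approximable D (fun y => Rfun (Q i * Q i) (m%:R * y - j%:R)).
  by move=> i; have [D' D'0 H] := Rfun_step_approximable (Q i * Q i); exists D'.
have M0 : 0 < \sum_i M i by apply: sum_gt0 => i; case: (HM i).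
have D0 : 0 < \sum_i D i by apply: sum_gt0 => i; case: (HD i).
have D'0 : 0 < \sum_i D' i by apply: sum_gt0 => i; case: (HD' i).
exists (\sum_i M i), (\sum_i D i + 2 * \sum_i M i), (\sum_i D' i); split; split => //.
- by rewrite addr_gt0// mulr_gt0.
- by rewrite lerDr ltW.
- move=> i x x01; have [_ H] := HM i; rewrite (le_trans (H x x01))//.
  by apply: le_sum => k; case: (HM k).
- move=> i m j m0; have [_ H] := HD i; apply: step_approximable_le (H m j m0).
  rewrite (@le_trans _ _ (\sum_i D i))//; last by rewrite lerDl mulr_ge0// ltW.
  by apply: le_sum => k; case: (HD k).
- move=> i m j m0; have [_ H] := HD' i.
  rewrite (_ : (fun y => _) = fun y => Rfun (Q i * Q i) (m%:R * y - j%:R)).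
    apply: step_approximable_le (H m j m0).
    by apply: le_sum => k; case: (HD' k).
  by apply/funext => y; rewrite /Rfun hornerM; case: ifP => _; rewrite expr2// mulr0.
Qed.

(** The powers of [m] and [n]: a cell has length [m^-1] and the variance of the
    partial sums is of order [n]. *)
Lemma variance_scaling (R : realType) (p m n : R) : 2 < p -> 0 < m -> 0 < n ->
  (m / n) `^ p / m * (n `^ (p / 2) * m `^ ((1 - p) * ((p - 2) / (2 * (p - 1))))) =
  (m / n) `^ (p / 2).
Proof.
move=> p2 m0 n0; have mn0 : 0 < m / n by exact: divr_gt0.
have -> : (1 - p) * ((p - 2) / (2 * (p - 1))) = 1 - p / 2.
  by field; rewrite gt_eqF//; lra.
have pE : p = p / 2 + p / 2 by field.
have -> : (m / n) `^ p = (m / n) `^ (p / 2) * (m / n) `^ (p / 2).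
  by rewrite [in LHS]pE powRD// (gt_eqF mn0) implybT.
have mE : (m / n) `^ (p / 2) * n `^ (p / 2) = m `^ (p / 2).
  by rewrite -powRM ?(ltW mn0) ?(ltW n0)// divfK ?gt_eqF.
have mE1 : m `^ (p / 2) * m `^ (1 - p / 2) = m.
  by rewrite -powRD ?(gt_eqF m0) ?implybT// subrKC powRr1 ?(ltW m0).
move: mE mE1; set x := (m / n) `^ _; set y := n `^ _; set z := m `^ (1 - _) => mE mE1.
rewrite (_ : x * x / m * (y * z) = x * (x * y * z) / m); last by ring.
by rewrite mE mE1 mulfK// gt_eqF.
Qed.

Lemma tail_scaling (R : realType) (p m n : R) : 0 < m -> 0 < n ->
  (m / n) `^ p / m * n = (m / n) `^ (p - 1).
Proof.
move=> m0 n0; have mn0 : 0 < m / n by exact: divr_gt0.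
have -> : (m / n) `^ p = (m / n) `^ (p - 1) * (m / n).
  rewrite -[X in _ = _ * X]powRr1 ?(ltW mn0)// -powRD ?subrK//.
  by rewrite (gt_eqF mn0) implybT.
by field; rewrite !gt_eqF.
Qed.

Lemma hoelder_factorE (R : realType) (p : R) (N V : \bar R) : 2 < p ->
  N \is a fin_num -> (0 <= N)%E -> (0 <= V)%E ->
  ((N `^ ((p - 2) / (p - 1)) * V `^ (p - 1)^-1) `^ (p / 2) =
   ((fine N `^ p) `^ ((p - 2) / (2 * (p - 1))))%:E * V `^ (p / (2 * (p - 1))))%E.
Proof.
move=> p2 Nfin N0 V0; rewrite poweRM ?poweR_ge0// -!poweRrM -powRrM.
rewrite -{1}[N]fineK// poweR_EFin.
have p1 : p - 1 != 0 by rewrite gt_eqF//; lra.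
by congr ((_ `^ _)%:E * _ `^ _)%E; field.
Qed.

Local Open Scope ereal_scope.

Theorem proposition4p1 (R : realType) (d : measure_display)
  (Omega : measurableType d) (P : probability Omega R)
  (Y : int -> {RV P >-> R}) (f : R -> R)
  (hY : strictly_stationary Y) (hf : marginal_density Y f)
  (kappa1 : int -> R.-pker (Fsigma Y 0) ~> R)
  (hkappa1 : forall k, is_cond_dist (Y k) (kappa1 k))
  (kappa2 : int -> int -> R.-pker (Fsigma Y 0) ~> (R * R)%type)
  (hkappa2 : forall i j, is_cond_dist (fun w => (Y i w, Y j w)) (kappa2 i j))
  (r : nat) (Q : 'I_r.+1 -> {poly R}) (hQ : orthonormal_poly_basis Q)
  (dR : 'I_r.+1 -> {charge set R -> \bar R})
  (hdR : forall i, is_stieltjes_charge (Rfun (Q i)) (dR i))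
  (m : nat -> nat) (hm : forall n, (0 < n)%N -> (0 < m n)%N)
  (p : R) (hp : (2 < p)%R)
  (hfp : (f \* \1_(`[0%R, 1%R]))%R \in Lfun (@lebesgue_measure R) p%:E) :
  exists2 C : R, (0 < C)%R & forall n : nat, (0 < n)%N ->
    \int[P]_w \int[@lebesgue_measure R]_(x in `[0%R, 1%R])
      (`| (estimator Y Q (m n) n w x)%:E
          - 'E_P[fun v => estimator Y Q (m n) n v x] | `^ p)
    <= C%:E * (((m n)%:R / n%:R) `^ (p / 2)%R)%:E * C1 Q dR p
         * (Lnorm (@lebesgue_measure R) p%:E
              (EFin \o (f \* \1_(`[0%R, 1%R]))%R) `^ ((p - 2) / (p - 1))%R
            * V1 kappa1 p n `^ ((p - 1)^-1)%R) `^ (p / 2)%R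
       + C%:E * (((m n)%:R / n%:R) `^ (p - 1)%R)%:E * C2 Q dR p
         * V2 kappa1 kappa2 p n.
Proof.
have [M [D [D' [[M0 D0 D'0 MD] [QM gD g2D]]]]] := uniform_constants Q.
have [C0 C00 HC0] : exists2 C0, (0 < C0)%R & moment_bound p (2 * M)%R C0.
  by apply: moment_inequality => //; rewrite mulr_gt0.
have [K0 K00 HK0] := sum_scales_le hp.
have [c c0 [cC1 cC2]] := constants_gt0 hQ hdR hp.
have p1 : (0 < p - 1)%R by lra.
pose fc := family_const M D D' p C0 K0.
have fc0 : (0 < fc)%R.
  have DD : (0 < dev_bound M D D')%R by exact: dev_bound_gt0.
  have MM : (0 < 2 * M)%R by exact: mulr_gt0.
  apply: mulr_gt0 => //; apply: addr_gt0.
    apply: addr_gt0; last exact: mulr_gt0.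
    by apply: mulr_gt0; apply: powR_gt0 => //; exact: mulr_gt0.
  by apply: mulr_gt0 => //; apply: mulr_gt0 => //; apply: mulr_gt0 => //; exact: addr_gt0.
pose L := ((r.+1%:R * M) `^ p)%R.
have L0 : (0 < L)%R by rewrite powR_gt0// mulr_gt0.
pose K := (r.+1%:R * (fc * L))%R.
have K1 : (0 < K)%R by apply: mulr_gt0 => //; exact: mulr_gt0.
exists (K / c)%R; first exact: divr_gt0.
move=> n n0; have m0 := hm n n0.
have [nR mR] : (0 < n%:R :> R)%R /\ (0 < (m n)%:R :> R)%R by rewrite !ltr0n.
have V1_0 : 0 <= V1 kappa1 p n.
  apply: sume_ge0 => k _; rewrite mule_ge0 ?lee_fin ?powR_ge0//.
  by apply: integral_ge0 => w _; exact: b1_ge0.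
have V2_0 : 0 <= V2 kappa1 kappa2 p n.
  by apply: sume_ge0 => k _; rewrite mule_ge0 ?lee_fin ?powR_ge0// beta2_ge0.
rewrite (hoelder_factorE hp (Lnorm_density_fin hfp)) ?Lnorm_ge0//.
set N := fine _; set e := ((p - 2) / (2 * (p - 1)))%R.
set A := (((m n)%:R / n%:R) `^ (p / 2))%R; set B := (((m n)%:R / n%:R) `^ (p - 1))%R.
set G := _ * V1 _ _ _ `^ _.
have e0 : (0 <= e)%R by rewrite divr_ge0 ?mulr_ge0//; lra.
have A0 : (0 <= A)%R by exact: powR_ge0.
have B0 : (0 <= B)%R by exact: powR_ge0.
have G0 : 0 <= G by rewrite mule_ge0 ?poweR_ge0// lee_fin powR_ge0.
have cell_le (i : 'I_r.+1) : (loss_const r M p (m n) n)%:E *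
    (\sum_(j < m n) \int[P]_w
      (`|partial_sum (fun k => obs Y (local_poly Q i j) k%:Z) n w| `^ p)%R)%R%:E <=
    (fc * L)%:E * (A%:E * G + B%:E * V2 kappa1 kappa2 p n).
  have loss0 : (0 <= loss_const r M p (m n) n)%R.
    by rewrite /loss_const divr_ge0 ?mulr_ge0 ?powR_ge0.
  have H := @family_moment _ _ _ P Y hY kappa1 kappa2 hkappa1 hkappa2 (m n)
    (local_poly Q i) (cell (m n)) M D D' M0 D0 D'0 MD
    (fun j => measurable_cell j) (sum_cell_le1 (m n))
    (fun j => measurable_local_poly Q i j) (local_poly_le QM i)
    (fun j => gD i (m n) j m0) (fun j => g2D i (m n) j m0) p n hp C0 K0
    C00 K00 n0 HC0 HK0.
  apply: le_trans (lee_wpmul2l _ H) _; first by rewrite lee_fin.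
  have W_le : (n%:R `^ (p / 2) * (\sum_(j < m n) cell_prob Y (cell (m n)) j `^ p) `^ e <=
      n%:R `^ (p / 2) * (m n)%:R `^ ((1 - p) * e) * (N `^ p) `^ e)%R.
    rewrite -mulrA ler_wpM2l ?powR_ge0// [(_ `^ (_ * e))%R]powRrM -powRM ?powR_ge0//.
    apply: powR_le => //; first by apply: sumr_ge0 => j _; exact: powR_ge0.
    exact: (sum_cell_prob_le hf hp hfp m0).
  have V1e0 : 0 <= V1 kappa1 p n `^ (p / (2 * (p - 1))) by exact: poweR_ge0.
  have W0 : (0 <= n%:R `^ (p / 2) * (\sum_(j < m n) cell_prob Y (cell (m n)) j `^ p) `^ e)%R.
    by rewrite mulr_ge0 ?powR_ge0.
  rewrite muleA -EFinM muleDr//; last first.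
    by rewrite ge0_adde_def// inE mule_ge0// lee_fin.
  rewrite muleDr//; last first.
    by rewrite ge0_adde_def// inE mule_ge0// lee_fin.
  have fcL0 : (0 <= fc * L)%R by rewrite mulr_ge0// ltW.
  apply: leeD.
    rewrite /G !muleA -!EFinM lee_wpmul2r// lee_fin.
    rewrite /A -(variance_scaling hp mR nR) -/e.
    rewrite (@le_trans _ _ (loss_const r M p (m n) n * fc *
      (n%:R `^ (p / 2) * (m n)%:R `^ ((1 - p) * e) * (N `^ p) `^ e))%R)//.
      by rewrite ler_wpM2l// mulr_ge0// ltW.
    rewrite le_eqVlt; apply/orP; left; apply/eqP.
    by rewrite /loss_const /L -/fc; ring.
  rewrite !muleA -!EFinM lee_wpmul2r// lee_fin /B -(tail_scaling p mR nR).
  rewrite le_eqVlt; apply/orP; left; apply/eqP.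
  by rewrite /loss_const /L -/fc; ring.
have T0 : 0 <= A%:E * G by rewrite mule_ge0// lee_fin.
have T'0 : 0 <= B%:E * V2 kappa1 kappa2 p n by rewrite mule_ge0// lee_fin.
apply: le_trans (estimator_loss_le hY (m n) hp M0 QM n0) _.
rewrite ge0_sume_distrr; last first.
  move=> i _; rewrite lee_fin; apply: sumr_ge0 => j _.
  by apply: Rintegral_ge0 => w _; exact: powR_ge0.
apply: le_trans (lee_sum _ (fun i _ => cell_le i)) _.
have fcL0 : (0 <= fc * L)%R by rewrite mulr_ge0// ltW.
rewrite -ge0_sume_distrl; last by move=> i _; rewrite lee_fin.
have -> : \sum_(i < r.+1) (fc * L)%:E = K%:E.
  by rewrite sumEFin sumr_const card_ord -[(_ *+ r.+1)%R]mulr_natl.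
rewrite muleDr//; last by rewrite ge0_adde_def// inE.
(* [K / c] is the constant: one factor [c] is returned by [C1], or by [C2]. *)
have KcE : K%:E = (K / c)%:E * c%:E by rewrite -EFinM divfK// gt_eqF.
have Kc0 : 0 <= (K / c)%:E by rewrite lee_fin divr_ge0// ltW.
have distribute (a x y z : \bar R) : 0 <= a -> 0 <= x -> 0 <= z -> c%:E <= y ->
    a * c%:E * (x * z) <= a * x * y * z.
  move=> a0 x0 z0 cy; rewrite -!muleA; apply: lee_wpmul2l => //.
  by rewrite [leRHS]muleCA; apply: lee_wpmul2r => //; exact: mule_ge0.
by rewrite KcE; apply: leeD; apply: distribute => //; rewrite lee_fin.
Qed.
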